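(* Let $u_0\in L^1(\mathbb{R})\cap L^\infty(\mathbb{R})$ and let $u$ be the solution of $$u_t(x,t)=\int_{\mathbb{R}}J(x-y)\,(u(y,t)-u(x,t))\,dy,\quad x\in\mathbb{R},\ t>0,\qquad u(x,0)=u_0(x),\quad x\in\mathbb{R}.$$ Then for any $p\in[1,\infty]$, $$\lim_{t\to\infty}t^{\frac12\left(1-\frac1p\right)}\,\|u(t)-MG_{At}\|_{L^p(\mathbb{R})}=0,$$ where $G_t(x)=\frac{1}{\sqrt{4\pi t}}\exp\left(-\frac{x^2}{4t}\right)$ is the heat kernel, $M=\int_{\mathbb{R}}u_0(x)\,dx$ and $A=\frac12\int_{\mathbb{R}}J(z)z^2\,dz$.
   Context: Standing assumptions: $J:\mathbb{R}\to\mathbb{R}$ is a nonnegative, smooth, even function, rapidly decaying at infinity (in the Schwartz class), with $\int_{\mathbb{R}}J(s)\,ds=1$. The solution $u$ is the unique solution in $C^1([0,\infty);L^1(\mathbb{R}))$ of the linear equation $u_t=J*u-u$ with $u(0)=u_0$, where $*$ is convolution in $x$. When $p=\infty$, $1/p$ means $0$. $u(t)$ denotes the function $u(\cdot,t)$. *)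

(* Defs.v *)
From HB Require Import structures.
From mathcomp Require Import all_boot all_order all_algebra.
From mathcomp Require Import all_classical all_reals all_analysis.

Set Implicit Arguments.
Unset Strict Implicit.
Unset Printing Implicit Defensive.

Import Order.TTheory GRing.Theory Num.Theory.
Import numFieldNormedType.Exports.

Local Open Scope classical_set_scope.
Local Open Scope ring_scope.

Definition smooth (R : realType) (f : R -> R) : Prop :=
  forall (n : nat) (x : R), derivable (derive1n n f) x 1.

Definition schwartz (R : realType) (f : R -> R) : Prop :=
  smooth f /\
  forall m n : nat, exists C : R, forall x : R, `|x| ^+ m * `|derive1n n f x| <= C.

Definition even_fun (R : realType) (f : R -> R) : Prop :=
  forall x : R, f (- x) = f x.

(* Elements of L^p(R) are represented by Borel functions in [Lfun]; the library
   puts no topology on its Lebesgue spaces, so convergence in L^1(R) is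
   convergence to 0 of the L^1 norm of the difference. *)
Definition cvg_L1 (R : realType) (F : set_system R) (f : R -> R -> R)
    (l : R -> R) : Prop :=
  ('N[@lebesgue_measure R]_1[EFin \o (fun x => (f s x - l x)%R)])%E @[s --> F]
    --> 0%E.

(* [du] is the derivative of the curve [u] in C^1([0, +oo); L^1(R)); it is
   one-sided at t = 0. *)
Definition C1_L1_derivative (R : realType) (u du : R -> R -> R) : Prop :=
  [/\ forall t : R, 0 <= t ->
        u t \in Lfun (@lebesgue_measure R) 1%E /\
        du t \in Lfun (@lebesgue_measure R) 1%E,
      forall t : R, 0 <= t ->
        cvg_L1 (within [set h : R | 0 <= t + h] 0^')
          (fun h x => h^-1 * (u (t + h) x - u t x)) (du t)
    & forall t : R, 0 <= t ->
        cvg_L1 (within [set s : R | 0 <= s] (nbhs t)) du (du t)].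

(* The variables are in the order [u t x], so that [u t] is u(., t). *)
Definition nonlocal_diffusion_solution (R : realType) (J u0 : R -> R)
    (u : R -> R -> R) : Prop :=
  exists2 du : R -> R -> R, C1_L1_derivative u du &
    (forall t : R, 0 < t -> {ae @lebesgue_measure R, forall x : R,
       du t x =
       (\int[@lebesgue_measure R]_y (J (x - y) * (u t y - u t x)))%R}) /\
    {ae @lebesgue_measure R, forall x : R, u 0 x = u0 x}.

Definition heat_kernel (R : realType) (t x : R) : R :=
  (Num.sqrt (4 * pi * t))^-1 * expR (- (x ^+ 2 / (4 * t))).

(* Main.v *)
(* Pair the solution with bounded functions g, so that L^1 norms become suprema
   of such pairings. The pairings s |-> \int u(s) g obey a linear equation, and
   Euler's scheme with step h = t / n gives
     \int u(t) g = \int u0 W^n g + O(1 / n),    W g = (1 - h) g + h (J * g),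
   so the semigroup is replaced by the iterates of one Markov operator W.
   - Smoothing: if J >= c k with k a probability density, then W = a K + (1 - a) Q
     with K = k * . and Q Markov and commuting with K, a = h c. The Stein
     identity of the binomial law bounds W^n (K - Q) by 1 / sqrt (n a (1 - a)).
     Using k and its small translates, W^n moves by O((1 + |y|) / sqrt t) under
     a translation by y, in L^oo and, by duality, in L^1.
   - Comparison: a Lindeberg telescoping compares W^n G_tau with the heat kernel
     at time tau + t; with tau = t^(3/4) the error of smoothing the datum by
     G_tau and the third order Taylor error t tau^(-3/2) are both O(t^(-1/8)).
     This yields convergence in L^1.
   - L^oo: the iterates W^n u0 vary by O((1 + |y|) / t) over a distance y, hence
     averaging over an interval of length l = b sqrt t turns smallness in L^1
     into smallness o(t^(-1/2)) in L^oo.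
   The other exponents follow by interpolation. *)

Require Import Defs.
From HB Require Import structures.
From mathcomp Require Import all_boot all_order all_algebra.
From mathcomp Require Import all_classical all_reals all_analysis.
From mathcomp Require Import measurable_realfun ess_sup_inf ring lra.

Set Implicit Arguments.
Unset Strict Implicit.
Unset Printing Implicit Defensive.

Import Order.TTheory GRing.Theory Num.Theory.
Import numFieldNormedType.Exports.

Local Open Scope classical_set_scope.
Local Open Scope ring_scope.

(** * Integration on the line *)

(** The operator [J * f - f] does not regularise: an Euler iterate keeps the part [(1 - h)^n f] of
    its datum, close to [exp (- t) f]. Hence no derivative of the solution is ever estimated.
    Regularity is measured by finite differences, and the bound [1 + |y|] does not vanish with [y].
    The only source of decay is a count: exchanging one factor [K] for one factor [Q] among [n + 1]
    commuting factors shifts by one a binomial variable whose standard deviation is of order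
    [sqrt t]. Limits are taken in a fixed order. The constant of the Euler error depends on [t], so
    [n] goes to infinity first, at fixed [t]; this is harmless because the bounds on the iterates
    involve only [n h = t] once [n] is large. Then [t] grows. The iterates are functions bounded at
    every point, while [u t] is only their limit in [L^1]; a uniform bound on them therefore reaches
    [u t] almost everywhere. What is used of [J] is its mass, evenness, boundedness and third
    moment, and a density, uniform on a short interval, small translates of which fit below [J]
    after scaling. *)

Definition integ (R : realType) (f : R -> R) : Prop :=
  (@lebesgue_measure R).-integrable [set: R] (EFin \o f).

(** The bound holds at every point rather than almost everywhere, so that operators act on genuine
    functions and values at a given point make sense. *)
Definition bm (R : realType) (m : R) (f : R -> R) : Prop :=
  measurable_fun [set: R] f /\ forall x, `|f x| <= m.

Section line.
Context {R : realType}.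
Local Notation mu := (@lebesgue_measure R).
Implicit Types (f g : R -> R) (a m : R).

Lemma integ_meas f : integ f -> measurable_fun [set: R] f.
Proof. by move=> /measurable_int /measurable_EFinP. Qed.

Lemma integ_dom f g : measurable_fun [set: R] f -> integ g ->
  (forall x, `|f x| <= g x) -> integ f.
Proof.
move=> mf ig fg; apply: (le_integrable measurableT _ _ ig).
  exact/measurable_EFinP.
by move=> x _ /=; rewrite lee_fin (le_trans (fg x))// ler_norm.
Qed.

Lemma integ_norm f : integ f -> integ (fun x => `|f x|).
Proof. by move=> /integrable_norm. Qed.

Lemma integD f g : integ f -> integ g -> integ (fun x => f x + g x).
Proof. by move=> h k; exact: (integrableD measurableT h k). Qed.

Lemma integB f g : integ f -> integ g -> integ (fun x => f x - g x).
Proof. by move=> h k; exact: (integrableB measurableT h k). Qed.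

Lemma integZ c f : integ f -> integ (fun x => c * f x).
Proof. by move=> h; exact: (integrableZl measurableT c h). Qed.

Lemma integ_bm f g m : integ f -> bm m g -> integ (fun x => f x * g x).
Proof.
move=> iF [mg gm]; apply: (integ_dom _ (integZ m (integ_norm iF))).
  exact: measurable_funM (integ_meas iF) mg.
by move=> x; rewrite normrM mulrC ler_wpM2r.
Qed.

Lemma IntD f g : integ f -> integ g ->
  (\int[mu]_x (f x + g x) = \int[mu]_x f x + \int[mu]_x g x)%R.
Proof. exact: (RintegralD measurableT). Qed.

Lemma IntB f g : integ f -> integ g ->
  (\int[mu]_x (f x - g x) = \int[mu]_x f x - \int[mu]_x g x)%R.
Proof. exact: (RintegralB measurableT). Qed.

Lemma IntZ c f : integ f -> (\int[mu]_x (c * f x) = c * \int[mu]_x f x)%R.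
Proof. exact: (RintegralZl c measurableT). Qed.

Lemma IntZr c f : integ f -> (\int[mu]_x (f x * c) = \int[mu]_x f x * c)%R.
Proof. exact: (RintegralZr c measurableT). Qed.

Lemma le_Int f g : integ f -> integ g -> (forall x, f x <= g x) ->
  (\int[mu]_x f x <= \int[mu]_x g x)%R.
Proof. by move=> h k l; exact: le_Rintegral. Qed.

Lemma Int_norm_le f : integ f ->
  (`|\int[mu]_x f x| <= \int[mu]_x `|f x|)%R.
Proof. exact: (le_normr_Rintegral measurableT). Qed.

Lemma Int_norm_dom f g : integ f -> integ g -> (forall x, `|f x| <= g x) ->
  (`|\int[mu]_x f x| <= \int[mu]_x g x)%R.
Proof.
move=> h k l; apply: (le_trans (Int_norm_le h)).
by apply: le_Int => //; exact: integ_norm.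
Qed.

Lemma Int_ext f g : f =1 g -> (\int[mu]_x f x = \int[mu]_x g x)%R.
Proof. by move=> fg; congr (Rintegral _ _ _); exact/funext. Qed.

Lemma Int_EFin f : integ f ->
  ((\int[mu]_x (f x)%:E) = (\int[mu]_x f x)%R%:E)%E.
Proof. by move=> iF; rewrite fineK//; exact: integrable_fin_num. Qed.

Lemma ae_sub (P Q : R -> Prop) : (forall x, P x -> Q x) ->
  {ae mu, forall x, P x} -> {ae mu, forall x, Q x}.
Proof. by apply: filterS; exact: (ae_filter_ringOfSetsType mu). Qed.

Lemma ae_sub2 (P Q S : R -> Prop) : (forall x, P x -> Q x -> S x) ->
  {ae mu, forall x, P x} -> {ae mu, forall x, Q x} -> {ae mu, forall x, S x}.
Proof. by apply: filterS2; exact: (ae_filter_ringOfSetsType mu). Qed.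

Lemma Int_ae f g : integ f -> measurable_fun [set: R] g ->
  {ae mu, forall x, f x = g x} ->
  integ g /\ (\int[mu]_x f x = \int[mu]_x g x)%R.
Proof.
move=> iF mg fg.
have mfE := integ_meas iF.
have fgE : ae_eq mu [set: R] (EFin \o f) (EFin \o g).
  by move: fg; apply: ae_sub => x /= ->.
split.
  apply/integrableP; split; first exact/measurable_EFinP.
  rewrite (_ : (\int[mu]_x _)%E = (\int[mu]_x `|(f x)%:E|)%E); last first.
    apply: ae_eq_integral => //.
    - by apply/measurable_EFinP; exact: measurableT_comp.
    - by apply/measurable_EFinP; exact: measurableT_comp.
    - by move: fg; apply: ae_sub => x /= ->.
  by case/integrableP : iF.
rewrite /Rintegral; congr fine; apply: ae_eq_integral => //;
  exact/measurable_EFinP.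
Qed.

Lemma measurable_addr a : measurable_fun [set: R] (fun x => x + a).
Proof. exact: measurable_funD. Qed.

(** By uniqueness of Lebesgue measure it is enough to compare lengths of half-open intervals. *)
Lemma lebesgue_measure_addr a (A : set R) : measurable A ->
  pushforward mu ((fun x => x + a) : _ -> measurableTypeR R) A = mu A.
Proof.
move=> mA; apply/esym/lebesgue_measure_unique => //=; first exact: measurable_addr.
move=> mt X [[b c] _ <-]; rewrite /pushforward.
rewrite (_ : _ @^-1` _ = `]b - a, c - a]%classic); last first.
  by apply/seteqP; split => x /=; rewrite !in_itv/= ltrBlDr lerBrDr.
rewrite !lebesgue_measure_itv/= !lte_fin ltrD2r.
by case: ifPn => // _; rewrite -!EFinD; congr EFin; ring.
Qed.

Lemma ge0_integral_shift a (f : R -> \bar R) : measurable_fun [set: R] f ->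
  (forall x, 0 <= f x)%E -> (\int[mu]_x f (x + a)%R = \int[mu]_x f x)%E.
Proof.
move=> mf f0.
have mt : measurable_fun [set: R] ((fun x => x + a) : _ -> measurableTypeR R).
  exact: measurable_addr.
transitivity
    (\int[pushforward mu ((fun x : R => x + a)%R : _ -> measurableTypeR R)]_x f x)%E.
  by rewrite ge0_integral_pushforward.
by apply: eq_measure_integral => A mA _; exact/lebesgue_measure_addr.
Qed.

Lemma integ_shift a f : integ f -> integ (fun x => f (x + a)).
Proof.
move=> /integrableP[mf foo]; apply/integrableP; split.
  exact: (measurableT_comp mf (measurable_addr a)).
rewrite (ge0_integral_shift a (f := fun x => `|(f x)%:E|)%E)//.
exact: measurableT_comp.
Qed.

(** The positive and negative parts are shifted separately, so the identity covers infinite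
    integrals too. *)
Lemma Int_shift a f : measurable_fun [set: R] f ->
  (\int[mu]_x f (x + a) = \int[mu]_x f x)%R.
Proof.
move=> /measurable_EFinP mf; rewrite /Rintegral; congr fine.
rewrite integralE [in RHS]integralE; congr (_ - _)%E.
  rewrite -[RHS](ge0_integral_shift a)//.
    by apply: eq_integral => x _; rewrite !funeposE.
  exact: measurable_funepos.
rewrite -[RHS](ge0_integral_shift a)//.
  by apply: eq_integral => x _; rewrite !funenegE.
exact: measurable_funeneg.
Qed.

Lemma measurable_Int_param (F : R * R -> R) : measurable_fun [set: R * R] F ->
  measurable_fun [set: R] (fun x => \int[mu]_y F (x, y))%R.
Proof.
move=> /measurable_EFinP mF; apply: measurableT_comp => //.
under eq_fun do rewrite integralE.
apply: emeasurable_funB.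
  rewrite (_ : (fun x => _) = fubini_F mu (EFin \o F)^\+%E).
    apply: (@measurable_fun_fubini_tonelli_F _ _ _ _ _ mu) => //.
    exact: measurable_funepos.
  by apply/funext => x; apply: eq_integral => y _; rewrite !funeposE.
rewrite (_ : (fun x => _) = fubini_F mu (EFin \o F)^\-%E).
  apply: (@measurable_fun_fubini_tonelli_F _ _ _ _ _ mu) => //.
  exact: measurable_funeneg.
by apply/funext => x; apply: eq_integral => y _; rewrite !funenegE.
Qed.

Lemma Fubini_integrable (F : R * R -> R) g : measurable_fun [set: R * R] F ->
  (forall y, integ (fun x => F (x, y))) -> integ g ->
  (forall y, (\int[mu]_x `|F (x, y)|)%R <= g y) ->
  (mu \x mu)%E.-integrable [set: R * R] (EFin \o F).
Proof.
move=> mF iF ig Fg.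
have mF' : measurable_fun [set: R * R] (EFin \o F) by exact/measurable_EFinP.
apply/(integrable21ltyP mu mu mF') => /=.
apply: (@le_lt_trans _ _ (\int[mu]_y `|(g y)%:E|)%E); last first.
  by case/integrableP : ig.
apply: ge0_le_integral => //=.
- by move=> y _; exact: integral_ge0.
- apply: (@measurable_fun_fubini_tonelli_G _ _ _ _ _ mu (fun z => `|(F z)%:E|)%E) => //.
  exact: (@measurableT_comp _ _ _ _ _ _ _ _ _ (@abse_measurable R setT) mF').
- have [mg _] := integrableP _ _ _ ig.
  exact: (@measurableT_comp _ _ _ _ _ _ _ _ _ (@abse_measurable R setT) mg).
- move=> y _; apply: (@le_trans _ _ (g y)%:E); last by rewrite lee_fin ler_norm.
  by rewrite (Int_EFin (integ_norm (iF y))) lee_fin.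
Qed.

(** Fubini with a one-sided criterion: [g] dominates the [L^1] norms of the slices in the first
    variable. In most uses [g] is a multiple of the absolute value of one factor of [F]. *)
Lemma Int_swap (F : R * R -> R) g : measurable_fun [set: R * R] F ->
  (forall y, integ (fun x => F (x, y))) -> (forall x, integ (fun y => F (x, y))) ->
  integ g -> (forall y, (\int[mu]_x `|F (x, y)|)%R <= g y) ->
  [/\ integ (fun x => \int[mu]_y F (x, y))%R,
      integ (fun y => \int[mu]_x F (x, y))%R &
      (\int[mu]_x \int[mu]_y F (x, y) = \int[mu]_y \int[mu]_x F (x, y))%R].
Proof.
move=> mF iF1 iF2 ig Fg.
have iF := Fubini_integrable mF iF1 ig Fg.
have E1 x : (\int[mu]_y F (x, y))%R%:E = (\int[mu]_y (F (x, y))%:E)%E.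
  by rewrite Int_EFin.
have E2 y : (\int[mu]_x F (x, y))%R%:E = (\int[mu]_x (F (x, y))%:E)%E.
  by rewrite Int_EFin.
split.
- rewrite /integ (_ : _ \o _ = fubini_F mu (EFin \o F)); last first.
    by apply/funext => x; rewrite /= E1.
  exact: (integrable_fubini_F iF).
- apply: (integ_dom _ ig) => [|y].
    apply: (measurable_Int_param (F := fun z => F (z.2, z.1))).
    exact: (measurableT_comp mF (@measurable_swap _ _ R R)).
  by apply: (le_trans (Int_norm_le (iF1 y))).
- rewrite [LHS]/Rintegral [RHS]/Rintegral; congr fine.
  under eq_integral do rewrite E1.
  under [in RHS]eq_integral do rewrite E2.
  exact: (Fubini iF).
Qed.

End line.

(** * Markov operators and the binomial law *)

(** The recursion splits off one trial, which is how [iter_bexp] expands a power of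
    [a K + (1 - a) Q] one factor at a time. *)
Fixpoint bexp (R : realType) (a : R) (n : nat) (f : nat -> R) : R :=
  if n is n'.+1 then a * bexp a n' (fun k => f k.+1) + (1 - a) * bexp a n' f
  else f 0%N.

Section binomial_expectation.
Context {R : realType}.
Implicit Types (a : R) (f g : nat -> R).

Lemma bexp_ext a n f g : (forall k, (k <= n)%N -> f k = g k) ->
  bexp a n f = bexp a n g.
Proof.
elim: n f g => [|n IH] f g fg /=; first exact: fg.
by congr (_ * _ + _ * _); apply: IH => k kn; apply: fg => //; exact: ltnW.
Qed.

Lemma bexp_lin a n (b c : R) f g :
  bexp a n (fun k => b * f k + c * g k) = b * bexp a n f + c * bexp a n g.
Proof. by elim: n f g => [|n IH] f g //=; rewrite !IH; ring. Qed.

Lemma bexp_cst a n (c : R) : bexp a n (fun=> c) = c.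
Proof. by elim: n => [|n IH] //=; rewrite !IH; ring. Qed.

Lemma bexp_le a n f g : 0 <= a <= 1 -> (forall k, f k <= g k) ->
  bexp a n f <= bexp a n g.
Proof.
move=> /andP[a0 a1]; elim: n f g => [|n IH] f g fg //=.
by apply: lerD; apply: ler_wpM2l; rewrite ?subr_ge0//; exact: IH.
Qed.

(* [bexp a n f] is the expectation of [f] under the binomial law of parameters
   [n] and [a]; this is the Stein identity of that law. *)
Lemma bexp_stein a n g :
  bexp a n.+1 (fun k => (k%:R - n.+1%:R * a) * g k) =
  n.+1%:R * a * (1 - a) * bexp a n (fun k => g k.+1 - g k).
Proof.
elim: n g => [|n IH] g; first by rewrite /=; ring.
have E f : bexp a n.+2 f =
  a * bexp a n.+1 (fun k => f k.+1) + (1 - a) * bexp a n.+1 f by [].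
rewrite {}E.
have -> : bexp a n.+1 (fun k => (k.+1%:R - n.+2%:R * a) * g k.+1) =
  bexp a n.+1 (fun k => 1 * ((k%:R - n.+1%:R * a) * g k.+1) + (1 - a) * g k.+1).
  by apply: bexp_ext => k _; ring.
have -> : bexp a n.+1 (fun k => (k%:R - n.+2%:R * a) * g k) =
  bexp a n.+1 (fun k => 1 * ((k%:R - n.+1%:R * a) * g k) + (- a) * g k).
  by apply: bexp_ext => k _; ring.
rewrite !bexp_lin (IH (fun k => g k.+1)) IH.
have -> : bexp a n.+1 (fun k => g k.+1 - g k) =
  bexp a n.+1 (fun k => 1 * g k.+1 + -1 * g k).
  by apply: bexp_ext => k _; ring.
rewrite bexp_lin.
have E : bexp a n.+1 (fun k => 1 * g k.+1 + -1 * g k) =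
  a * bexp a n (fun k => g k.+2 - g k.+1) + (1 - a) * bexp a n (fun k => g k.+1 - g k).
  by congr (_ * _ + _ * _); apply: bexp_ext => k _; ring.
rewrite bexp_lin in E.
transitivity (n.+1%:R * a * (1 - a) *
  (a * bexp a n (fun k => g k.+2 - g k.+1) + (1 - a) * bexp a n (fun k => g k.+1 - g k))
  + a * (1 - a) * (1 * bexp a n.+1 (fun k => g k.+1) + -1 * bexp a n.+1 g)).
  by ring.
by rewrite -E -!natr1; ring.
Qed.

(** The Stein identity for the centred variable itself, whose increments are 1. *)
Lemma bexp_var a n :
  bexp a n.+1 (fun k => (k%:R - n.+1%:R * a) ^+ 2) = n.+1%:R * a * (1 - a).
Proof.
rewrite (bexp_stein a n (fun k => k%:R - n.+1%:R * a)).
rewrite (@bexp_ext a n _ (fun=> 1)) ?bexp_cst ?mulr1// => k _.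
by rewrite -(natr1 k); ring.
Qed.

(** The Stein identity turns the mean increment of [g] into a covariance with the centred variable
    of [n.+1] trials, at most [m] times its mean absolute deviation. That deviation is at most
    [sqrt V], and division by [V] leaves [m / sqrt V]. *)
Lemma bexp_diff a n g m : 0 < a < 1 -> (forall k, `|g k| <= m) ->
  `|bexp a n (fun k => g k.+1 - g k)| <= m / Num.sqrt (n.+1%:R * a * (1 - a)).
Proof.
move=> /andP[a0 a1] gm.
set V := n.+1%:R * a * (1 - a).
have V0 : 0 < V by rewrite !mulr_gt0// subr_gt0.
set s := Num.sqrt V; have s0 : 0 < s by rewrite sqrtr_gt0.
have sV : s * s = V by rewrite -expr2 sqr_sqrtr// ltW.
have m0 : 0 <= m := le_trans (normr_ge0 _) (gm 0%N).
have a01 : 0 <= a <= 1 by rewrite !ltW.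
have H : `|V * bexp a n (fun k => g k.+1 - g k)| <= m * s.
  rewrite -bexp_stein.
  (* Cauchy-Schwarz is replaced by the pointwise inequality [|d| <= d^2 / (2 s) + s / 2]; with
     [s = sqrt V] both terms have mean [s / 2]. *)
  have B k : `|(k%:R - n.+1%:R * a) * g k| <=
      (m * s^-1 / 2) * (k%:R - n.+1%:R * a) ^+ 2 + (m * s / 2) * 1.
    set d := k%:R - _.
    rewrite normrM (le_trans (ler_wpM2l (normr_ge0 _) (gm k)))//.
    rewrite -subr_ge0.
    have -> : m * s^-1 / 2 * d ^+ 2 + m * s / 2 * 1 - `|d| * m =
      m * s^-1 / 2 * (`|d| - s) ^+ 2.
      rewrite -(real_normK (num_real d)) sqrrB.
      have -> : m * s / 2 * 1 = m * s^-1 / 2 * s ^+ 2.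
        by field; rewrite gt_eqF.
      by field; rewrite gt_eqF.
    by rewrite mulr_ge0 ?sqr_ge0// divr_ge0// divr_ge0// ltW.
  have -> : m * s = bexp a n.+1
      (fun k => (m * s^-1 / 2) * (k%:R - n.+1%:R * a) ^+ 2 + (m * s / 2) * 1).
    rewrite bexp_lin bexp_var bexp_cst -/V -sV.
    by field; rewrite gt_eqF.
  rewrite ler_norml; apply/andP; split.
    rewrite -mulN1r -[_ * bexp _ _ _]addr0 -(mul0r (bexp a n.+1 (fun=> 0))) -bexp_lin.
    apply: bexp_le => // k; rewrite mul0r addr0 mulN1r.
    by have := B k; rewrite ler_norml => /andP[].
  by apply: bexp_le => // k; exact: le_trans (ler_norm _) (B k).
rewrite normrM gtr0_norm// in H.
rewrite -(ler_pM2l V0) (le_trans H)// -sV le_eqVlt; apply/orP; left.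
by apply/eqP; field; rewrite gt_eqF.
Qed.

End binomial_expectation.

Definition lincomb (R : realType) (a b : R) (f g : R -> R) : R -> R :=
  fun x => a * f x + b * g x.

(** Contraction of the sup norm and linearity on bounded functions are what is kept of a Markov
    operator. Both can be checked directly for a difference of operators, such as [Q] in
    [walk_conv]. *)
Definition markov_op (R : realType) (N : (R -> R) -> (R -> R)) : Prop :=
  (forall m f, bm m f -> bm m (N f)) /\
  (forall a b m m' f g, bm m f -> bm m' g ->
    N (lincomb a b f g) = lincomb a b (N f) (N g)).

Definition commut (R : realType) (N N' : (R -> R) -> (R -> R)) : Prop :=
  forall m f, bm m f -> N (N' f) = N' (N f).

Section markov_operators.
Context {R : realType}.
Implicit Types (N K Q : (R -> R) -> (R -> R)) (f g : R -> R).

Lemma bm_ge0 m f : bm m f -> 0 <= m.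
Proof. by move=> [_ /(_ 0)]; exact: le_trans (normr_ge0 _). Qed.

Lemma bm_lincomb a b m m' f g : bm m f -> bm m' g ->
  bm (`|a| * m + `|b| * m') (lincomb a b f g).
Proof.
move=> [mf fm] [mg gm]; split.
  by apply: measurable_funD; apply: measurable_funM.
move=> x; rewrite (le_trans (ler_normD _ _))// !normrM.
by apply: lerD; exact: ler_wpM2l.
Qed.

Lemma markov_iter N n : markov_op N -> markov_op (iter n N).
Proof.
move=> [Nb Nl]; elim: n => [|n [IHb IHl]]; first by split.
split=> [m f mf|a b m m' f g mf mg]; first exact/Nb/IHb.
by rewrite iterS (IHl _ _ _ _ _ _ mf mg) (Nl _ _ m m')//; exact: IHb.
Qed.

Lemma commut_iter N K n : markov_op N -> commut N K -> commut (iter n N) K.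
Proof.
move=> mN NK; elim: n => [|n IH] m f mf //.
rewrite iterS (IH _ _ mf) (NK m)//; exact: (markov_iter n mN).1.
Qed.

(** The binomial theorem for commuting operators, read as an expectation. The exponents [i] and [j]
    are general because the induction peels the innermost factor, which adds one [K] or one [Q] to
    the argument. *)
Lemma iter_bexp N K Q (a : R) m f : markov_op N -> markov_op K -> markov_op Q ->
  commut K Q ->
  (forall m g, bm m g -> N g = lincomb a (1 - a) (K g) (Q g)) -> bm m f ->
  forall n i j, iter n N (iter i K (iter j Q f)) =
    fun x => bexp a n (fun k => iter (i + k) K (iter (j + (n - k)) Q f) x).
Proof.
move=> mN mK mQ KQ NE mf.
have mij i j : bm m (iter i K (iter j Q f)).
  by apply: (markov_iter i mK).1; exact: (markov_iter j mQ).1.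
elim=> [|n IH] i j; first by apply/funext => x /=; rewrite !addn0.
rewrite iterSr (NE m)// -[K _]/(iter i.+1 K _).
rewrite -(commut_iter i mK KQ (m := m)) -?[Q _]/(iter j.+1 Q f); last first.
  exact: (markov_iter j mQ).1.
rewrite ((markov_iter n mN).2 _ _ m m)// !IH; apply/funext => x /=.
congr (_ * _ + _ * _); apply: bexp_ext => k kn.
  by rewrite addnS subSS.
by rewrite subSn// addnS.
Qed.

(** Both iterates are expectations of the same sequence [K^k Q^(n + 1 - k) f x], the first one with
    [k] shifted by one. Their difference is a mean increment, bounded by [bexp_diff]. *)
Lemma markov_stein N K Q (a : R) m f : markov_op N -> markov_op K -> markov_op Q ->
  commut K Q -> 0 < a < 1 ->
  (forall m g, bm m g -> N g = lincomb a (1 - a) (K g) (Q g)) -> bm m f ->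
  forall n x, `|iter n N (K f) x - iter n N (Q f) x| <=
    m / Num.sqrt (n.+1%:R * a * (1 - a)).
Proof.
move=> mN mK mQ KQ a01 NE mf n x.
have := iter_bexp mN mK mQ KQ NE mf n 1 0.
have := iter_bexp mN mK mQ KQ NE mf n 0 1.
move=> /= -> ->.
(* Beyond [n.+1] the truncated subtraction gives the exponent 0, so the bound by [m] holds for all
   [k]; only [k <= n.+1] is evaluated. *)
pose g k := iter k K (iter (n.+1 - k) Q f) x.
have gm k : `|g k| <= m.
  by apply: ((markov_iter k mK).1 _ _ ((markov_iter _ mQ).1 _ _ mf)).2.
have := bexp_diff n a01 gm.
rewrite (@bexp_ext R a n _ (fun k => 1 * g k.+1 + -1 * g k)); last first.
  by move=> k _; ring.
rewrite bexp_lin mul1r mulN1r; apply: le_trans.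
rewrite le_eqVlt; apply/orP; left; apply/eqP; congr `|_ - _|.
by apply: bexp_ext => k kn; rewrite /g ?add0n subSn.
Qed.

End markov_operators.

(** * Convolution operators *)

(* With the sign of [x + z] this is the convolution with the reflection of [k]. *)
Definition conv (R : realType) (k f : R -> R) : R -> R :=
  fun x => (\int[@lebesgue_measure R]_z (k z * f (x + z)))%R.

Definition density (R : realType) (k : R -> R) : Prop :=
  [/\ integ k, forall x, 0 <= k x & (\int[@lebesgue_measure R]_x k x)%R = 1].

Definition tau (R : realType) (y : R) (f : R -> R) : R -> R :=
  fun x => f (x + y).

Section convolution.
Context {R : realType}.
Local Notation mu := (@lebesgue_measure R).
Implicit Types (k l f : R -> R) (m : R).

Lemma bm_tau y m f : bm m f -> bm m (tau y f).
Proof.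
move=> [mf fm]; split => [|x]; last exact: fm.
exact: (measurableT_comp mf (measurable_addr y)).
Qed.

Lemma bm_shiftl x m f : bm m f -> bm m (fun z => f (x + z)).
Proof.
by move=> /(bm_tau x); congr bm; apply/funext => z; rewrite /tau addrC.
Qed.

Lemma integ_conv k m f x : integ k -> bm m f -> integ (fun z => k z * f (x + z)).
Proof. by move=> ik mf; apply: (integ_bm (m := m) ik); exact: bm_shiftl. Qed.

Lemma measurable_conv k f : measurable_fun [set: R] k ->
  measurable_fun [set: R] f -> measurable_fun [set: R] (conv k f).
Proof.
move=> mk mf.
apply: (measurable_Int_param (F := fun z => k z.2 * f (z.1 + z.2))).
apply: measurable_funM.
  exact: (measurableT_comp mk measurable_snd).
exact: (measurableT_comp mf (measurable_funD measurable_fst measurable_snd)).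
Qed.

Lemma conv_le k m f x : integ k -> bm m f ->
  `|conv k f x| <= m * (\int[mu]_z `|k z|)%R.
Proof.
move=> ik mf; rewrite /conv -IntZ; last exact: integ_norm.
apply: Int_norm_dom; first exact: (integ_conv (m := m)).
  exact/integZ/integ_norm.
by move=> z; rewrite normrM mulrC ler_wpM2r//; apply: mf.2.
Qed.

Lemma bm_conv k m f : integ k -> bm m f ->
  bm (m * (\int[mu]_z `|k z|)%R) (conv k f).
Proof.
move=> ik mf; split => [|x]; last exact: conv_le.
apply: measurable_conv; [exact: integ_meas|exact: mf.1].
Qed.

Lemma conv_lincomb k a b m m' f g : integ k -> bm m f -> bm m' g ->
  conv k (lincomb a b f g) = lincomb a b (conv k f) (conv k g).
Proof.
move=> ik mf mg; apply/funext => x; rewrite /lincomb /conv.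
have i1 := integ_conv x ik mf; have i2 := integ_conv x ik mg.
rewrite -(IntZ a i1) -(IntZ b i2) -IntD; [|exact: integZ|exact: integZ].
by apply: Int_ext => z /=; ring.
Qed.

Lemma conv_lincombl k l a b m f x : integ k -> integ l -> bm m f ->
  conv (lincomb a b k l) f x = a * conv k f x + b * conv l f x.
Proof.
move=> ik il mf; rewrite /lincomb /conv.
have i1 := integ_conv x ik mf; have i2 := integ_conv x il mf.
rewrite -(IntZ a i1) -(IntZ b i2) -IntD; [|exact: integZ|exact: integZ].
by apply: Int_ext => z /=; ring.
Qed.

Lemma conv_comm k l : integ k -> integ l -> commut (conv k) (conv l).
Proof.
move=> ik il m f mf; apply/funext => x.
pose F (z : R * R) := k z.1 * l z.2 * f (x + z.1 + z.2).
have mF : measurable_fun [set: R * R] F.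
  apply: measurable_funM.
    apply: measurable_funM; first exact: (measurableT_comp (integ_meas ik) measurable_fst).
    exact: (measurableT_comp (integ_meas il) measurable_snd).
  apply: (measurableT_comp mf.1); apply: measurable_funD => //.
  by apply: measurable_funD.
have iF1 y : integ (fun x => F (x, y)).
  rewrite /F/=; have := integZ (l y) (integ_conv (x + y) ik mf).
  by congr integ; apply/funext => z; rewrite (addrAC x y z); ring.
have iF2 y : integ (fun x => F (y, x)).
  rewrite /F/=; have := integZ (k y) (integ_conv (x + y) il mf).
  by congr integ; apply/funext => z; ring.
have [] := Int_swap mF iF1 iF2
  (integZ (m * (\int[mu]_z `|k z|)%R) (integ_norm il)) => [y|_ _].
  rewrite mulrAC -(IntZ _ (integ_norm ik)).
  apply: le_Int; [exact: integ_norm|exact/integZ/integ_norm|move=> z].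
  rewrite /F/= !normrM mulrC -mulrA (mulrC `|k z|) ler_wpM2r ?mulr_ge0//.
  exact: mf.2.
rewrite /F/= => E; transitivity (\int[mu]_y \int[mu]_z (k y * l z * f (x + y + z)))%R.
  apply: Int_ext => y; rewrite -IntZ; last exact: (integ_conv (m := m)).
  by apply: Int_ext => z; rewrite mulrA.
rewrite E; apply: Int_ext => y; rewrite -IntZ; last exact: (integ_conv (m := m)).
by apply: Int_ext => z; rewrite (addrAC x y z); ring.
Qed.

Lemma conv_tau k y : commut (conv k) (tau y).
Proof.
by move=> m f mf; apply/funext => x; apply: Int_ext => z; rewrite /tau addrAC.
Qed.

Lemma conv_shift k y m f : integ k -> bm m f ->
  conv (fun z => k (z - y)) f = tau y (conv k f).
Proof.
move=> ik mf; apply/funext => x; rewrite /tau /conv.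
rewrite -(Int_shift y (f := fun z => k (z - y) * f (x + z))); last first.
  apply: measurable_funM.
    exact: (measurableT_comp (integ_meas ik) (measurable_addr (- y))).
  exact: (bm_shiftl x mf).1.
by apply: Int_ext => z; rewrite addrK (addrAC x y z) addrA.
Qed.

(** For even [k] the kernel [k (y - x)] is symmetric, so Fubini moves the convolution from one
    factor to the other. *)
Lemma conv_adj k m f m' g : (forall x, k (- x) = k x) -> integ k ->
  integ f -> bm m f -> bm m' g ->
  integ (conv k f) /\
  (\int[mu]_x (f x * conv k g x) = \int[mu]_x (conv k f x * g x))%R.
Proof.
move=> ev ik iF mf mg.
pose F (z : R * R) := k z.2 * f (z.1 + z.2).
have mF : measurable_fun [set: R * R] F.
  apply: measurable_funM; first exact: (measurableT_comp (integ_meas ik) measurable_snd).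
  exact: (measurableT_comp (integ_meas iF) (measurable_funD measurable_fst measurable_snd)).
have iF1 y : integ (fun x => F (x, y)) := integZ (k y) (integ_shift y iF).
have iF2 x : integ (fun y => F (x, y)) by exact: integ_conv ik mf.
have [] := Int_swap mF iF1 iF2
  (integZ (\int[mu]_z `|f z|)%R (integ_norm ik)) => [y|icf _ _].
  rewrite mulrC -[leRHS](IntZ `|k y| (integ_norm iF)).
  rewrite -(Int_shift y (f := fun z => `|k y| * `|f z|)); last first.
    exact: (integ_meas (integZ `|k y| (integ_norm iF))).
  by rewrite le_eqVlt; apply/orP; left; apply/eqP/Int_ext => z; rewrite normrM.
split => //.
pose G (z : R * R) := f z.1 * (k (z.2 - z.1) * g z.2).
have Gm : measurable_fun [set: R * R] G.
  apply: measurable_funM; first exact: (measurableT_comp (integ_meas iF) measurable_fst).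
  apply: measurable_funM; last exact: (measurableT_comp mg.1 measurable_snd).
  apply: (measurableT_comp (integ_meas ik)).
  exact: (measurable_funB measurable_snd measurable_fst).
have iks y : integ (fun x => k (x - y)) by exact: integ_shift.
have ksE x y : k (x - y) = k (y - x) by rewrite -ev opprB.
have iG2 x : integ (fun y => G (x, y)).
  exact: (integZ (f x) (integ_bm (iks x) mg)).
have iG1 y : integ (fun x => G (x, y)).
  have := integZ (g y) (integ_bm (iks y) mf).
  by congr integ; apply/funext => x; rewrite /G/= (ksE y); ring.
pose cN f := (fun x => \int[mu]_z (`|k z| * `|f (x + z)|))%R.
have iN := integ_norm ik.
have iNf := integ_norm iF.
have mNf : bm m (fun x => `|f x|).
  by split=> [|x]; [exact: integ_meas|rewrite normr_id; exact: mf.2].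
(* A preliminary swap with absolute values shows that the convolution of [|k|] and [|f|] is
   integrable; [m'] times it is the dominating function for the swap of [G]. *)
pose F' (z : R * R) := `|k z.2| * `|f (z.1 + z.2)|.
have mF' : measurable_fun [set: R * R] F'.
  by have := @measurableT_comp _ _ _ _ _ _ _ _ _ (@normr_measurable R setT) mF;
    congr measurable_fun; apply/funext => z; rewrite /F' -normrM.
have [] := Int_swap mF' (g := fun y => (\int[mu]_z `|f z|)%R * `|k y|) _ _ _ _.
- by move=> y; exact: (integZ `|k y| (integ_shift y iNf)).
- by move=> x; exact: (integ_conv x iN mNf).
- exact: integZ.
- move=> y; rewrite mulrC -[leRHS](IntZ `|k y| iNf).
  rewrite -(Int_shift y (f := fun z => `|k y| * `|f z|)); last exact: (integ_meas (integZ `|k y| iNf)).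
  rewrite le_eqVlt; apply/orP; left; apply/eqP/Int_ext => z.
  by rewrite /F'/= ger0_norm// mulr_ge0.
rewrite /F'/= => icN _ _.
have [] := Int_swap Gm iG1 iG2 (integZ m' icN).
  move=> y; rewrite -IntZ; last exact: (integ_conv y iN mNf).
  rewrite -(Int_shift (- y) (f := fun z => m' * (`|k z| * `|f (y + z)|))); last first.
    exact: (integ_meas (integZ m' (integ_conv y iN mNf))).
  apply: le_Int; [exact: integ_norm| |move=> x].
    apply: integZ; apply: (integ_shift (- y) (f := fun x => `|k x| * `|f (y + x)|)).
    exact: (integ_conv y iN mNf).
  rewrite /G/= !normrM ksE (addrC y) subrK.
  rewrite mulrA (mulrC `|f x|) [leLHS]mulrC.
  rewrite ler_wpM2r ?mulr_ge0//.
  exact: mg.2.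
move=> _ _; rewrite /G/= => E.
transitivity (\int[mu]_x \int[mu]_y (f x * (k (y - x) * g y)))%R.
  apply: Int_ext => x; rewrite IntZ; last by apply: (integ_bm (m := m')).
  rewrite -(Int_shift x (f := fun y => k (y - x) * g y)); last first.
    by apply: integ_meas; apply: (integ_bm (m := m')).
  by congr (_ * _); apply: Int_ext => z; rewrite addrK addrC.
rewrite E; apply: Int_ext => y.
rewrite -IntZr; last exact: integ_conv ik mf.
rewrite -(Int_shift (- y) (f := fun z => k z * f (y + z) * g y)); last first.
  apply: integ_meas; have := integZ (g y) (integ_conv y ik mf).
  by congr integ; apply/funext => z; rewrite mulrC.
by apply: Int_ext => x; rewrite ksE (addrC y) subrK; ring.
Qed.

Lemma markov_conv k : density k -> markov_op (conv k).
Proof.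
move=> [ik k0 k1]; split=> [m f mf|a b m m' f g mf mg]; last exact: conv_lincomb mf mg.
have := bm_conv ik mf; rewrite (Int_ext (g := k)) ?k1 ?mulr1// => x.
by rewrite ger0_norm.
Qed.

End convolution.

(** * The Euler walk *)

(* One Euler step of size [h] of the evolution [v_t = J * v - v]. *)
Definition walk (R : realType) (J : R -> R) (h : R) (f : R -> R) : R -> R :=
  lincomb (1 - h) h f (conv J f).

Section walk.
Context {R : realType}.
Local Notation mu := (@lebesgue_measure R).
Implicit Types (k l f g : R -> R) (m h c : R).

Lemma markov_id : markov_op (@id (R -> R)).
Proof. by split. Qed.

Lemma markov_tau y : markov_op (@tau R y).
Proof. by split=> // m f; exact: bm_tau. Qed.

Lemma commut_id (K : (R -> R) -> (R -> R)) : commut K id.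
Proof. by []. Qed.

Lemma markov_lincomb N N' (a b : R) : 0 <= a -> 0 <= b -> a + b = 1 ->
  markov_op N -> markov_op N' -> markov_op (fun f => lincomb a b (N f) (N' f)).
Proof.
move=> a0 b0 ab [Nb Nl] [Nb' Nl']; split=> [m f mf|c d m m' f g mf mg].
  have := bm_lincomb a b (Nb _ _ mf) (Nb' _ _ mf).
  by rewrite !ger0_norm// -mulrDl ab mul1r.
rewrite (Nl _ _ _ _ _ _ mf mg) (Nl' _ _ _ _ _ _ mf mg).
by apply/funext => x; rewrite /lincomb; ring.
Qed.

Lemma commut_lincomb N N' K (a b : R) : markov_op N -> markov_op N' ->
  markov_op K -> commut N K -> commut N' K ->
  commut (fun f => lincomb a b (N f) (N' f)) K.
Proof.
move=> mN mN' mK NK NK' m f mf.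
rewrite (mK.2 _ _ m m); [|exact: mN.1|exact: mN'.1].
by rewrite (NK m)// (NK' m).
Qed.

Variable J : R -> R.
Hypothesis dJ : density J.

Lemma markov_walk h : 0 <= h <= 1 -> markov_op (walk J h).
Proof.
move=> /andP[h0 h1]; apply: (@markov_lincomb id (conv J)).
- by rewrite subr_ge0.
- by [].
- by rewrite subrK.
- exact: markov_id.
- exact: markov_conv.
Qed.

Lemma commut_walk h K : markov_op K -> commut (conv J) K -> commut (walk J h) K.
Proof.
move=> mK JK; apply: (@commut_lincomb id (conv J)) => //.
exact: markov_conv.
Qed.

Lemma commut_walk_conv h k : density k -> commut (walk J h) (conv k).
Proof.
move=> dk; apply: commut_walk; first exact: markov_conv.
by apply: conv_comm; [case: dJ|case: dk].
Qed.

Lemma commut_walk_tau h y : commut (walk J h) (tau y).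
Proof. by apply: commut_walk; [exact: markov_tau|exact: conv_tau]. Qed.

(* [J - c k >= 0] makes the walk a mixture of [conv k], with weight [h c], and
   of a Markov operator, so that [markov_stein] applies. *)
Lemma walk_conv k c h m f n x : density k -> 0 < c <= 2^-1 -> 0 < h <= 2^-1 ->
  (forall z, c * k z <= J z) -> bm m f -> (0 < n)%N ->
  `|iter n (walk J h) (conv k f) x - iter n (walk J h) f x| <=
    2 * m / Num.sqrt (n%:R * h * c / 2).
Proof.
move=> dk /andP[c0 c2] /andP[h0 h2] ckJ mf n0.
have [iJ J0 J1] := dJ; have [ik k0 k1] := dk.
have mW : markov_op (walk J h) by apply: markov_walk; lra.
have mK := markov_conv dk; have mJ := markov_conv dJ.
have m0 := bm_ge0 mf.
have n0' : 0 < n%:R :> R by rewrite ltr0n.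
set a := h * c.
have a0 : 0 < a by rewrite mulr_gt0.
have a1 : a <= 2^-1.
  by rewrite /a (@le_trans _ _ (2^-1 * 2^-1))//; [rewrite ler_pM// ltW|lra].
have s0 : 0 < n%:R * h * c / 2 by rewrite !mulr_gt0// invr_gt0.
have le_sqrt b : n%:R * h * c / 2 <= b ->
    m / Num.sqrt b <= m / Num.sqrt (n%:R * h * c / 2).
  move=> sb; have b0 := lt_le_trans s0 sb.
  by rewrite ler_wpM2l// lef_pV2 ?posrE ?sqrtr_gt0//; exact: ler_wsqrtr.
have nS : n%:R <= n.+1%:R :> R by rewrite ler_nat.
(* [Q] is obtained by solving [W = a K + (1 - a) Q]. It contracts because [J - c k] is nonnegative
   of mass [1 - c], and [(1 - h) + h (1 - c) = 1 - a]. *)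
pose Q f := lincomb (1 - a)^-1 (- (a / (1 - a))) (walk J h f) (conv k f).
have mQ : markov_op Q.
  split=> [{m f mf m0 le_sqrt} m f mf|{m f mf m0 le_sqrt} b d m m' f g mf mg]; last first.
    rewrite /Q (mW.2 _ _ _ _ _ _ mf mg) (mK.2 _ _ _ _ _ _ mf mg).
    by apply/funext => y; rewrite /lincomb; ring.
  split.
    exact: (bm_lincomb _ _ (mW.1 _ _ mf) (mK.1 _ _ mf)).1.
  move=> y; rewrite /Q /walk /lincomb.
  have iJk : integ (lincomb 1 (- c) J k).
    by apply: integD; exact: integZ.
  have -> : (1 - a)^-1 * ((1 - h) * f y + h * conv J f y) + - (a / (1 - a)) * conv k f y
      = (1 - a)^-1 * ((1 - h) * f y + h * conv (lincomb 1 (- c) J k) f y).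
    by rewrite (conv_lincombl _ _ _ iJ ik mf) /a; ring.
  have B := conv_le y iJk mf.
  rewrite (Int_ext (g := lincomb 1 (- c) J k)) in B; last first.
    move=> z; rewrite ger0_norm// /lincomb mul1r mulNr subr_ge0//.
  rewrite /lincomb IntD in B; [|exact: integZ|exact: integZ].
  rewrite !IntZ// J1 k1 !mulr1 in B.
  rewrite normrM ger0_norm ?invr_ge0; last lra.
  rewrite mulrC ler_pdivrMr; last lra.
  have h1 : 0 <= 1 - h by lra.
  rewrite (le_trans (ler_normD _ _))// !normrM (ger0_norm h1) (ger0_norm (ltW h0)).
  rewrite (@le_trans _ _ ((1 - h) * m + h * (m * (1 - c))))//.
    apply: lerD; first by apply: ler_wpM2l => //; exact: mf.2.
    by apply: ler_wpM2l; [exact: ltW|exact: B].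
  by rewrite le_eqVlt; apply/orP; left; apply/eqP; rewrite /a; ring.
have KQ : commut (conv k) Q.
  move=> m' g mg; rewrite /Q (mK.2 _ _ m' m'); [|exact: mW.1|exact: mK.1].
  by rewrite -(commut_walk_conv h dk mg).
have NE m' g : bm m' g -> walk J h g = lincomb a (1 - a) (conv k g) (Q g).
  move=> mg; apply/funext => y; rewrite /Q [in RHS]/lincomb.
  by field; rewrite gt_eqF//; lra.
have a01 : 0 < a < 1 by lra.
have h01 : 0 < h < 1 by lra.
have B1 := markov_stein mW mK mQ KQ a01 NE mf n x.
(* The walk is also a mixture of [conv J], with weight [h], and of the identity; this second
   splitting compares [W^n (J * f)] with [W^n f]. *)
have B2 := @markov_stein R (walk J h) (conv J) id h m f mW mJ markov_id
   (commut_id (conv J)) h01 _ mf n x.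
have {}B2 : `|iter n (walk J h) (conv J f) x - iter n (walk J h) f x| <=
    m / Num.sqrt (n.+1%:R * h * (1 - h)).
  by apply: B2 => m' g _; apply/funext => y; rewrite /walk /lincomb addrC.
have mWn := markov_iter n mW.
have E1 : iter n (walk J h) (walk J h f) x =
    (1 - h) * iter n (walk J h) f x + h * iter n (walk J h) (conv J f) x.
  by rewrite {2}/walk (mWn.2 _ _ m m)//; exact: mJ.1.
have E2 : iter n (walk J h) (walk J h f) x =
    a * iter n (walk J h) (conv k f) x + (1 - a) * iter n (walk J h) (Q f) x.
  by rewrite (NE m f mf) (mWn.2 _ _ m m)//; [exact: mK.1|exact: mQ.1].
set X := iter n (walk J h) (conv k f) x in B1 E2 *.
set Y := iter n (walk J h) f x in B2 E1 *.
set Z := iter n (walk J h) (walk J h f) x in E1 E2 *.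
set V := iter n (walk J h) (Q f) x in B1 E2 *.
set U := iter n (walk J h) (conv J f) x in B2 E1 *.
(* The intermediate term is [Z = W^(n + 1) f]: the first splitting gives [X - Z], the second
   [Z - Y]. Since [1 - a] and [1 - h] are at least 1/2, both variances exceed [n h c / 2]. *)
have -> : X - Y = (1 - a) * (X - V) + h * (U - Y).
  by transitivity ((X - Z) + (Z - Y)); [ring|rewrite {1}E2 E1; ring].
rewrite (le_trans (ler_normD _ _))// !normrM.
rewrite -mulrA mulr2n mulrDl !mul1r; apply: lerD.
  rewrite ger0_norm; last lra.
  apply: (@le_trans _ _ `|X - V|); first by rewrite ler_piMl//; lra.
  rewrite (le_trans B1)//; apply: le_sqrt.
  apply: ler_pM; rewrite ?invr_ge0 ?mulr_ge0 ?(ltW h0) ?(ltW c0)//; last lra.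
  by rewrite /a -mulrA ler_wpM2r// mulr_ge0 ?(ltW h0) ?(ltW c0).
rewrite ger0_norm; last lra.
apply: (@le_trans _ _ `|U - Y|); first by rewrite ler_piMl//; lra.
rewrite (le_trans B2)//; apply: le_sqrt.
have nh0 : 0 <= n%:R * h by rewrite mulr_ge0// ltW.
apply: (@le_trans _ _ (n%:R * h / 2)).
  by rewrite ler_pM2r ?invr_gt0// ler_piMr//; lra.
apply: ler_pM; rewrite ?invr_ge0//; last lra.
by rewrite ler_wpM2r// ltW.
Qed.

(** The same [c] serves all translates by at most [d]: one smoothing by [k] can then be reached from
    two different base points. *)
Definition minorizes (k : R -> R) (c d : R) :=
  forall y, `|y| <= d -> forall z, c * k (z - y) <= J z.

Lemma density_shift k y : density k -> density (fun z => k (z - y)).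
Proof.
move=> [ik k0 k1]; split=> //; first exact: integ_shift.
by rewrite (Int_shift (- y) (f := k))//; exact: integ_meas.
Qed.

(** The value of [W^n (k * f)] at [x + y] is close to [W^n f (x + y)] through [k], and close to
    [W^n f x] through the translate of [k] by [y]. Each comparison costs twice [m] over the square
    root, whence 4. *)
Lemma walk_tau_small k c d h m f n x y : density k -> 0 < c <= 2^-1 -> 0 <= d ->
  minorizes k c d -> 0 < h <= 2^-1 -> bm m f -> (0 < n)%N -> `|y| <= d ->
  `|iter n (walk J h) f (x + y) - iter n (walk J h) f x| <=
    4 * m / Num.sqrt (n%:R * h * c / 2).
Proof.
move=> dk c01 d0 ckJ h02 mf n0 yd.
have [ik _ _] := dk.
have mW : markov_op (walk J h) by apply: markov_walk; lra.
have ckJ0 z : c * k z <= J z.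
  by have := ckJ 0 _ z; rewrite normr0 subr0; apply.
have B1 := walk_conv x (density_shift y dk) c01 h02 (ckJ y yd) mf n0.
have B2 := walk_conv (x + y) dk c01 h02 ckJ0 mf n0.
rewrite (conv_shift y ik mf) in B1.
have E := commut_iter n mW (commut_walk_tau h y) ((markov_conv dk).1 _ _ mf).
rewrite E {1}/tau in B1.
set X := iter n _ _ x in B1 *; set Y := iter n _ _ (x + y) in B1 B2 *.
set Z := iter n _ _ (x + y) in B2 *.
rewrite (_ : Z - X = (Y - X) - (Y - Z)); last by ring.
rewrite (le_trans (ler_normB _ _))// (le_trans (lerD B1 B2))//.
by rewrite le_eqVlt; apply/orP; left; apply/eqP; ring.
Qed.

(** The displacement is cut into [floor (|y| / d) + 1] equal steps of length at most [d]; the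
    rounding is the 1 in [1 + |y| / d]. *)
Lemma walk_tau k c d h m f n x y : density k -> 0 < c <= 2^-1 -> 0 < d ->
  minorizes k c d -> 0 < h <= 2^-1 -> bm m f -> (0 < n)%N ->
  `|iter n (walk J h) f (x + y) - iter n (walk J h) f x| <=
    4 * m / Num.sqrt (n%:R * h * c / 2) * (1 + `|y| / d).
Proof.
move=> dk c01 d0 ckJ h02 mf n0.
set B := 4 * m / _; set w := iter n _ f.
have B0 : 0 <= B.
  by rewrite divr_ge0 ?sqrtr_ge0// mulr_ge0// (bm_ge0 mf).
pose N := (Num.truncn (`|y| / d)).+1.
have yd0 : 0 <= `|y| / d by rewrite divr_ge0// ltW.
have yN : `|y| / d < N%:R by exact: truncnS_gt.
have Ny : N%:R <= 1 + `|y| / d.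
  by rewrite /N -natr1 addrC lerD2l truncn_le.
have N0 : 0 < N%:R :> R by rewrite ltr0n.
have yNd : `|y / N%:R| <= d.
  rewrite normrM normfV (ger0_norm (ltW N0)) ler_pdivrMr// mulrC.
  by rewrite -ler_pdivrMr// ltW.
have S j : `|w (x + j%:R * (y / N%:R)) - w x| <= B * j%:R.
  elim: j => [|j IH]; first by rewrite mul0r addr0 subrr normr0 mulr0.
  rewrite (_ : _ - _ = (w (x + j%:R * (y / N%:R) + y / N%:R) -
    w (x + j%:R * (y / N%:R))) + (w (x + j%:R * (y / N%:R)) - w x)); last first.
    by rewrite subrKA; congr (w _ - _); rewrite -natr1; ring.
  rewrite (le_trans (ler_normD _ _))// -natr1 mulrDr mulr1 addrC.
  by apply: lerD => //; apply: walk_tau_small dk c01 _ ckJ h02 mf n0 yNd; exact: ltW.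
have := S N; rewrite mulrCA divff ?gt_eqF// mulr1 => /le_trans; apply.
exact: ler_wpM2l.
Qed.

End walk.

(** * Averages over intervals and duality with bounded functions *)

Definition box (R : realType) (l : R) : R -> R :=
  fun z => l^-1 * \1_(`[0, l[%classic) z.

Section averages.
Context {R : realType}.
Local Notation mu := (@lebesgue_measure R).
Implicit Types (k f g w : R -> R) (m l B : R).

Lemma box_ge0 l z : 0 < l -> 0 <= box l z.
Proof. by move=> l0; rewrite /box indicE mulr_ge0// invr_ge0 ltW. Qed.

Lemma box_le l z : 0 < l -> box l z <= l^-1.
Proof.
by move=> l0; rewrite /box indicE ler_piMr ?invr_ge0 ?(ltW l0)// lern1 leq_b1.
Qed.

Lemma density_box l : 0 < l -> density (box l).
Proof.
move=> l0.
have mul : mu `[0, l[%classic = l%:E.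
  by rewrite lebesgue_measure_itv/= lte_fin l0 -EFinD subr0.
have i1 : integ (\1_(`[0, l[%classic) : R -> R) by exact: integrable_indic_itv.
split; [exact: (integZ l^-1 i1)|by move=> z; exact: box_ge0|].
rewrite /box IntZ// /Rintegral integral_indic// setIT.
by rewrite [X in fine X]mul/= mulVf// gt_eqF.
Qed.

Lemma conv_box_close l B m w x : 0 < l -> bm m w ->
  (forall z, 0 <= z <= l -> `|w (x + z) - w x| <= B) ->
  `|conv (box l) w x - w x| <= B.
Proof.
move=> l0 mw wB; have [ib b0 b1] := density_box l0.
have i1 := integ_conv x ib mw.
have i2 : integ (fun z => box l z * w x).
  by have := integZ (w x) ib; congr integ; apply/funext => z; rewrite mulrC.
have -> : conv (box l) w x - w x = (\int[mu]_z (box l z * (w (x + z) - w x)))%R.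
  rewrite -[X in _ - X = _]mul1r -b1 -(IntZr (w x) ib) -IntB//.
  by apply: Int_ext => z; rewrite mulrBr.
rewrite -[leRHS]mulr1 -b1 -(IntZ B ib).
apply: Int_norm_dom; last 2 first.
- exact: integZ.
- move=> z; rewrite normrM ger0_norm// mulrC.
  rewrite /box indicE; have [zl|] := boolP (z \in _); last first.
    by rewrite !(mulr0, mul0r).
  rewrite mulr1 ler_wpM2r ?invr_ge0 ?(ltW l0)// wB//.
  by move: zl; rewrite inE/= in_itv/= => /andP[-> /ltW].
have := integB i1 i2; congr integ; apply/funext => z.
by rewrite mulrBr.
Qed.

Lemma conv_box_L1 l m w x : 0 < l -> integ w -> bm m w ->
  `|conv (box l) w x| <= l^-1 * (\int[mu]_z `|w z|)%R.
Proof.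
move=> l0 iw mw; have [ib b0 b1] := density_box l0.
have iw' : integ (fun z => `|w (z + x)|) by exact: (integ_shift x (integ_norm iw)).
rewrite -(Int_shift x (f := fun z => `|w z|)); last exact: (integ_meas (integ_norm iw)).
rewrite -IntZ//; apply: Int_norm_dom; [exact: integ_conv ib mw|exact: integZ|].
by move=> z; rewrite normrM ger0_norm// addrC ler_wpM2r// box_le.
Qed.

(* The integral of [w] over [x, x + l] is that of [w - tau l w] over the half
   line from [x]. *)
Lemma conv_box_diff l m w x : 0 < l -> integ w -> bm m w ->
  `|conv (box l) w x| <= l^-1 * (\int[mu]_z `|w (z + l) - w z|)%R.
Proof.
move=> l0 iw mw; have [ib b0 b1] := density_box l0.
pose H : R -> R := \1_(`[0, +oo[%classic).
have mH y : bm 1 (fun z => H (z + y)).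
  apply: (bm_tau y (f := H)); split; first exact: measurable_indic.
  by move=> z; rewrite /H indicE ger0_norm// lern1 leq_b1.
have HE z : box l z = l^-1 * (H z - H (z - l)).
  rewrite /box /H !indicE; congr (_ * _).
  have -> : (z \in `[0, l[%classic) = (0 <= z < l) by rewrite mem_setE in_itv.
  have -> : (z \in `[0, +oo[%classic) = (0 <= z) by rewrite mem_setE in_itv/= andbT.
  have -> : (z - l \in `[0, +oo[%classic) = (l <= z).
    by rewrite mem_setE in_itv/= andbT subr_ge0.
  have [lz|lz] := leP l z; first by rewrite (le_trans (ltW l0) lz)/= subrr.
  by rewrite andbT subr0.
have iwl : integ (fun z => w (z + l)) by exact: integ_shift.
have i1 : integ (fun z => w (z + l) * H (z - x)) := integ_bm iwl (mH (- x)).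
have i2 : integ (fun z => w z * H (z - x)) := integ_bm iw (mH (- x)).
have i3 : integ (fun z => w z * H (z - x - l)).
  have := integ_bm iw (mH (- x - l)); congr integ; apply/funext => z.
  by rewrite addrA.
have E : conv (box l) w x =
    l^-1 * (\int[mu]_z ((w z - w (z + l)) * H (z - x)))%R.
  transitivity (l^-1 * (\int[mu]_z (w z * H (z - x) - w z * H (z - x - l)))%R).
    rewrite /conv -(Int_shift x (f := fun z => w z * H (z - x) - w z * H (z - x - l))).
      rewrite -IntZ.
        by apply: Int_ext => z; rewrite addrK HE (addrC x); ring.
      apply: (integ_shift x (f := fun z => w z * H (z - x) - w z * H (z - x - l))).
      exact: integB.
    by apply: integ_meas; exact: integB.
  congr (_ * _); rewrite IntB//.
  rewrite -(Int_shift l (f := fun z => w z * H (z - x - l))); last exact: integ_meas.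
  rewrite -IntB//; last first.
    by have := i1; congr integ; apply/funext => z; congr (_ * H _); ring.
  by apply: Int_ext => z; rewrite mulrBl; congr (_ - _ * H _); ring.
rewrite E normrM ger0_norm ?invr_ge0 ?(ltW l0)//.
rewrite ler_wpM2l ?invr_ge0 ?(ltW l0)//; apply: Int_norm_dom.
- have := integB i2 i1; congr integ; apply/funext => z.
  by rewrite mulrBl.
- by apply: integ_norm; exact: integB.
- move=> z; rewrite normrM distrC -[leRHS]mulr1 ler_wpM2l//.
  exact: (mH (- x)).2.
Qed.

(** Tested on the sign of [f], taken to be 1 where [f] vanishes. *)
Lemma L1_dual f B : integ f ->
  (forall g, bm 1 g -> `|(\int[mu]_x (f x * g x))%R| <= B) ->
  (\int[mu]_x `|f x| <= B)%R.
Proof.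
move=> iF fB.
pose g x := \1_(`[0, +oo[%classic) (f x) - \1_(`]-oo, 0[%classic) (f x) : R.
have mg : bm 1 g.
  split.
    by apply: measurable_funB; apply: (measurableT_comp _ (integ_meas iF));
      exact: measurable_indic.
  move=> x; rewrite /g !indicE !mem_setE/= !in_itv/= andbT.
  by case: ltP => _; rewrite ?subr0 ?sub0r ?normrN normr1.
rewrite (Int_ext (g := fun x => f x * g x)); last first.
  move=> x; rewrite /g !indicE !mem_setE/= !in_itv/= andbT.
  have [f0|f0] := leP 0 (f x); first by rewrite subr0 mulr1 ger0_norm.
  by rewrite sub0r mulrN1 ltr0_norm.
by rewrite (le_trans (ler_norm _))// fB.
Qed.

Lemma tau_adj y f g : measurable_fun [set: R] f -> measurable_fun [set: R] g ->
  (\int[mu]_x (tau y f x * g x) = \int[mu]_x (f x * tau (- y) g x))%R.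
Proof.
move=> mf mg; rewrite -(Int_shift y (f := fun x => f x * tau (- y) g x)).
  by apply: Int_ext => x; rewrite /tau addrK.
apply: measurable_funM => //.
exact: (measurableT_comp mg (measurable_addr (- y))).
Qed.

End averages.

(** * The walk on integrable functions *)

Section walk_integrable.
Context {R : realType}.
Local Notation mu := (@lebesgue_measure R).
Implicit Types (k f g : R -> R) (m h c d : R).
Variable J : R -> R.
Hypothesis dJ : density J.
Hypothesis J_even : forall x, J (- x) = J x.

Lemma walk_adj h m f m' g : integ f -> bm m f -> bm m' g ->
  integ (walk J h f) /\
  (\int[mu]_x (f x * walk J h g x) = \int[mu]_x (walk J h f x * g x))%R.
Proof.
move=> iF mf mg; have [iJ J0 J1] := dJ.
have [icf E] := conv_adj J_even iJ iF mf mg.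
have mcg := bm_conv iJ mg.
split; first by apply: integD; exact: integZ.
rewrite /walk /lincomb.
transitivity ((1 - h) * (\int[mu]_x (f x * g x))%R
    + h * (\int[mu]_x (f x * conv J g x))%R).
  have i1 := integ_bm iF mg; have i2 := integ_bm iF mcg.
  rewrite -(IntZ (1 - h) i1) -(IntZ h i2).
  rewrite -(IntD (integZ (1 - h) i1) (integZ h i2)).
  by apply: Int_ext => x; ring.
have i1 := integ_bm iF mg; have i2 := integ_bm icf mg.
rewrite E -(IntZ (1 - h) i1) -(IntZ h i2).
rewrite -(IntD (integZ (1 - h) i1) (integZ h i2)).
by apply: Int_ext => x; ring.
Qed.

Lemma iter_walk_adj h n m f m' g : 0 <= h <= 1 -> integ f -> bm m f -> bm m' g ->
  integ (iter n (walk J h) f) /\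
  (\int[mu]_x (f x * iter n (walk J h) g x) =
   \int[mu]_x (iter n (walk J h) f x * g x))%R.
Proof.
move=> h01 iF mf; have mW := markov_walk dJ h01.
elim: n g => [|n IH] g mg //.
have [iw _] := IH g mg.
have mw := (markov_iter n mW).1 _ _ mf.
have [iw1 E1] := walk_adj h iw mw mg.
split=> //; rewrite [X in (\int[mu]_x (_ * X x))%R]iterSr.
by rewrite (IH _ (mW.1 _ _ mg)).2 E1.
Qed.

(** By duality: against a test function [g], both the iterate and the translation pass to [g], where
    the sup norm estimate [walk_tau] applies. *)
Lemma walk_tau_L1 k c d h m f n y : density k -> 0 < c <= 2^-1 -> 0 < d ->
  minorizes J k c d -> 0 < h <= 2^-1 -> integ f -> bm m f -> (0 < n)%N ->
  (\int[mu]_x `|iter n (walk J h) f (x + y) - iter n (walk J h) f x| <=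
    4 / Num.sqrt (n%:R * h * c / 2) * (1 + `|y| / d) * \int[mu]_x `|f x|)%R.
Proof.
move=> dk c01 d0 ckJ h02 iF mf n0.
have h01 : 0 <= h <= 1 by lra.
set W := iter n (walk J h).
have mW := markov_iter n (markov_walk dJ h01).
have iW : integ (W f) := (iter_walk_adj n h01 iF mf mf).1.
have iWy : integ (fun x => W f (x + y)) by exact: integ_shift.
apply: L1_dual; first exact: integB.
move=> g mg.
have mtg := bm_tau (- y) mg.
have -> : (\int[mu]_x ((W f (x + y) - W f x) * g x))%R =
    (\int[mu]_x (f x * (W g (x - y) - W g x)))%R.
  rewrite (Int_ext (g := fun x => W f (x + y) * g x - W f x * g x)); last first.
    by move=> x; rewrite mulrBl.
  rewrite IntB; [|exact: (integ_bm iWy mg)|exact: (integ_bm iW mg)].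
  rewrite (tau_adj y (f := W f)); [|exact: integ_meas|exact: mg.1].
  rewrite -(iter_walk_adj n h01 iF mf mg).2 -(iter_walk_adj n h01 iF mf mtg).2.
  rewrite -IntB; last 2 first.
  - exact: integ_bm iF (mW.1 _ _ mtg).
  - exact: integ_bm iF (mW.1 _ _ mg).
  apply: Int_ext => x; rewrite -mulrBr.
  by rewrite (commut_iter n (markov_walk dJ h01) (commut_walk_tau dJ h (- y)) mg).
rewrite -IntZ; last exact: integ_norm.
apply: Int_norm_dom; last 2 first.
- exact/integZ/(integ_norm iF).
- move=> x; rewrite normrM mulrC ler_wpM2r//.
  have := walk_tau dJ x (- y) dk c01 d0 ckJ h02 mg n0.
  by rewrite mulr1 normrN.
have := integ_bm iF (bm_lincomb 1 (-1) (bm_tau (- y) (mW.1 _ _ mg)) (mW.1 _ _ mg)).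
by congr integ; apply/funext => x; rewrite /lincomb mul1r mulN1r.
Qed.

(** The decay of order [t^(-1/2)] in sup norm. The iterate [w] is its average over a unit interval
    up to the oscillation given by [walk_tau], and that average is at most the [L^1] norm of
    [w (z + 1) - w z]. The sup norm [m] stays in the bound because [w] retains a fraction of [f]. *)
Lemma walk_sup k c d h m f n x : density k -> 0 < c <= 2^-1 -> 0 < d ->
  minorizes J k c d -> 0 < h <= 2^-1 -> integ f -> bm m f -> (0 < n)%N ->
  `|iter n (walk J h) f x| <=
    4 / Num.sqrt (n%:R * h * c / 2) * (1 + d^-1) * (m + \int[mu]_x `|f x|)%R.
Proof.
move=> dk c01 d0 ckJ h02 iF mf n0.
have h01 : 0 <= h <= 1 by lra.
have mW := (markov_iter n (markov_walk dJ h01)).1 _ _ mf.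
have iW := (iter_walk_adj n h01 iF mf mf).1.
have B1 := conv_box_diff x ltr01 iW mW.
have B2 := walk_tau_L1 1 dk c01 d0 ckJ h02 iF mf n0.
set w := iter n _ f in mW iW B1 B2 *.
set S := 4 / Num.sqrt _ in B2 *.
have S0 : 0 <= S by rewrite divr_ge0// sqrtr_ge0.
have B3 : `|conv (box 1) w x - w x| <= S * (1 + d^-1) * m.
  apply: (conv_box_close ltr01 mW) => z /andP[z0 z1].
  have := walk_tau dJ x z dk c01 d0 ckJ h02 mf n0.
  rewrite -/w => /le_trans; apply.
  rewrite (_ : 4 * m / _ = S * m); last by rewrite /S mulrAC.
  rewrite [leRHS]mulrAC ler_wpM2l ?mulr_ge0 ?(bm_ge0 mf)// lerD2l.
  by rewrite ger0_norm// ler_piMl// invr_ge0 ltW.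
rewrite normr1 div1r in B2; rewrite invr1 mul1r in B1.
rewrite mulrDr (_ : w x = conv (box 1) w x - (conv (box 1) w x - w x)); last by ring.
rewrite (le_trans (ler_normB _ _))// addrC lerD//.
exact: le_trans B1 B2.
Qed.

End walk_integrable.

(** * Euler scheme for the evolution equation *)

Section solution.
Context {R : realType}.
Local Notation mu := (@lebesgue_measure R).
Implicit Types (f g : R -> R) (m h s t : R).

Lemma Lnorm1_Int f : integ f ->
  ('N[mu]_1[EFin \o f] = (\int[mu]_x `|f x|)%R%:E)%E.
Proof. by move=> iF; rewrite Lnorm1 -Int_EFin//; exact: integ_norm. Qed.

Lemma Int_norm_mul m f g : integ f -> bm m g ->
  (`|\int[mu]_x (f x * g x)| <= m * \int[mu]_x `|f x|)%R.
Proof.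
move=> iF mg; rewrite -IntZ; last exact: integ_norm.
apply: Int_norm_dom; [exact: integ_bm mg|exact/integZ/(integ_norm iF)|move=> x].
by rewrite normrM mulrC ler_wpM2r//; exact: mg.2.
Qed.

Lemma Int_norm_triangle f g : integ f -> integ g ->
  (\int[mu]_x `|f x + g x| <= \int[mu]_x `|f x| + \int[mu]_x `|g x|)%R.
Proof.
move=> iF ig; have i1 := integ_norm iF; have i2 := integ_norm ig.
rewrite -IntD//; apply: le_Int; [exact/integ_norm/integD|exact: integD|].
by move=> x; exact: ler_normD.
Qed.

Lemma cvg_L1_near (F : set_system R) (FF : Filter F) (f : R -> R -> R) (l : R -> R) :
  cvg_L1 F f l -> (\forall s \near F, integ (f s)) -> integ l ->
  forall e, 0 < e -> \forall s \near F, (\int[mu]_x `|f s x - l x| <= e)%R.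
Proof.
move=> /fine_cvgP[_ fl] iF il e e0.
move/cvgrPdist_le : fl => /(_ e e0); apply: filterS2 iF => s ifs.
rewrite sub0r normrN /= Lnorm1_Int; last exact: integB.
by rewrite ger0_norm//; apply: Rintegral_ge0.
Qed.

Variables (J : R -> R) (CJ : R).
Hypothesis dJ : density J.
Hypothesis J_even : forall x, J (- x) = J x.
Hypothesis J_bm : bm CJ J.
Variables (u du : R -> R -> R).
Hypothesis C1u : C1_L1_derivative u du.
Hypothesis u_eq : forall t : R, 0 < t -> {ae mu, forall x : R,
  du t x = (\int[mu]_y (J (x - y) * (u t y - u t x)))%R}.

Lemma integ_u t : 0 <= t -> integ (u t).
Proof. by move=> t0; case: C1u => /(_ t t0)[/Lfun1_integrable]. Qed.

Lemma integ_du t : 0 <= t -> integ (du t).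
Proof. by move=> t0; case: C1u => /(_ t t0)[_ /Lfun1_integrable]. Qed.

Lemma near_quotient t e : 0 <= t -> 0 < e ->
  \forall h \near 0^', 0 <= t + h ->
    (\int[mu]_x `|h^-1 * (u (t + h) x - u t x) - du t x| <= e)%R.
Proof.
move=> t0 e0; have [_ /(_ t t0) D _] := C1u.
apply: (cvg_L1_near (F := within [set h : R | 0 <= t + h] 0^') _ D) => //.
- rewrite near_withinE; apply: nearW => h /= th.
  by apply: integZ; apply: integB; exact: integ_u.
- exact: integ_du.
Qed.

(** Near [t] the difference quotient is within 1 of [du t], hence a local Lipschitz bound with
    constant [1 + K]. *)
Lemma u_continuous t e : 0 <= t -> 0 < e -> exists2 d, 0 < d &
  forall s, 0 <= s -> `|s - t| < d -> (\int[mu]_x `|u s x - u t x| <= e)%R.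
Proof.
move=> t0 e0; have /near_quotient H : 0 <= t by [].
have /= [d /= d0 Hd] := H 1 ltr01.
have iu := integ_u t0; have idu := integ_du t0.
set K := (\int[mu]_x `|du t x|)%R.
have K0 : 0 <= K by exact: Rintegral_ge0.
exists (Num.min d (e / (1 + K))).
  by rewrite lt_min d0 divr_gt0// ltr_wpDr.
move=> s s0; rewrite lt_min => /andP[sd se].
have [->|st] := eqVneq s t.
  rewrite (Int_ext (g := fun=> 0)) => [|x]; last by rewrite subrr normr0.
  by rewrite Rintegral_cst// mul0r ltW.
set h := s - t in sd se.
have h0 : h != 0 by rewrite subr_eq0.
have := Hd h _ h0; rewrite /= sub0r normrN => /(_ sd).
have -> : t + h = s by rewrite addrC subrK.
move=> /(_ s0) Q.
have ius := integ_u s0.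
have iq : integ (fun x => h^-1 * (u s x - u t x)) by apply: integZ; exact: integB.
rewrite (Int_ext (g := fun x => `|h| *
   `|(h^-1 * (u s x - u t x) - du t x) + du t x|)) => [|x]; last first.
  by rewrite subrK -normrM mulVKf.
rewrite IntZ; last by apply: integ_norm; apply: integD => //; exact: integB.
have T := Int_norm_triangle (integB iq idu) idu.
rewrite (@le_trans _ _ (`|h| * (1 + K)))//.
  by rewrite ler_wpM2l// (le_trans T)// lerD2r.
by rewrite -ler_pdivlMr ?ltr_wpDr//; exact: ltW.
Qed.

Definition pairing g s := (\int[mu]_x (u s x * g x))%R.

Lemma pair_continuous m g a b : bm m g -> 0 <= a ->
  {within `[a, b], continuous (pairing g)}.
Proof.
move=> mg a0; apply/subspace_continuousP => t /=.
rewrite in_itv/= => /andP[at_ tb].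
have t0 : 0 <= t by exact: le_trans at_.
apply/cvgrPdist_le => e e0.
have m0 := bm_ge0 mg.
have m1 : 0 < m + 1 by rewrite ltr_wpDl.
have [d d0 dH] := u_continuous t0 (divr_gt0 e0 m1).
rewrite near_withinE; exists d => // s /= ts; rewrite in_itv/= => /andP[as_ _].
have s0 : 0 <= s by exact: le_trans as_.
have it := integ_u t0; have is_ := integ_u s0.
rewrite distrC /pairing.
rewrite -(IntB (integ_bm is_ mg) (integ_bm it mg)).
rewrite (Int_ext (g := fun x => (u s x - u t x) * g x)) => [|x]; last by rewrite mulrBl.
rewrite (le_trans (Int_norm_mul (integB is_ it) mg))//.
apply: (@le_trans _ _ (m * (e / (m + 1)))).
  by rewrite ler_wpM2l// dH// distrC.
by rewrite mulrCA ler_piMr ?(ltW e0)// ler_pdivrMr// mul1r lerDl.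
Qed.

Lemma u_bounded t : 0 <= t ->
  exists M, forall s, 0 <= s <= t -> (\int[mu]_x `|u s x| <= M)%R.
Proof.
move=> t0.
have C : {within `[0, t], continuous (fun s => \int[mu]_x `|u s x|)%R}.
  apply/subspace_continuousP => s /=; rewrite in_itv/= => /andP[s0 st].
  apply/cvgrPdist_le => e e0.
  have [d d0 dH] := u_continuous s0 e0.
  rewrite near_withinE; exists d => // r /= sr; rewrite in_itv/= => /andP[r0 _].
  have is_ := integ_u s0; have ir := integ_u r0.
  rewrite -IntB; [|exact: integ_norm|exact: integ_norm].
  apply: (@le_trans _ _ (\int[mu]_x `|u r x - u s x|)%R); last by rewrite dH// distrC.
  apply: Int_norm_dom.
  - by apply: integB; exact: integ_norm.
  - by apply: integ_norm; exact: integB.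
  - by move=> x; rewrite (distrC (u r x)); exact: ler_dist_dist.
have [c _ cM] := EVT_max t0 C.
by exists ((\int[mu]_x `|u c x|)%R) => s st; apply: cM; rewrite in_itv.
Qed.

(** Since [J] has mass one the equation reads [J * u - u]; Fubini and evenness transfer the
    convolution to [g], which leaves a closed linear system for the pairings. *)
Lemma du_pair m g t : 0 < t -> bm m g ->
  (\int[mu]_x (du t x * g x))%R = pairing (conv J g) t - pairing g t.
Proof.
move=> t0 mg; have [iJ J0 J1] := dJ.
have iu := integ_u (ltW t0); have idu := integ_du (ltW t0).
have iJs x : integ (fun y => J (x - y)).
  have := integ_shift (- x) iJ; congr integ; apply/funext => y.
  by rewrite -J_even opprB.
have J1s x : (\int[mu]_y J (x - y))%R = 1.
  rewrite -[RHS]J1 -(Int_shift (- x) (integ_meas iJ)).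
  by apply: Int_ext => y; rewrite -J_even opprB.
(* Boundedness of [J] makes [J (x - y) * u t y] integrable in [y] for every [x], not just for almost
   every one. *)
have mJs x : bm CJ (fun y => J (x - y)).
  have := bm_tau (- x) J_bm; congr bm; apply/funext => y.
  by rewrite /tau -J_even opprB.
have iJu x : integ (fun y => J (x - y) * u t y).
  by have := integ_bm iu (mJs x); congr integ; apply/funext => y; rewrite mulrC.
have E x : (\int[mu]_y (J (x - y) * (u t y - u t x)))%R =
    (\int[mu]_y (J (x - y) * u t y))%R - u t x.
  rewrite -[X in _ - X]mul1r -(J1s x) -(IntZr (u t x) (iJs x)) -IntB//.
    by apply: Int_ext => y; rewrite mulrBr.
  by have := integZ (u t x) (iJs x); congr integ; apply/funext => y; rewrite mulrC.
pose F (z : R * R) := g z.1 * (J (z.1 - z.2) * u t z.2).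
have mF : measurable_fun [set: R * R] F.
  apply: measurable_funM; first exact: (measurableT_comp mg.1 measurable_fst).
  apply: measurable_funM; last exact: (measurableT_comp (integ_meas iu) measurable_snd).
  apply: (measurableT_comp (integ_meas iJ)).
  exact: (measurable_funB measurable_fst measurable_snd).
have iF1 y : integ (fun x => F (x, y)).
  have := integZ (u t y) (integ_bm (integ_shift (- y) iJ) mg).
  by congr integ; apply/funext => x; rewrite /F/=; ring.
have iF2 x : integ (fun y => F (x, y)) := integZ (g x) (iJu x).
have [] := Int_swap mF iF1 iF2 (integZ m (integ_norm iu)).
  move=> y; rewrite -[leRHS]mulr1 -J1 -(Int_shift (- y) (integ_meas iJ)).
  rewrite -(IntZ _ (integ_shift (- y) iJ)); apply: le_Int; [exact: integ_norm| |].
    exact/integZ/integ_shift.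
  move=> x; rewrite /F/= !normrM (ger0_norm (J0 _)) mulrA mulrAC ler_wpM2r//.
  by rewrite ler_wpM2r//; exact: mg.2.
rewrite /F/= => i1 i2 E2.
have mH : measurable_fun [set: R] (fun x => (\int[mu]_y (J (x - y) * u t y))%R).
  apply: (measurable_Int_param (F := fun z => J (z.1 - z.2) * u t z.2)).
  apply: measurable_funM; last exact: (measurableT_comp (integ_meas iu) measurable_snd).
  apply: (measurableT_comp (integ_meas iJ)).
  exact: (measurable_funB measurable_fst measurable_snd).
have mG : measurable_fun [set: R]
    (fun x => g x * (\int[mu]_y (J (x - y) * u t y))%R - u t x * g x).
  apply: measurable_funB; first exact: measurable_funM mg.1 mH.
  exact: measurable_funM (integ_meas iu) mg.1.
have aeE : {ae mu, forall x, du t x * g x =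
    g x * (\int[mu]_y (J (x - y) * u t y))%R - u t x * g x}.
  by move: (u_eq t0); apply: ae_sub => x ->; rewrite E; ring.
have [_ ->] := Int_ae (integ_bm idu mg) mG aeE.
have gE x : g x * (\int[mu]_y (J (x - y) * u t y))%R =
    (\int[mu]_y (g x * (J (x - y) * u t y)))%R by rewrite IntZ.
rewrite (Int_ext (g := fun x => (\int[mu]_y (g x * (J (x - y) * u t y)))%R
  - u t x * g x)) => [|x]; last by rewrite gE.
rewrite IntB//; last exact: integ_bm mg.
rewrite E2; congr (_ - _); apply: Int_ext => y.
rewrite /conv -IntZ; last exact: integ_conv iJ mg.
rewrite -(Int_shift y (f := fun x => g x * (J (x - y) * u t y))); last exact: (integ_meas (iF1 y)).
by apply: Int_ext => x; rewrite addrK (addrC y); ring.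
Qed.

(** Differentiability of an [L^1] valued curve becomes that of a real function, to which the mean
    value theorem applies. *)
Lemma pair_derive m g t : 0 < t -> bm m g ->
  is_derive t 1 (pairing g) (pairing (conv J g) t - pairing g t).
Proof.
move=> t0 mg; rewrite -(du_pair t0 mg).
have m0 := bm_ge0 mg; have m1 : 0 < m + 1 by rewrite ltr_wpDl.
have iu := integ_u (ltW t0); have idu := integ_du (ltW t0).
suff C : h^-1 *: ((pairing g \o shift t) (h *: (1:R)) - pairing g t) @[h --> 0^']
    --> (\int[mu]_x (du t x * g x))%R.
  by split; [apply/cvg_ex; eexists; exact: C|exact: cvg_lim C].
apply/cvgrPdist_le => e e0.
have Q := near_quotient (ltW t0) (divr_gt0 e0 m1).
have T : \forall h \near 0^', 0 <= t + h.
  exists t => // h /=; rewrite sub0r normrN => ht _.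
  by move: ht; rewrite ltr_norml => /andP[+ _]; rewrite -subr_gt0 opprK addrC => /ltW.
apply: filterS2 Q T => h Q th.
have iuh := integ_u th.
rewrite /= scaler1 (addrC h) /pairing /GRing.scale/=.
have i1 := integ_bm iuh mg; have i2 := integ_bm iu mg; have i3 := integ_bm idu mg.
rewrite -(IntB i1 i2) -(IntZ h^-1 (integB i1 i2)) distrC.
rewrite -(IntB (integZ h^-1 (integB i1 i2)) i3).
rewrite (Int_ext (g := fun x => (h^-1 * (u (t + h) x - u t x) - du t x) * g x));
  last by move=> x; ring.
have iq := integB (integZ h^-1 (integB iuh iu)) idu.
rewrite (le_trans (Int_norm_mul iq mg))//.
apply: (@le_trans _ _ (m * (e / (m + 1)))); first by rewrite ler_wpM2l// Q.
by rewrite mulrCA ler_piMr ?(ltW e0)// ler_pdivrMr// mul1r lerDl.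
Qed.

Lemma pair_walk h m g s : 0 <= s -> bm m g ->
  pairing (walk J h g) s = pairing g s + h * (pairing (conv J g) s - pairing g s).
Proof.
move=> s0 mg; have iu := integ_u s0; have [iJ _ _] := dJ.
have i1 := integ_bm iu mg; have i2 := integ_bm iu (bm_conv iJ mg).
rewrite /pairing -(IntB i2 i1) -(IntZ h (integB i2 i1)) -(IntD i1 (integZ h (integB i2 i1))).
by apply: Int_ext => x; rewrite /walk /lincomb; ring.
Qed.

(** Two mean value steps: the derivative [D g] of the pairing is again a combination of pairings, so
    it has a derivative too, made of four pairings each at most [m * M]. *)
Lemma euler_step m g s h M : 0 <= s -> 0 < h -> bm m g ->
  (forall r, s <= r <= s + h -> (\int[mu]_x `|u r x| <= M)%R) ->
  `|pairing g (s + h) - pairing (walk J h g) s| <= 4 * m * M * h ^+ 2.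
Proof.
move=> s0 h0 mg uM; have mJ := markov_conv dJ; have m0 := bm_ge0 mg.
have sh : s < s + h by rewrite ltrDl.
have mcg := mJ.1 _ _ mg; have mccg := mJ.1 _ _ mcg.
pose D f r := pairing (conv J f) r - pairing f r.
have drv f r : bm m f -> r \in `]s, s + h[ -> is_derive r 1 (pairing f) (D f r).
  move=> mf; rewrite in_itv/= => /andP[sr _]; apply: (pair_derive _ mf).
  exact: le_lt_trans s0 sr.
have [r rI E] := MVT sh (fun r => @drv g r mg) (pair_continuous mg s0).
have Dd : forall y, y \in `]s, r[ -> is_derive y 1 (D g) (D (conv J g) y - D g y).
  move=> y; rewrite in_itv/= => /andP[sy yr].
  have yI : y \in `]s, s + h[.
    by move: rI; rewrite !in_itv/= sy/= => /andP[_]; exact: lt_trans.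
  by apply: is_deriveB; exact: drv.
move: rI; rewrite in_itv/= => /andP[sr rsh].
have cD : {within `[s, r], continuous (D g)}.
  move=> y; apply: continuousB; [exact: (pair_continuous mcg s0)|exact: (pair_continuous mg s0)].
have [y yI E2] := MVT sr Dd cD.
move: yI; rewrite in_itv/= => /andP[sy yr].
have yM : (\int[mu]_x `|u y x| <= M)%R.
  by apply: uM; rewrite (ltW sy)/= ltW// (lt_trans yr).
have iu := integ_u (le_trans s0 (ltW sy)).
have P f : bm m f -> `|pairing f y| <= m * M.
  move=> mf; rewrite (le_trans (Int_norm_mul iu mf))// ler_wpM2l//.
rewrite (pair_walk h s0 mg) -/(D g s).
have -> : pairing g (s + h) - (pairing g s + h * D g s) =
    h * ((D (conv J g) y - D g y) * (r - s)).
  by rewrite -E2 opprD addrA E (addrAC s) subrr add0r; ring.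
rewrite !normrM (gtr0_norm h0).
have rs : `|r - s| <= h by rewrite gtr0_norm ?subr_gt0// lerBlDl ltW.
have B : `|D (conv J g) y - D g y| <= 4 * m * M.
  rewrite /D.
  have -> : 4 * m * M = (m * M + m * M) + (m * M + m * M) by ring.
  rewrite (le_trans (ler_normB _ _))// lerD// (le_trans (ler_normB _ _))// lerD//; exact: P.
rewrite expr2 [leRHS]mulrCA ler_pM2l//.
by apply: ler_pM.
Qed.

(** There are [n] local errors of size [4 m M (t / n)^2]. The constant depends on [t] but not on [g]
    or [n]. The induction varies the test function, since each step back in time replaces [f] by
    [walk J h f]. *)
Lemma euler_error t : 0 < t -> exists2 C, 0 <= C & forall m g n, bm m g ->
  (0 < n)%N -> t / n%:R <= 1 ->
  `|pairing g t - pairing (iter n (walk J (t / n%:R)) g) 0| <= C * m / n%:R.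
Proof.
move=> t0; have [M uM] := u_bounded (ltW t0).
have M0 : 0 <= M.
  apply: (le_trans _ (uM t _)); last by rewrite (ltW t0) lexx.
  exact: Rintegral_ge0.
exists (4 * M * t ^+ 2); first by rewrite mulr_ge0 ?sqr_ge0// mulr_ge0.
move=> m g n mg n0 h1.
have n0' : 0 < n%:R :> R by rewrite ltr0n.
set h := t / n%:R in h1 *.
have h0 : 0 < h by rewrite divr_gt0.
have nh : n%:R * h = t by rewrite mulrCA divff ?mulr1// gt_eqF.
have mW : markov_op (walk J h) by apply: markov_walk => //; rewrite (ltW h0).
have S k : (k <= n)%N -> forall f, bm m f ->
    `|pairing f (k%:R * h) - pairing (iter k (walk J h) f) 0| <= k%:R * (4 * m * M * h ^+ 2).
  elim: k => [|k IH] kn f mf; first by rewrite !mul0r subrr normr0.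
  have {}IH := IH (ltnW kn) _ (mW.1 _ _ mf).
  have kh0 : 0 <= k%:R * h by rewrite mulr_ge0// ltW.
  have Es : k.+1%:R * h = k%:R * h + h by rewrite -natr1 mulrDl mul1r.
  have St : `|pairing f (k%:R * h + h) - pairing (walk J h f) (k%:R * h)| <=
      4 * m * M * h ^+ 2.
    apply: (euler_step kh0 h0 mf) => r /andP[r1 r2]; apply: uM.
    rewrite (le_trans kh0 r1)/= (le_trans r2)// -Es -nh ler_wpM2r ?(ltW h0)//.
    by rewrite ler_nat.
  rewrite Es iterSr.
  set X := pairing f _ in St *; set Y := pairing (walk J h f) _ in St IH.
  set Z := pairing _ 0 in IH *.
  rewrite (_ : X - Z = (Y - Z) + (X - Y)); last by ring.
  by rewrite (le_trans (ler_normD _ _))// -natr1 mulrDl mul1r lerD.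
have := S n (leqnn n) g mg; rewrite nh => /le_trans; apply.
rewrite le_eqVlt; apply/orP; left; apply/eqP.
by rewrite /h; field; rewrite gt_eqF.
Qed.

End solution.

(** * The heat kernel *)

Section heat_kernel.
Context {R : realType}.
Local Notation mu := (@lebesgue_measure R).
Local Notation hk := (@heat_kernel R).
Implicit Types (s w x z r : R).

Lemma hk_ge0 s w : 0 <= hk s w.
Proof. by rewrite /heat_kernel mulr_ge0 ?expR_ge0// invr_ge0 sqrtr_ge0. Qed.

(** The heat kernel at time [s] is the centred normal density of variance [2 * s]. *)
Lemma density_hk s : 0 < s -> density (hk s).
Proof.
move=> s0.
have sg0 : Num.sqrt (2 * s) != 0 by rewrite gt_eqF// sqrtr_gt0 mulr_gt0.
have s2 : Num.sqrt (2 * s) ^+ 2 = 2 * s by rewrite sqr_sqrtr// mulr_ge0// ltW.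
have E : hk s = normal_pdf 0 (Num.sqrt (2 * s)).
  apply/funext => w; rewrite normal_pdfE//.
  rewrite /normal_peak /normal_fun /heat_kernel s2 subr0.
  congr (_ * expR _).
    by congr (Num.sqrt _)^-1; rewrite -mulr_natr; ring.
  by rewrite -mulNr; congr (_ / _); rewrite -mulr_natr; ring.
have i : integ (hk s) by rewrite E; exact: integrable_normal_pdf.
split=> //; first exact: hk_ge0.
by rewrite /Rintegral E integral_normal_pdf.
Qed.

(* Writing the factor [s^(-1/2)] as an exponential makes the heat kernel easy to
   differentiate in [s]. *)
Definition lhk s w := - (ln s / 2) - w ^+ 2 / 4 / s.

Lemma hkE s w : 0 < s -> hk s w = (Num.sqrt (4 * pi))^-1 * expR (lhk s w).
Proof.
move=> s0; rewrite /heat_kernel /lhk expRD mulrA; congr (_ * expR _); last first.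
  by congr (- _); field; rewrite gt_eqF.
rewrite sqrtrM ?mulr_ge0 ?pi_ge0// invfM; congr (_ * _).
rewrite expRN; congr (_^-1).
apply/eqP; rewrite -(@eqrXn2 _ 2) ?sqrtr_ge0 ?expR_ge0// sqr_sqrtr ?(ltW s0)//.
by rewrite -expRM_natr -mulrA mulVf// mulr1 lnK.
Qed.

(** The three space derivatives of the kernel, then its second time derivative [hkss]. By the heat
    equation [hk2] is also the first time derivative. *)
Definition hk1 s w := - (w / (2 * s)) * hk s w.
Definition hk2 s w := (w ^+ 2 / 4 / s - 2^-1) / s * hk s w.
Definition hk3 s w := (w / (2 * s)) * (3 / 2 - w ^+ 2 / 4 / s) / s * hk s w.
Definition hkss s w :=
  ((w ^+ 2 / 4 / s - 2^-1) ^+ 2 - 2 * (w ^+ 2 / 4 / s) + 2^-1) / s ^+ 2 * hk s w.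

Lemma is_derive_lhkx s w : 0 < s -> is_derive w 1 (lhk s) (- (w / (2 * s))).
Proof.
move=> s0; rewrite /lhk; apply: is_derive_eq; rewrite /GRing.scale/=.
by field; rewrite gt_eqF.
Qed.

Lemma is_derive_lhks s w : 0 < s ->
  is_derive s 1 (lhk^~ w) ((w ^+ 2 / 4 / s - 2^-1) / s).
Proof.
move=> s0; rewrite /lhk.
have h1 := is_derive1_ln s0.
have h2 := @is_deriveV R id s 1 1 (lt0r_neq0 s0) (is_derive_id _ _).
apply: is_derive_eq; rewrite /GRing.scale/=.
by field; rewrite gt_eqF.
Qed.

Lemma is_derive_hkx s w : 0 < s -> is_derive w 1 (hk s) (hk1 s w).
Proof.
move=> s0; have E : hk s = fun w => (Num.sqrt (4 * pi))^-1 * expR (lhk s w).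
  by apply/funext => v; exact: hkE.
rewrite E /hk1 hkE//.
have h := is_derive_lhkx w s0.
apply: is_derive_eq; rewrite /GRing.scale/=.
by ring.
Qed.

Lemma is_derive_hk1 s w : 0 < s -> is_derive w 1 (hk1 s) (hk2 s w).
Proof.
move=> s0; rewrite /hk1; have h := is_derive_hkx w s0.
apply: is_derive_eq; rewrite /GRing.scale/= /hk2 /hk1.
by field; rewrite gt_eqF.
Qed.

Lemma is_derive_hk2 s w : 0 < s -> is_derive w 1 (hk2 s) (hk3 s w).
Proof.
move=> s0; rewrite /hk2; have h := is_derive_hkx w s0.
apply: is_derive_eq; rewrite /GRing.scale/= /hk3 /hk1.
by field; rewrite gt_eqF.
Qed.

Lemma is_derive_hks s w : 0 < s -> is_derive s 1 (hk^~ w) (hk2 s w).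
Proof.
move=> s0; have h := is_derive_lhks w s0.
apply: (@near_eq_is_derive _ _ _
    (fun s => (Num.sqrt (4 * pi))^-1 * expR (lhk s w))).
  near=> y; apply/esym/hkE; near: y; exact: lt_nbhsr.
rewrite /hk2 hkE//; apply: is_derive_eq; rewrite /GRing.scale/=.
by ring.
Unshelve. all: by end_near. Qed.

Lemma is_derive_hk2s s w : 0 < s -> is_derive s 1 (hk2^~ w) (hkss s w).
Proof.
move=> s0; rewrite /hk2; have h := is_derive_hks w s0.
have h2 := @is_deriveV R id s 1 1 (lt0r_neq0 s0) (is_derive_id _ _).
apply: is_derive_eq; rewrite /GRing.scale/= /hkss /hk2.
by field; rewrite gt_eqF.
Qed.

(** The cube of [1 + q <= 6 * expR (q / 6)], with [216 = 6 ^ 3]. *)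
Lemma poly_expR (q : R) : 0 <= q -> (1 + q) ^+ 3 <= 216 * expR (q / 2).
Proof.
move=> q0; have -> : q / 2 = 3%:R * (q / 6) by field.
rewrite expRM_natl; have -> : 216 = 6 ^+ 3 :> R by ring.
rewrite -exprMn ler_pXn2r ?nnegrE ?mulr_ge0 ?expR_ge0//; [|lra].
by have := expR_ge1Dx (q / 6); lra.
Qed.

Lemma peak_compare (s s' : R) : 0 < s -> s <= s' <= 4 * s ->
  (Num.sqrt (4 * pi * s'))^-1 <= (Num.sqrt (4 * pi * s))^-1 <=
  2 * (Num.sqrt (4 * pi * s'))^-1.
Proof.
move=> s0 /andP[ss' s's]; have pi0 := pi_gt0 R.
have s'0 : 0 < s' by exact: lt_le_trans ss'.
have a0 : 0 < 4 * pi * s by rewrite !mulr_gt0.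
have a'0 : 0 < 4 * pi * s' by rewrite !mulr_gt0.
have b0 : 0 < Num.sqrt (4 * pi * s) by rewrite sqrtr_gt0.
have b'0 : 0 < Num.sqrt (4 * pi * s') by rewrite sqrtr_gt0.
apply/andP; split.
  rewrite lef_pV2 ?posrE//; apply: ler_wsqrtr.
  by rewrite ler_wpM2l// mulr_ge0// pi_ge0.
rewrite -ler_pdivrMl// mulrC -invfM lef_pV2 ?posrE ?mulr_gt0//.
have -> : Num.sqrt (4 * pi * s) * 2 = Num.sqrt (4 * pi * (4 * s)).
  have -> : 4 * pi * (4 * s) = 2 ^+ 2 * (4 * pi * s) by ring.
  by rewrite [RHS]sqrtrM ?sqr_ge0// sqrtr_sqr ger0_norm// mulrC.
by apply: ler_wsqrtr; rewrite ler_wpM2l// mulr_ge0// pi_ge0.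
Qed.

(** Half of the Gaussian exponent absorbs the polynomial and the other half is the exponent at time
    [2 * s]. The change of prefactor costs at most 2, so [432 = 2 * 216]; the factor 3 in
    [hk_poly_le] makes it 1296. *)
Lemma hk_poly s w : 0 < s ->
  (1 + w ^+ 2 / 4 / s) ^+ 3 * hk s w <= 432 * hk (2 * s) w.
Proof.
move=> s0; set q := w ^+ 2 / 4 / s.
have q0 : 0 <= q by rewrite !divr_ge0 ?sqr_ge0 ?(ltW s0).
have /andP[_ pk] : (Num.sqrt (4 * pi * (2 * s)))^-1 <= (Num.sqrt (4 * pi * s))^-1 <=
    2 * (Num.sqrt (4 * pi * (2 * s)))^-1 by apply: peak_compare => //; lra.
rewrite /heat_kernel.
have -> : w ^+ 2 / (4 * s) = q by rewrite /q; field; rewrite gt_eqF.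
have -> : w ^+ 2 / (4 * (2 * s)) = q / 2 by rewrite /q; field; rewrite gt_eqF.
have -> : expR (- q) = expR (- (q / 2)) * expR (- (q / 2)).
  by rewrite -expRD; congr expR; field.
set E := expR (- (q / 2)).
have E0 : 0 <= E by exact: expR_ge0.
set S := (Num.sqrt (4 * pi * s))^-1 in pk *; set S' := (Num.sqrt _)^-1 in pk *.
have S0 : 0 <= S by rewrite invr_ge0 sqrtr_ge0.
have H : (1 + q) ^+ 3 * E <= 216.
  rewrite (le_trans (ler_wpM2r E0 (poly_expR q0)))//.
  by rewrite -mulrA -expRD subrr expR0 mulr1.
rewrite (_ : _ * (S * (E * E)) = ((1 + q) ^+ 3 * E) * (S * E)); last by ring.
apply: (@le_trans _ _ (216 * (S * E))); first by rewrite ler_wpM2r// mulr_ge0.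
rewrite (_ : 432 * (S' * E) = 216 * ((2 * S') * E)); last by ring.
by rewrite ler_wpM2l// ler_wpM2r.
Qed.

Lemma hk_poly_le s w (P : R) : 0 < s -> `|P| <= 3 * (1 + w ^+ 2 / 4 / s) ^+ 3 ->
  `|P * hk s w| <= 1296 * hk (2 * s) w.
Proof.
move=> s0 PB; rewrite normrM (ger0_norm (hk_ge0 _ _)).
rewrite (le_trans (ler_wpM2r (hk_ge0 s w) PB))//.
have := hk_poly w s0; lra.
Qed.

(* The constant is kept opaque so that no tactic tries to compute with it. *)
Lemma hk_constant : {K : R | K = 1296}.
Proof. by exists 1296. Qed.

Definition hkC : R := sval hk_constant.

Lemma hkCE : hkC = 1296.
Proof. exact: (svalP hk_constant). Qed.

Lemma hkC_ge2 : 2 <= hkC.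
Proof. by rewrite hkCE; lra. Qed.

Section bounds.
Variable r : R.
Hypothesis r0 : 0 < r.
Let s := r ^+ 2.
Let s0 : 0 < s. Proof. by rewrite exprn_gt0. Qed.

Lemma hk_q w : w ^+ 2 / 4 / s = (w / (2 * r)) ^+ 2.
Proof. by rewrite /s; field; rewrite gt_eqF. Qed.

(** In the scaled variable [y = w / (2 * r)] each derivative is [r ^- k] times a polynomial in [y]
    times the kernel; only that polynomial remains to be bounded. *)
Lemma hk_bound w (P D : R) k : P * hk s w = D ->
  (forall y, y = w / (2 * r) -> `|P * r ^+ k| <= 3 * (1 + y ^+ 2) ^+ 3) ->
  `|D| <= hkC / r ^+ k * hk (2 * s) w.
Proof.
rewrite hkCE =>  <- /(_ _ erefl) PB; have rk : 0 < r ^+ k by rewrite exprn_gt0.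
rewrite mulrAC ler_pdivlMr// -{1}(gtr0_norm rk) -normrM mulrAC.
by apply: hk_poly_le => //; rewrite hk_q.
Qed.

Lemma hk1_le w : `|hk1 s w| <= hkC / r * hk (2 * s) w.
Proof.
rewrite -[X in _ / X]expr1; apply: (hk_bound (P := - (w / (2 * s)))) => // y yE.
have -> : - (w / (2 * s)) * r ^+ 1 = - y by rewrite yE /s; field; rewrite gt_eqF.
by rewrite ler_norml; apply/andP; split; nra.
Qed.

Lemma hk2_le w : `|hk2 s w| <= hkC / r ^+ 2 * hk (2 * s) w.
Proof.
apply: (hk_bound (P := (w ^+ 2 / 4 / s - 2^-1) / s)) => // y yE.
have -> : (w ^+ 2 / 4 / s - 2^-1) / s * r ^+ 2 = y ^+ 2 - 2^-1.
  by rewrite hk_q yE /s; field; rewrite gt_eqF.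
have := sqr_ge0 y; move: (y ^+ 2) => q q0.
by rewrite ler_norml; apply/andP; split; nra.
Qed.

Lemma hk3_le w : `|hk3 s w| <= hkC / r ^+ 3 * hk (2 * s) w.
Proof.
apply: (hk_bound (P := (w / (2 * s)) * (3 / 2 - w ^+ 2 / 4 / s) / s)) => // y yE.
have -> : (w / (2 * s)) * (3 / 2 - w ^+ 2 / 4 / s) / s * r ^+ 3 = y * (3 / 2 - y ^+ 2).
  by rewrite hk_q yE /s; field; rewrite gt_eqF.
have yB : `|y| <= 1 + y ^+ 2 by rewrite ler_norml; apply/andP; split; nra.
have yB2 : `|3 / 2 - y ^+ 2| <= 2 * (1 + y ^+ 2).
  by rewrite ler_norml; apply/andP; split; nra.
rewrite normrM (le_trans (ler_pM _ _ yB yB2))//.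
have := sqr_ge0 y; move: (y ^+ 2) => q q0.
by nra.
Qed.

Lemma hkss_le w : `|hkss s w| <= hkC / r ^+ 4 * hk (2 * s) w.
Proof.
apply: (hk_bound (P := ((w ^+ 2 / 4 / s - 2^-1) ^+ 2 - 2 * (w ^+ 2 / 4 / s) + 2^-1) / s ^+ 2)) => // y yE.
have -> : ((w ^+ 2 / 4 / s - 2^-1) ^+ 2 - 2 * (w ^+ 2 / 4 / s) + 2^-1) / s ^+ 2 * r ^+ 4
    = (y ^+ 2 - 2^-1) ^+ 2 - 2 * y ^+ 2 + 2^-1.
  by rewrite hk_q yE /s; field; rewrite gt_eqF.
have := sqr_ge0 y; move: (y ^+ 2) => q q0.
by rewrite ler_norml; apply/andP; split; nra.
Qed.

Lemma norm_hk_le w : `|w| * hk s w <= 2 * hkC * r * hk (2 * s) w.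
Proof.
have H y : y = w / (2 * r) ->
    `|w / (2 * r) * r ^+ 0| <= 3 * (1 + y ^+ 2) ^+ 3.
  move=> <-; rewrite expr0 mulr1.
  by rewrite ler_norml; apply/andP; split; nra.
have := @hk_bound w (w / (2 * r)) (w / (2 * r) * hk s w) 0 erefl H.
rewrite expr0 divr1 {H}.
rewrite normrM (ger0_norm (hk_ge0 _ _)) normrM normfV (gtr0_norm (mulr_gt0 _ r0))// => H.
have r2 : 0 < 2 * r by rewrite mulr_gt0.
rewrite (_ : `|w| * hk s w = 2 * r * (`|w| / (2 * r) * hk s w)); last first.
  by field; rewrite gt_eqF.
rewrite (_ : 2 * hkC * r * _ = 2 * r * (hkC * hk (2 * s) w)); last by ring.
by rewrite ler_wpM2l// ltW.
Qed.

Lemma hk_sup w : hk s w <= r^-1.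
Proof.
have pi2 := pi_ge2 R.
rewrite /heat_kernel (@le_trans _ _ (Num.sqrt (4 * pi * s))^-1)//.
  rewrite ler_piMr ?invr_ge0 ?sqrtr_ge0// -[leRHS]expR0 ler_expR oppr_le0.
  by rewrite divr_ge0 ?sqr_ge0// mulr_ge0// ltW.
rewrite lef_pV2 ?posrE ?sqrtr_gt0 ?mulr_gt0 ?pi_gt0//.
rewrite -[leLHS](gtr0_norm r0) -sqrtr_sqr -/s; apply: ler_wsqrtr.
by rewrite ler_peMl ?(ltW s0)//; lra.
Qed.

(** Doubling the time pays for moving the point by at most [r], as needed at the intermediate points
    of Taylor remainders. One factor 2 comes from the prefactors, the other bounds
    [expR (1 / 4)]. *)
Lemma hk_near w x : `|x - w| <= r -> hk (2 * s) x <= 4 * hk (4 * s) w.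
Proof.
move=> xw.
have /andP[_ pk] : (Num.sqrt (4 * pi * (4 * s)))^-1 <= (Num.sqrt (4 * pi * (2 * s)))^-1
   <= 2 * (Num.sqrt (4 * pi * (4 * s)))^-1.
  by apply: peak_compare; move: s0; lra.
rewrite /heat_kernel.
set S1 := (Num.sqrt (4 * pi * (2 * s)))^-1 in pk *.
set S2 := (Num.sqrt _)^-1 in pk *.
set E := expR (- (w ^+ 2 / (4 * (4 * s)))).
rewrite (_ : 4 * (S2 * E) = (2 * S2) * (2 * E)); last by ring.
apply: ler_pM; rewrite ?invr_ge0 ?sqrtr_ge0 ?expR_ge0//.
have e2 : expR (4^-1) <= 2 :> R.
  rewrite -[leRHS]invrK -(invrK (expR _)) -expRN lef_pV2 ?posrE ?invr_gt0 ?expR_gt0//.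
  by have := expR_ge1Dx (- 4^-1 : R); lra.
apply: (@le_trans _ _ (expR 4^-1 * E)); last by rewrite ler_wpM2r ?expR_ge0.
rewrite /E -expRD ler_expR.
have d2 : (x - w) ^+ 2 <= s.
  by rewrite -(real_normK (num_real (x - w))) /s ler_pXn2r ?nnegrE// ltW.
rewrite -subr_ge0.
have -> : 4^-1 - w ^+ 2 / (4 * (4 * s)) - - (x ^+ 2 / (4 * (2 * s))) =
   (4 * s - w ^+ 2 + 2 * x ^+ 2) / (16 * s).
  by field; rewrite gt_eqF.
rewrite divr_ge0//; last by rewrite mulr_ge0// ltW.
by have := sqr_ge0 (w - 2 * x); nra.
Qed.

Lemma hk_later w s' : s <= s' <= 2 * s -> hk (2 * s') w <= 2 * hk (4 * s) w.
Proof.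
move=> /andP[ss' s's].
have /andP[_ pk] : (Num.sqrt (4 * pi * (4 * s)))^-1 <= (Num.sqrt (4 * pi * (2 * s')))^-1
   <= 2 * (Num.sqrt (4 * pi * (4 * s)))^-1.
  by apply: peak_compare; move: s0; lra.
rewrite /heat_kernel.
set S1 := (Num.sqrt (4 * pi * (2 * s')))^-1 in pk *.
set S2 := (Num.sqrt _)^-1 in pk *.
rewrite (mulrA 2); apply: ler_pM; rewrite ?invr_ge0 ?sqrtr_ge0 ?expR_ge0//.
rewrite ler_expR lerN2 ler_wpM2l ?sqr_ge0// lef_pV2 ?posrE; last 2 first.
- by move: s0; lra.
- by move: s0; lra.
by lra.
Qed.

End bounds.

End heat_kernel.

(** * Taylor estimates and averages against the heat kernel *)

Section taylor.
Context {R : realType}.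
Implicit Types (f df : R -> R) (x z B : R).

Lemma mvt_itv_le f df (a b : R) B : a <= b ->
  (forall y, a <= y <= b -> is_derive y 1 f (df y)) ->
  (forall y, a <= y <= b -> `|df y| <= B) ->
  `|f b - f a| <= B * `|b - a|.
Proof.
move=> ab fd dB.
have D y : y \in `[a, b] -> is_derive y 1 f (df y) by rewrite in_itv/= => /fd.
have D' y : y \in `]a, b[ -> is_derive y 1 f (df y).
  by rewrite in_itv/= => /andP[ay yb]; apply: D; rewrite in_itv/= !ltW.
have C : {within `[a, b], continuous f}.
  by apply: derivable_within_continuous => y /D[].
have [c cab E] := MVT_segment ab D' C.
by rewrite E normrM ler_wpM2r// dB//; move: cab; rewrite in_itv.
Qed.

Lemma mvt_le f df x z B :
  (forall y, `|y - x| <= `|z| -> is_derive y 1 f (df y)) ->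
  (forall y, `|y - x| <= `|z| -> `|df y| <= B) ->
  `|f (x + z) - f x| <= B * `|z|.
Proof.
move=> fd dB.
have [z0|z0] := leP z 0.
- have H y : x + z <= y <= x -> `|y - x| <= `|z|.
    by move=> /andP[y1 y2]; rewrite (ler0_norm z0) ler0_norm ?subr_le0//; lra.
  rewrite distrC; have -> : `|z| = `|x - (x + z)|.
    by rewrite opprD addrA subrr sub0r normrN.
  by apply: (mvt_itv_le (df := df)) => [|y /H|y /H]; [rewrite gerDl|exact: fd|exact: dB].
- have H y : x <= y <= x + z -> `|y - x| <= `|z|.
    by move=> /andP[y1 y2]; rewrite (gtr0_norm z0) ger0_norm ?subr_ge0//; lra.
  have -> : `|z| = `|x + z - x| by rewrite addrAC subrr add0r.
  apply: (mvt_itv_le (df := df)) => [|y /H|y /H]; [|exact: fd|exact: dB].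
  by rewrite lerDl ltW.
Qed.

(** Each order follows from the mean value bound for [f] minus its Taylor polynomial, whose
    derivative is the remainder of the previous order; the sharp factorials are given up. *)
Lemma taylor1_le f f1 f2 x z B :
  (forall y, `|y - x| <= `|z| -> is_derive y 1 f (f1 y)) ->
  (forall y, `|y - x| <= `|z| -> is_derive y 1 f1 (f2 y)) ->
  (forall y, `|y - x| <= `|z| -> `|f2 y| <= B) ->
  `|f (x + z) - f x - z * f1 x| <= B * `|z| ^+ 2.
Proof.
move=> fd f1d f2B.
have B0 : 0 <= B by apply: (le_trans _ (f2B x _)); rewrite ?subrr ?normr0.
pose G y := f y - y * f1 x.
have D y : `|y - x| <= `|z| -> is_derive y 1 G (f1 y - f1 x).
  move=> yz; have h := fd y yz; rewrite /G.
  by apply: is_derive_eq; rewrite /GRing.scale/=; ring.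
have DB y : `|y - x| <= `|z| -> `|f1 y - f1 x| <= B * `|z|.
  move=> yz; have yE : y = x + (y - x) by rewrite addrC subrK.
  rewrite {1}yE (le_trans (mvt_le (df := f2) (B := B) _ _))//.
  - by move=> v vy; apply: f1d; exact: le_trans vy yz.
  - by move=> v vy; apply: f2B; exact: le_trans vy yz.
  - by rewrite ler_wpM2l.
have := mvt_le D DB; rewrite -mulrA -expr2.
by rewrite (_ : G (x + z) - G x = f (x + z) - f x - z * f1 x)// /G; ring.
Qed.

Lemma taylor2_le f f1 f2 f3 x z B :
  (forall y, `|y - x| <= `|z| -> is_derive y 1 f (f1 y)) ->
  (forall y, `|y - x| <= `|z| -> is_derive y 1 f1 (f2 y)) ->
  (forall y, `|y - x| <= `|z| -> is_derive y 1 f2 (f3 y)) ->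
  (forall y, `|y - x| <= `|z| -> `|f3 y| <= B) ->
  `|f (x + z) - f x - z * f1 x - z ^+ 2 / 2 * f2 x| <= B * `|z| ^+ 3.
Proof.
move=> fd f1d f2d f3B.
have B0 : 0 <= B by apply: (le_trans _ (f3B x _)); rewrite ?subrr ?normr0.
pose G y := f y - y * f1 x - (y - x) ^+ 2 / 2 * f2 x.
have D y : `|y - x| <= `|z| -> is_derive y 1 G (f1 y - f1 x - (y - x) * f2 x).
  move=> yz; have h := fd y yz; rewrite /G.
  by apply: is_derive_eq; rewrite /GRing.scale/=; field.
have DB y : `|y - x| <= `|z| -> `|f1 y - f1 x - (y - x) * f2 x| <= B * `|z| ^+ 2.
  move=> yz; have yE : y = x + (y - x) by rewrite addrC subrK.
  rewrite {1}yE (le_trans (taylor1_le (f2 := f3) (B := B) _ _ _))//.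
  - by move=> v vy; apply: f1d; exact: le_trans vy yz.
  - by move=> v vy; apply: f2d; exact: le_trans vy yz.
  - by move=> v vy; apply: f3B; exact: le_trans vy yz.
  - by rewrite ler_wpM2l// ler_pXn2r ?nnegrE.
have := mvt_le D DB; rewrite -mulrA -exprSr.
by rewrite (_ : G (x + z) - G x = f (x + z) - f x - z * f1 x - z ^+ 2 / 2 * f2 x)//
  /G; field.
Qed.

Lemma derive_measurable f df : (forall x : R, is_derive x 1 f (df x)) ->
  measurable_fun [set: R] f.
Proof.
move=> fd; apply: continuous_measurable_fun => x.
by apply: differentiable_continuous; apply/derivable1_diffP; case: (fd x).
Qed.

Local Notation mu := (@lebesgue_measure R).

Lemma Int_opp f : measurable_fun [set: R] f ->
  (\int[mu]_x f (- x) = \int[mu]_x f x)%R.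
Proof.
have K (g : R -> \bar R) : measurable_fun [set: R] g -> (forall x, 0 <= g x)%E ->
    (\int[mu]_x g (- x)%R = \int[mu]_x g x)%E.
  move=> mg g0.
  transitivity (\int[pushforward mu (-%R : _ -> measurableTypeR R)]_x g x)%E.
    by rewrite ge0_integral_pushforward.
  by apply: eq_measure_integral => A mA _; exact: lebesgue_measureN.
move=> /measurable_EFinP mf; rewrite /Rintegral; congr fine.
rewrite integralE [in RHS]integralE; congr (_ - _)%E.
  rewrite -[RHS]K//; last exact: measurable_funepos.
  by apply: eq_integral => x _; rewrite !funeposE.
rewrite -[RHS]K//; last exact: measurable_funeneg.
by apply: eq_integral => x _; rewrite !funenegE.
Qed.

End taylor.

Section gaussian_averages.
Context {R : realType}.
Local Notation mu := (@lebesgue_measure R).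
Local Notation hk := (@heat_kernel R).
Implicit Types (f : R -> R) (m r s w x z : R).

Lemma measurable_hk1 s : 0 < s -> measurable_fun [set: R] (hk1 s).
Proof. by move=> s0; apply: derive_measurable => x; exact: is_derive_hk1. Qed.

Lemma measurable_hk2 s : 0 < s -> measurable_fun [set: R] (hk2 s).
Proof. by move=> s0; apply: derive_measurable => x; exact: is_derive_hk2. Qed.

(** The estimates below reduce to a pointwise domination of a kernel by [C] times a heat kernel,
    whose mass is one. *)
Lemma conv_dom (k l : R -> R) C m f x : measurable_fun [set: R] k -> density l ->
  (forall w, `|k w| <= C * l w) -> bm m f -> integ k /\ `|conv k f x| <= m * C.
Proof.
move=> mk [il l0 l1] kC mf.
have ik : integ k by apply: (integ_dom mk (integZ C il)).
split=> //; rewrite (le_trans (conv_le x ik mf))// ler_wpM2l ?(bm_ge0 mf)//.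
rewrite -[leRHS]mulr1 -l1 -IntZ//; apply: le_Int => //; first exact: integ_norm.
exact: integZ.
Qed.

Let hC2 := @hkC_ge2 R.
Let hC0 : 0 <= @hkC R. Proof. by move: hC2; lra. Qed.

Section radius.
Variable r : R.
Hypothesis r0 : 0 < r.
Let s := r ^+ 2.
Let s0 : 0 < s. Proof. by rewrite exprn_gt0. Qed.
Let s20 : 0 < 2 * s. Proof. by rewrite mulr_gt0. Qed.
Let s40 : 0 < 4 * s. Proof. by rewrite mulr_gt0. Qed.

Lemma conv_hk1 m f x : bm m f -> integ (hk1 s) /\ `|conv (hk1 s) f x| <= m * (hkC / r).
Proof.
move=> mf; apply: conv_dom mf; [exact: measurable_hk1|exact: (density_hk s20)|].
exact: hk1_le.
Qed.

Lemma conv_hk2 m f x : bm m f ->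
  integ (hk2 s) /\ `|conv (hk2 s) f x| <= m * (hkC / r ^+ 2).
Proof.
move=> mf; apply: conv_dom mf; [exact: measurable_hk2|exact: (density_hk s20)|].
exact: hk2_le.
Qed.

Let psi f := conv (hk s) f.

Lemma conv_hk_shift m f x z : bm m f ->
  psi f (x + z) = conv (fun w => hk s (w - z)) f x.
Proof. by move=> mf; have [ik _ _] := density_hk s0; rewrite (conv_shift z ik mf). Qed.

Let psi_le m f x : bm m f -> `|psi f x| <= m.
Proof. by move=> mf; apply: ((markov_conv (density_hk s0)).1 _ _ mf).2. Qed.

(** For [|z| <= r] the mean value bound on the kernel applies, through [hk_near]; for larger [z] the
    trivial bound [2 * m] is enough. *)
Lemma conv_hk_lip m f x z : bm m f ->
  `|psi f (x + z) - psi f x| <= m * ((4 * hkC) * (`|z| / r)).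
Proof.
move=> mf; have m0 := bm_ge0 mf.
have [zr|zr] := leP `|z| r; last first.
  rewrite (le_trans (ler_normB _ _))// (le_trans (lerD (psi_le _ mf) (psi_le _ mf)))//.
  rewrite (_ : m + m = m * 2); last by ring.
  have q1 : 1 <= `|z| / r by rewrite ler_pdivlMr// mul1r ltW.
  by rewrite ler_wpM2l//; move: hC2 q1; nra.
have [ik _ _] := density_hk s0.
have iks : integ (fun w => hk s (w - z)) by exact: integ_shift.
rewrite (conv_hk_shift x z mf) /psi.
have := conv_lincombl 1 (-1) x iks ik mf; rewrite mul1r mulN1r => <-.
apply: (conv_dom _ _ (density_hk s40) _ mf).2.
  by apply: integ_meas; apply: integD; exact: integZ.
move=> w; rewrite /lincomb mul1r mulN1r.
rewrite (le_trans (mvt_le (df := hk1 s) (B := (4 * hkC) / r * hk (4 * s) w) _ _))//.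
- by move=> y _; exact: is_derive_hkx.
- move=> y; rewrite normrN => yz.
  rewrite (le_trans (hk1_le r0 y))//.
  have r1 : 0 <= hkC / r by rewrite divr_ge0// ltW.
  by have := hk_near r0 (le_trans yz zr) => /(ler_wpM2l r1); lra.
- by rewrite normrN le_eqVlt; apply/orP; left; apply/eqP; ring.
Qed.

(** A translation of the average is a translation of the kernel by [- z], hence the sign of the
    first order term. For [|z| > r] the terms are bounded one by one by powers of [|z| / r > 1], so
    the cubic bound holds for all [z] and can be integrated against [J]. *)
Lemma conv_hk_taylor m f x z : bm m f ->
  `|psi f (x + z) - psi f x + z * conv (hk1 s) f x - z ^+ 2 / 2 * conv (hk2 s) f x|
    <= m * ((4 * hkC) * (`|z| ^+ 3 / r ^+ 3)).
Proof.
move=> mf; have m0 := bm_ge0 mf.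
have [ik1 B1] := conv_hk1 x mf; have [ik2 B2] := conv_hk2 x mf.
have [zr|zr] := leP `|z| r; last first.
  set q := `|z| / r.
  have q1 : 1 < q by rewrite ltr_pdivlMr// mul1r.
  have -> : `|z| ^+ 3 / r ^+ 3 = q ^+ 3 by rewrite /q; field; rewrite gt_eqF.
  have C1 : `|z * conv (hk1 s) f x| <= m * (hkC * q).
    rewrite normrM (le_trans (ler_wpM2l (normr_ge0 z) B1))//.
    by rewrite le_eqVlt; apply/orP; left; apply/eqP; rewrite /q; field; rewrite gt_eqF.
  have C2 : `|z ^+ 2 / 2 * conv (hk2 s) f x| <= m * ((hkC / 2) * q ^+ 2).
    rewrite normrM (le_trans (ler_wpM2l (normr_ge0 _) B2))//.
    rewrite normrM normrX normfV (ger0_norm (ler0n R 2)).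
    by rewrite le_eqVlt; apply/orP; left; apply/eqP; rewrite /q; field; rewrite gt_eqF.
  have D1 := psi_le (x + z) mf; have D2 := psi_le x mf.
  rewrite (le_trans (ler_normB _ _))// (le_trans (lerD (ler_normD _ _) (lexx _)))//.
  rewrite (le_trans (lerD (lerD (ler_normB _ _) (lexx _)) (lexx _)))//.
  apply: (@le_trans _ _ (m * (2 + hkC * q + (hkC / 2) * q ^+ 2))); first by lra.
  rewrite ler_wpM2l//.
  have q2 : q <= q ^+ 2 by nra.
  have q3 : q ^+ 2 <= q ^+ 3 by rewrite (exprS _ 2); nra.
  by move: hC2 q1 q2 q3; nra.
have [ik _ _] := density_hk s0.
have iks : integ (fun w => hk s (w - z)) by exact: integ_shift.
have E : psi f (x + z) - psi f x + z * conv (hk1 s) f x - z ^+ 2 / 2 * conv (hk2 s) f x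
  = conv (lincomb 1 1 (lincomb 1 (-1) (fun w => hk s (w - z)) (hk s))
                      (lincomb z (- (z ^+ 2 / 2)) (hk1 s) (hk2 s))) f x.
  have i1 : integ (lincomb 1 (-1) (fun w => hk s (w - z)) (hk s)).
    by apply: integD; exact: integZ.
  have i2 : integ (lincomb z (- (z ^+ 2 / 2)) (hk1 s) (hk2 s)).
    by apply: integD; exact: integZ.
  rewrite (conv_lincombl _ _ _ i1 i2 mf) (conv_lincombl _ _ _ iks ik mf).
  by rewrite (conv_lincombl _ _ _ ik1 ik2 mf) (conv_hk_shift x z mf) /psi; ring.
rewrite E; apply: (conv_dom _ _ (density_hk s40) _ mf).2.
  by apply: integ_meas; do 2 (apply: integD; apply: integZ => //);
    apply: integD; exact: integZ.
move=> w; rewrite /lincomb !mul1r mulN1r.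
have T := @taylor2_le R (hk s) (hk1 s) (hk2 s) (hk3 s) w (- z)
  ((4 * hkC) / r ^+ 3 * hk (4 * s) w).
rewrite normrN in T.
have {}T := T (fun y _ => is_derive_hkx y s0) (fun y _ => is_derive_hk1 y s0)
  (fun y _ => is_derive_hk2 y s0).
rewrite [X in `|X| <= _](_ : _ = hk s (w + - z) - hk s w - - z * hk1 s w - (- z) ^+ 2 / 2 * hk2 s w);
  last by field.
rewrite (le_trans (T _))//; last first.
  by rewrite le_eqVlt; apply/orP; left; apply/eqP; ring.
move=> y yz; rewrite (le_trans (hk3_le r0 y))//.
have r3 : 0 <= hkC / r ^+ 3 by rewrite divr_ge0// exprn_ge0// ltW.
by have := hk_near r0 (le_trans yz zr) => /(ler_wpM2l r3); lra.
Qed.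

(** Since [t <= s], intermediate times stay between [s] and [2 * s], where [hk_later] dominates the
    derivatives by one kernel at time [4 * s]. *)
Lemma conv_hk_time m f x t : bm m f -> 0 <= t <= s ->
  `|conv (hk (s + t)) f x - psi f x| <= m * ((2 * hkC) * (t / s)) /\
  `|conv (hk (s + t)) f x - psi f x - t * conv (hk2 s) f x| <=
    m * ((2 * hkC) * (t ^+ 2 / s ^+ 2)).
Proof.
move=> mf /andP[t0 ts].
have [ik _ _] := density_hk s0.
have st0 : 0 < s + t by rewrite ltr_wpDr.
have [ikt _ _] := density_hk st0.
have [ik2 _] := conv_hk2 x mf.
have sqy y : s <= y -> (0 < Num.sqrt y) /\ Num.sqrt y ^+ 2 = y.
  by move=> sy; have y0 := lt_le_trans s0 sy; rewrite sqrtr_gt0 sqr_sqrtr// ltW.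
have range y : s <= y <= s + t -> s <= y <= 2 * s by lra.
have B2 w y : s <= y <= s + t -> `|hk2 y w| <= (2 * hkC) / s * hk (4 * s) w.
  move=> /range syr; have /andP[sy _] := syr; have [q0 qE] := sqy _ sy.
  have := hk2_le q0 w; rewrite qE => /le_trans; apply.
  rewrite (_ : (2 * hkC) / s * _ = hkC / s * (2 * hk (4 * s) w)); last by ring.
  apply: ler_pM; rewrite ?hk_ge0 ?divr_ge0 ?(ltW (lt_le_trans s0 sy))//; last exact: hk_later.
  by rewrite ler_wpM2l// lef_pV2 ?posrE// (lt_le_trans s0).
have Bs w y : s <= y <= s + t -> `|hkss y w| <= (2 * hkC) / s ^+ 2 * hk (4 * s) w.
  move=> /range syr; have /andP[sy _] := syr; have [q0 qE] := sqy _ sy.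
  have := hkss_le q0 w; rewrite (exprM (Num.sqrt y) 2 2) qE => /le_trans; apply.
  rewrite (_ : (2 * hkC) / s ^+ 2 * _ = hkC / s ^+ 2 * (2 * hk (4 * s) w)); last by ring.
  have y0 := lt_le_trans s0 sy.
  apply: ler_pM; rewrite ?hk_ge0 ?divr_ge0 ?sqr_ge0//; last exact: hk_later.
  by rewrite ler_wpM2l// lef_pV2 ?posrE ?exprn_gt0// ler_pXn2r ?nnegrE// ltW.
have pos y : s <= y <= s + t -> 0 < y by move=> /andP[sy _]; exact: lt_le_trans sy.
have sst : s <= s + t by rewrite lerDl.
have i1 : integ (lincomb 1 (-1) (hk (s + t)) (hk s)) by apply: integD; exact: integZ.
have E1 : conv (hk (s + t)) f x - psi f x =
    conv (lincomb 1 (-1) (hk (s + t)) (hk s)) f x.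
  by rewrite (conv_lincombl _ _ _ ikt ik mf) /psi; ring.
split.
  rewrite E1; apply: (conv_dom _ _ (density_hk s40) _ mf).2; first exact: integ_meas.
  move=> w; rewrite /lincomb mul1r mulN1r.
  have := mvt_itv_le (f := hk^~ w) (df := hk2^~ w) sst
    (fun y yr => is_derive_hks w (pos y yr)) (B2 w).
  rewrite addrAC subrr add0r (ger0_norm t0) => /le_trans; apply.
  by rewrite le_eqVlt; apply/orP; left; apply/eqP; ring.
rewrite E1.
have i2 : integ (lincomb 1 (- t) (lincomb 1 (-1) (hk (s + t)) (hk s)) (hk2 s)).
  by apply: integD; exact: integZ.
rewrite (_ : _ - _ = conv (lincomb 1 (- t) (lincomb 1 (-1) (hk (s + t)) (hk s)) (hk2 s)) f x);
  last by rewrite (conv_lincombl _ _ _ i1 ik2 mf); ring.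
apply: (conv_dom _ _ (density_hk s40) _ mf).2; first exact: integ_meas.
move=> w; rewrite /lincomb !mul1r mulN1r.
pose G y := hk y w - y * hk2 s w.
have DG y : s <= y <= s + t -> is_derive y 1 G (hk2 y w - hk2 s w).
  move=> yr; have h := is_derive_hks w (pos y yr); rewrite /G.
  by apply: is_derive_eq; rewrite /GRing.scale/=; ring.
have GB y : s <= y <= s + t ->
    `|hk2 y w - hk2 s w| <= (2 * hkC) / s ^+ 2 * hk (4 * s) w * t.
  move=> /andP[sy yt].
  have sub v : s <= v <= y -> s <= v <= s + t by move=> /andP[-> vy]; exact: le_trans yt.
  have := mvt_itv_le (f := hk2^~ w) (df := hkss^~ w) sy
    (fun v vr => is_derive_hk2s w (pos v (sub v vr))) (fun v vr => Bs w v (sub v vr)).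
  move=> /le_trans; apply; rewrite ger0_norm ?subr_ge0// ler_wpM2l ?lerBlDl//.
  by rewrite mulr_ge0 ?hk_ge0// divr_ge0 ?sqr_ge0// mulr_ge0.
have := mvt_itv_le sst DG GB; rewrite [in leRHS]addrAC subrr add0r (ger0_norm t0).
rewrite (_ : G (s + t) - G s = hk (s + t) w + - hk s w + - t * hk2 s w); last first.
  by rewrite /G; ring.
move=> /le_trans; apply.
by rewrite le_eqVlt; apply/orP; left; apply/eqP; ring.
Qed.

End radius.
End gaussian_averages.

(** * Lindeberg comparison *)

Section lindeberg.
Context {R : realType}.
Local Notation mu := (@lebesgue_measure R).
Local Notation hk := (@heat_kernel R).
Implicit Types (f : R -> R) (m r s x y z h t : R).

Variable J : R -> R.
Hypothesis dJ : density J.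
Hypothesis J_even : forall x, J (- x) = J x.
Hypothesis iJ2 : integ (fun z => J z * z ^+ 2).
Hypothesis iJ3 : integ (fun z => J z * `|z| ^+ 3).

Let A : R := 2^-1 * (\int[mu]_z (J z * z ^+ 2))%R.
Let J3 : R := (\int[mu]_z (J z * `|z| ^+ 3))%R.
Hypothesis A0 : 0 < A.

Let hC2 := @hkC_ge2 R.
Let hC0 : 0 <= @hkC R. Proof. by move: hC2; lra. Qed.

Let J_ge0 z : 0 <= J z. Proof. by have [] := dJ. Qed.
Let J30 : 0 <= J3.
Proof. by apply: Rintegral_ge0 => z _; rewrite mulr_ge0// exprn_ge0. Qed.

Lemma integ_J1 : integ (fun z => J z * z).
Proof.
have [iJ _ _] := dJ.
apply: (integ_dom _ (integD iJ iJ2)).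
  by apply: measurable_funM => //; exact: integ_meas.
move=> z; rewrite normrM (ger0_norm (J_ge0 z)) -[X in _ <= X + _]mulr1 -mulrDr.
by rewrite ler_wpM2l// ler_norml; apply/andP; split; nra.
Qed.

Lemma Int_J1 : (\int[mu]_z (J z * z))%R = 0.
Proof.
have := Int_opp (integ_meas integ_J1).
rewrite (Int_ext (g := fun z => -1 * (J z * z))) => [|z]; last first.
  by rewrite J_even; ring.
by rewrite (IntZ _ integ_J1) => /eqP; rewrite mulN1r -subr_eq0 -opprD oppr_eq0
  -mulr2n mulrn_eq0 => /eqP.
Qed.

(** Taylor's formula integrated against [J]: the first moment vanishes by evenness, half the second
    moment is [A], and the third absolute moment controls the remainder. *)
Lemma conv_J_heat r m f x : 0 < r -> bm m f ->
  `|conv J (conv (hk (r ^+ 2)) f) x - conv (hk (r ^+ 2)) f x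
    - A * conv (hk2 (r ^+ 2)) f x| <= m * (4 * hkC * (J3 / r ^+ 3)).
Proof.
move=> r0 mf; have [iJ _ J1] := dJ.
have s0 : 0 < r ^+ 2 by rewrite exprn_gt0.
set psi := conv (hk _) f; set c1 := conv (hk1 (r ^+ 2)) f x.
set c2 := conv (hk2 _) f x.
have mpsi : bm m psi := (markov_conv (density_hk s0)).1 _ _ mf.
have i1 := integ_conv x iJ mpsi.
have i2 := integZ (psi x) iJ.
have i3 := integZ c1 integ_J1.
have i4 := integZ (c2 / 2) iJ2.
have -> : conv J psi x - psi x - A * c2 =
    (\int[mu]_z (J z * (psi (x + z) - psi x + z * c1 - z ^+ 2 / 2 * c2)))%R.
  rewrite (Int_ext (g := fun z => ((J z * psi (x + z) - psi x * J z)
      + c1 * (J z * z)) - c2 / 2 * (J z * z ^+ 2))) => [|z]; last by ring.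
  rewrite (IntB (integD (integB i1 i2) i3) i4) (IntD (integB i1 i2) i3) (IntB i1 i2).
  rewrite (IntZ _ iJ) (IntZ _ integ_J1) (IntZ _ iJ2) J1 Int_J1 /A /conv; ring.
have -> : m * (4 * hkC * (J3 / r ^+ 3)) =
    (\int[mu]_z (m * (4 * hkC / r ^+ 3) * (J z * `|z| ^+ 3)))%R.
  by rewrite (IntZ _ iJ3) /J3; ring.
apply: Int_norm_dom; last 2 first.
- exact: integZ.
- move=> z; rewrite normrM (ger0_norm (J_ge0 z)).
  rewrite (le_trans (ler_wpM2l (J_ge0 z) (conv_hk_taylor r0 x z mf)))//.
  by rewrite le_eqVlt; apply/orP; left; apply/eqP; ring.
have := integB (integD (integB i1 i2) i3) i4; congr integ; apply/funext => z.
by ring.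
Qed.

(** One step of the walk and the heat flow over time [A * h] share the expansion with first order
    term [A * h * conv (hk2 (r ^+ 2)) f x]; the two errors are the two remainders. *)
Lemma walk_step r m f x h : 0 < r -> bm m f -> 0 <= h -> A * h <= r ^+ 2 ->
  `|walk J h (conv (hk (r ^+ 2)) f) x - conv (hk (r ^+ 2 + A * h)) f x| <=
    m * (4 * hkC * J3 * h / r ^+ 3 + 2 * hkC * (A * h) ^+ 2 / r ^+ 4).
Proof.
move=> r0 mf h0 hr; have m0 := bm_ge0 mf.
have Ah0 : 0 <= A * h by rewrite mulr_ge0// ltW.
have B1 := conv_J_heat x r0 mf.
have [|_ B2] := conv_hk_time r0 x mf (t := A * h); first by rewrite Ah0.
rewrite /walk /lincomb.
set P := conv (hk (r ^+ 2)) f x in B1 B2 *; set Q := conv J _ x in B1 *.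
set S := conv (hk (_ + _)) f x in B2 *; set c2 := conv (hk2 _) f x in B1 B2.
rewrite (_ : _ - S = h * (Q - P - A * c2) - (S - P - A * h * c2)); last by ring.
rewrite (le_trans (ler_normB _ _))// [leRHS]mulrDr lerD//.
  rewrite normrM (ger0_norm h0) (le_trans (ler_wpM2l h0 B1))//.
  by rewrite le_eqVlt; apply/orP; left; apply/eqP; ring.
rewrite (le_trans B2)// -exprM.
by rewrite le_eqVlt; apply/orP; left; apply/eqP; ring.
Qed.

(** Earlier errors do not grow, as the walk contracts the sup norm. The Gaussian time only increases
    from [r ^+ 2], so each step costs at most the error [e] of the first. *)
Lemma walk_heat_iter r m f x h n : 0 < r -> bm m f -> 0 <= h <= 1 ->
  A * h <= r ^+ 2 ->
  `|iter n (walk J h) (conv (hk (r ^+ 2)) f) x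
    - conv (hk (r ^+ 2 + A * (n%:R * h))) f x| <=
  n%:R * (m * (4 * hkC * J3 * h / r ^+ 3 + 2 * hkC * (A * h) ^+ 2 / r ^+ 4)).
Proof.
move=> r0 mf h01 hr; have m0 := bm_ge0 mf; have [h0 h1] := andP h01.
set e := m * _.
have mW := markov_walk dJ h01.
elim: n x => [|n IH] x; first by rewrite !mul0r mulr0 addr0 subrr normr0.
have nh0 : 0 <= n%:R * h by rewrite mulr_ge0.
set sn := r ^+ 2 + A * (n%:R * h) in IH.
have sr : r ^+ 2 <= sn by rewrite lerDl mulr_ge0// ltW.
have sn0 : 0 < sn by rewrite (lt_le_trans _ sr)// exprn_gt0.
pose q := Num.sqrt sn.
have q0 : 0 < q by rewrite sqrtr_gt0.
have qE : q ^+ 2 = sn by rewrite sqr_sqrtr// ltW.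
have rq : r <= q by rewrite -[leLHS](gtr0_norm r0) -sqrtr_sqr; exact: ler_wsqrtr.
have mpsi s : 0 < s -> bm m (conv (hk s) f).
  by move=> s0; exact: (markov_conv (density_hk s0)).1 _ _ mf.
have r20 : 0 < r ^+ 2 by rewrite exprn_gt0.
have mI : bm m (iter n (walk J h) (conv (hk (r ^+ 2)) f)).
  exact: (markov_iter n mW).1 _ _ (mpsi _ r20).
have hq : A * h <= q ^+ 2 by rewrite qE (le_trans hr).
have St := walk_step x q0 mf h0 hq.
rewrite qE in St.
have Se : `|walk J h (conv (hk sn) f) x - conv (hk (sn + A * h)) f x| <= e.
  rewrite (le_trans St)// /e ler_wpM2l// lerD//.
    rewrite ler_wpM2l ?mulr_ge0// lef_pV2 ?posrE ?exprn_gt0//.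
    by rewrite ler_pXn2r ?nnegrE ?(ltW r0) ?(ltW q0).
  apply: ler_wpM2l; first by rewrite mulr_ge0 ?sqr_ge0 ?mulr_ge0.
  rewrite lef_pV2 ?posrE ?exprn_gt0//.
  by rewrite ler_pXn2r ?nnegrE ?(ltW r0) ?(ltW q0).
have snE : r ^+ 2 + A * (n.+1%:R * h) = sn + A * h by rewrite /sn -natr1; ring.
rewrite snE iterS.
have mD : bm (n%:R * e) (lincomb 1 (-1) (iter n (walk J h) (conv (hk (r ^+ 2)) f))
    (conv (hk sn) f)).
  split; first exact: (bm_lincomb 1 (-1) mI (mpsi _ sn0)).1.
  by move=> y; rewrite /lincomb mul1r mulN1r; exact: IH.
have D := (mW.1 _ _ mD).2 x.
rewrite (mW.2 _ _ _ _ _ _ mI (mpsi _ sn0)) /lincomb mul1r mulN1r in D.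
set X := walk J h _ x in D *; set Y := walk J h _ x in D Se.
set Z := conv _ f x in Se *.
rewrite (_ : X - Z = (X - Y) + (Y - Z)); last by ring.
by rewrite (le_trans (ler_normD _ _))// -natr1 mulrDl mul1r lerD.
Qed.

Lemma Int_norm_hk r : 0 < r -> integ (fun w => `|w| * hk (r ^+ 2) w) /\
  (\int[mu]_w (`|w| * hk (r ^+ 2) w) <= 2 * hkC * r)%R.
Proof.
move=> r0; have s0 : 0 < r ^+ 2 by rewrite exprn_gt0.
have s20 : 0 < 2 * r ^+ 2 by rewrite mulr_gt0.
have [ik k0 k1] := density_hk s0; have [ik2 _ k21] := density_hk s20.
have iw : integ (fun w => `|w| * hk (r ^+ 2) w).
  apply: (integ_dom _ (integZ (2 * hkC * r) ik2)).
    apply: measurable_funM; last exact: integ_meas.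
    exact: (@measurableT_comp _ _ _ _ _ _ _ _ _ (@normr_measurable R setT)
      (@measurable_id _ R setT)).
  by move=> w; rewrite normrM normr_id (ger0_norm (k0 w)) (norm_hk_le r0).
split=> //.
have -> : 2 * hkC * r = (\int[mu]_w (2 * hkC * r * hk (2 * r ^+ 2) w))%R.
  by rewrite IntZ// k21 mulr1.
by apply: le_Int => //; [exact: integZ|move=> w; exact: (norm_hk_le r0)].
Qed.

Variables (k : R -> R) (c d : R).
Hypothesis dk : density k.
Hypothesis c01 : 0 < c <= 2^-1.
Hypothesis d0 : 0 < d.
Hypothesis ckJ : minorizes J k c d.

(* Smoothing the datum by a heat kernel of small time changes little, since the
   walk is almost translation invariant. *)
Lemma walk_smooth r m f x h n : 0 < r -> bm m f -> 0 < h <= 2^-1 -> (0 < n)%N ->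
  `|iter n (walk J h) (conv (hk (r ^+ 2)) f) x - iter n (walk J h) f x| <=
    4 * m / Num.sqrt (n%:R * h * c / 2) * (1 + 2 * hkC * r / d).
Proof.
move=> r0 mf h02 n0; have s0 : 0 < r ^+ 2 by rewrite exprn_gt0.
have h01 : 0 <= h <= 1 by lra.
have mW := markov_walk dJ h01.
have mWf := (markov_iter n mW).1 _ _ mf.
have [ik k0 k1] := density_hk s0.
have [iw wB] := Int_norm_hk r0.
rewrite (commut_iter n mW (commut_walk_conv dJ h (density_hk s0)) mf).
set w := iter n _ f in mWf *; set S := 4 * m / _.
have S0 : 0 <= S by rewrite divr_ge0 ?sqrtr_ge0// mulr_ge0// (bm_ge0 mf).
have i1 := integ_conv x ik mWf.
have i2 := integZ (w x) ik.
have -> : conv (hk (r ^+ 2)) w x - w x =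
    (\int[mu]_z (hk (r ^+ 2) z * w (x + z) - w x * hk (r ^+ 2) z))%R.
  by rewrite IntB// (IntZ _ ik) k1 mulr1.
have i3 : integ (fun z => S * hk (r ^+ 2) z + S / d * (`|z| * hk (r ^+ 2) z)).
  by apply: integD; exact: integZ.
apply: (@le_trans _ _ (\int[mu]_z (S * hk (r ^+ 2) z
    + S / d * (`|z| * hk (r ^+ 2) z)))%R).
  apply: Int_norm_dom => //; first exact: integB.
  move=> z; rewrite (_ : _ - _ = hk (r ^+ 2) z * (w (x + z) - w x)); last by ring.
  rewrite normrM (ger0_norm (k0 z)).
  rewrite (le_trans (ler_wpM2l (k0 z) (walk_tau dJ x z dk c01 d0 ckJ h02 mf n0)))//.
  by rewrite -/S le_eqVlt; apply/orP; left; apply/eqP; ring.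
rewrite IntD; [|exact: integZ|exact: integZ].
rewrite (IntZ _ ik) (IntZ _ iw) k1 mulr1 mulrDr mulr1 lerD2l.
rewrite (_ : S * (2 * hkC * r / d) = S / d * (2 * hkC * r)); last by ring.
by rewrite ler_wpM2l// divr_ge0// ltW.
Qed.

End lindeberg.

(** * Large time limits of the walk *)

Section walk_limits.
Context {R : realType}.
Local Notation mu := (@lebesgue_measure R).
Local Notation hk := (@heat_kernel R).
Implicit Types (f g : R -> R) (m r s x y z h t v : R).

(** The minimum of the two available bounds on the distance of an iterate to its limit, up to
    constants: the comparison with the heat kernel, useful for moderate [x], and the trivial one far
    away. *)
Let weight v x : R := Num.min 1 ((1 + `|x|) / v).

Let weight01 v x : 0 < v -> 0 <= weight v x <= 1.
Proof.
move=> v0; rewrite /weight le_min ler01/= divr_ge0 ?addr_ge0 ?(ltW v0)//=.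
by rewrite ge_min lexx.
Qed.

Lemma measurable_weight v : measurable_fun [set: R] (weight v).
Proof.
apply: measurable_minr => //; apply: measurable_funM => //.
exact: measurable_funD.
Qed.

Lemma integ_weight v f : 0 < v -> integ f -> integ (fun x => `|f x| * weight v x).
Proof.
move=> v0 iF; apply: (integ_bm (m := 1) (integ_norm iF)).
split; first exact: measurable_weight.
by move=> x; have /andP[w0 w1] := weight01 x v0; rewrite ger0_norm.
Qed.

(** Dominated convergence along integers; the weight decreases in [v], which gives all larger
    [v]. *)
Lemma weight_small f e : integ f -> 0 < e -> exists2 V, 0 < V &
  forall v, V <= v -> (\int[mu]_x (`|f x| * weight v x) <= e)%R.
Proof.
move=> iF e0; have mf := integ_meas iF.
have wn n : 0 < n.+1%:R :> R by rewrite ltr0n.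
have mF n : measurable_fun [set: R] (fun x => (`|f x| * weight n.+1%:R x)%:E).
  by apply/measurable_EFinP; exact: (integ_meas (integ_weight (wn n) iF)).
have cv x : (`|f x| * weight n.+1%:R x)%:E @[n --> \oo] --> (0 : \bar R).
  apply/fine_cvgP; split; first by (apply: nearW).
  apply/cvgrPdist_le => d d0.
  have D0 : 0 <= `|f x| * (1 + `|x|) / d by rewrite !mulr_ge0 ?addr_ge0 ?invr_ge0// ltW.
  exists (Num.truncn (`|f x| * (1 + `|x|) / d)).+1 => // n /= nN.
  have /andP[w0 w1] := weight01 x (wn n).
  rewrite sub0r normrN ger0_norm ?mulr_ge0//.
  apply: (@le_trans _ _ (`|f x| * ((1 + `|x|) / n.+1%:R))).
    by rewrite ler_wpM2l// /weight ge_min lexx orbT.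
  have T : `|f x| * (1 + `|x|) / d <= n.+1%:R.
    by apply: (le_trans (ltW (truncnS_gt _))); rewrite ler_nat (leq_trans nN).
  by move: T; rewrite ler_pdivrMr// mulrA ler_pdivrMr// (mulrC d).
have [] := dominated_convergence (D := setT) (f := cst 0) (g := fun x => `|f x|%:E)
    (mu := mu) measurableT mF _ _ _ _.
- exact: measurable_cst.
- by apply: aeW => x _; exact: cv.
- exact: integ_norm.
- apply: aeW => x n _ /=; have /andP[w0 w1] := weight01 x (wn n).
  by rewrite lee_fin ger0_norm ?mulr_ge0// ler_piMr.
move=> _ _; rewrite integral0 => /fine_cvgP[_] /cvgrPdist_le /(_ e e0) [N _ HN].
exists N.+1%:R => [|v Nv]; first by rewrite ltr0n.
have := HN N (leqnn N).
rewrite sub0r normrN /= => /(le_trans (ler_norm _)); apply: le_trans.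
have v0 : 0 < v by exact: lt_le_trans Nv.
apply: le_Int; [exact: integ_weight|exact: integ_weight|move=> x].
rewrite ler_wpM2l// /weight le_min !ge_min lexx/=; apply/orP; right.
by rewrite ler_wpM2l ?addr_ge0// lef_pV2 ?posrE.
Qed.

Variable J : R -> R.
Hypothesis dJ : density J.
Hypothesis J_even : forall x, J (- x) = J x.
Hypothesis iJ2 : integ (fun z => J z * z ^+ 2).
Hypothesis iJ3 : integ (fun z => J z * `|z| ^+ 3).
Variable A : R.
Hypothesis AE : A = 2^-1 * (\int[mu]_z (J z * z ^+ 2))%R.
Hypothesis A0 : 0 < A.
Variables (k : R -> R) (c d : R).
Hypothesis dk : density k.
Hypothesis c01 : 0 < c <= 2^-1.
Hypothesis d0 : 0 < d.
Hypothesis ckJ : minorizes J k c d.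

Let hC2 := @hkC_ge2 R.
Let hC0 : 0 <= @hkC R. Proof. by move: hC2; lra. Qed.

(* With [t = v ^ 8] the datum is smoothed by the heat kernel of time [v ^ 6],
   which balances the errors of [walk_smooth] and [walk_heat_iter]. *)
Lemma walk_heat : exists K V, [/\ 0 <= K, 2 <= V &
  forall v n m f x, V <= v -> v ^+ 16 <= n%:R -> bm m f ->
  `|iter n (walk J (v ^+ 8 / n%:R)) f x - conv (hk (A * v ^+ 8)) f 0| <=
    m * (K * ((1 + `|x|) / v))].
Proof.
set J3 := (\int[mu]_z (J z * `|z| ^+ 3))%R.
have J30 : 0 <= J3.
  by apply: Rintegral_ge0 => z _; rewrite mulr_ge0 ?exprn_ge0//; case: dJ.
have c0 : 0 < c by have /andP[] := c01.
pose q := Num.sqrt (c / 2).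
have q0 : 0 < q by rewrite sqrtr_gt0 divr_gt0.
pose a := Num.sqrt A; have a0 : 0 < a by rewrite sqrtr_gt0.
have aE : a ^+ 2 = A by rewrite sqr_sqrtr// ltW.
(* One constant for each error: smoothing the datum, walk against heat flow, dropping the extra time
   [v ^+ 6], and moving the point from [x] to 0. *)
pose K1 := 4 / q * (1 + 2 * hkC / d).
pose K2 := 4 * hkC * J3 + 2 * hkC * A ^+ 2.
pose K3 := 2 * hkC / A.
pose K4 := 4 * hkC / a.
have K10 : 0 <= K1.
  rewrite mulr_ge0 ?divr_ge0 ?(ltW q0)// addr_ge0// divr_ge0 ?(ltW d0)//.
  by rewrite mulr_ge0.
have h4 : 0 <= 4 * @hkC R by rewrite mulr_ge0.
have h2k : 0 <= 2 * @hkC R by rewrite mulr_ge0.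
have K20 : 0 <= K2.
  by apply: addr_ge0; apply: mulr_ge0 => //; exact: sqr_ge0.
have K30 : 0 <= K3 by rewrite divr_ge0 ?(ltW A0).
have K40 : 0 <= K4 by rewrite divr_ge0 ?(ltW a0).
(* The threshold yields [v >= 2], so that [h <= 1 / 2]; [v >= A], so that [A * h <= 1]; and
   [v >= 1 / A], so that the extra time [v ^+ 6] is at most [A * v ^+ 8]. *)
exists (K1 + K2 + K3 + K4), (2 + A + A^-1); split.
- exact: (addr_ge0 (addr_ge0 (addr_ge0 K10 K20) K30) K40).
- by rewrite -addrA lerDl addr_ge0 ?invr_ge0 ?(ltW A0).
move=> v n m f x Vv nv mf; have m0 := bm_ge0 mf.
have Ai0 : 0 < A^-1 by rewrite invr_gt0.
have v2 : 2 <= v by move: A0 Ai0 Vv; lra.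
have vA : A <= v by move: A0 Ai0 Vv; lra.
have vAi : A^-1 <= v by move: A0 Ai0 Vv; lra.
have v1 : 1 <= v by lra.
have v0 : 0 < v by lra.
have vX i : 0 < v ^+ i by rewrite exprn_gt0.
have n0' : 0 < n%:R :> R by exact: lt_le_trans nv.
have n0 : (0 < n)%N by move: n0'; rewrite ltr0n.
set h := v ^+ 8 / n%:R.
have nh : n%:R * h = v ^+ 8 by rewrite /h mulrCA divff ?mulr1// gt_eqF.
have h0 : 0 < h by rewrite divr_gt0.
have hv : h <= v^-1.
  rewrite /h ler_pdivrMr// -ler_pdivrMl ?invr_gt0// invrK (le_trans _ nv)//.
  by rewrite -exprS ler_weXn2l.
have h2 : h <= 2^-1 by rewrite (le_trans hv)// lef_pV2 ?posrE.
have h02 : 0 < h <= 2^-1 by rewrite h0.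
have h01 : 0 <= h <= 1 by lra.
have v30 : 0 < v ^+ 3 by [].
have Ah : A * h <= (v ^+ 3) ^+ 2.
  rewrite (@le_trans _ _ 1)//; last by rewrite -exprM exprn_ege1.
  rewrite (le_trans (ler_wpM2l (ltW A0) hv))// ler_pdivrMr// mul1r//.
have B1 := walk_smooth dJ dk c01 d0 ckJ x v30 mf h02 n0.
have A0' := A0; have Ah' := Ah; rewrite AE in A0' Ah'.
have B2 := walk_heat_iter dJ J_even iJ2 iJ3 A0' x n v30 mf h01 Ah'.
rewrite -AE -/J3 in B2.
rewrite nh in B1 B2.
have av0 : 0 < a * v ^+ 4 by rewrite mulr_gt0.
have avE : (a * v ^+ 4) ^+ 2 = A * v ^+ 8 by rewrite exprMn aE -exprM.
have B3 := conv_hk_time av0 x mf (t := v ^+ 6).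
rewrite avE in B3.
have v6A : v ^+ 6 <= A * v ^+ 8.
  rewrite (exprD v 2 6) mulrA ler_peMl ?(ltW (vX 6))//.
  rewrite -ler_pdivrMl// mulr1 (le_trans vAi)// -{1}(expr1 v) ler_weXn2l//.
have {B3}[|B3 _] := B3; first by rewrite (ltW (vX 6)).
have B4 := conv_hk_lip av0 0 x mf.
rewrite avE add0r in B4.
rewrite (_ : (v ^+ 3) ^+ 2 = v ^+ 6) in B1 B2; last by rewrite -exprM.
set P := iter n _ f x in B1 *; set Q := iter n _ (conv _ f) x in B1 B2.
rewrite (addrC (A * v ^+ 8)) in B3.
set S := conv (hk (_ + _)) f x in B2 B3.
set T := conv (hk (A * _)) f x in B3 B4; set U := conv _ f 0 in B4 *.
have x1 : 1 <= 1 + `|x| by rewrite lerDl.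
pose X := (1 + `|x|) / v.
have vX' : v^-1 <= X by rewrite /X ler_peMl// invr_ge0 ltW.
have vV i : (v ^+ i.+1)^-1 <= v^-1.
  by rewrite lef_pV2 ?posrE// -{1}(expr1 v) ler_weXn2l.
have C1 : `|Q - P| <= m * (K1 * X).
  rewrite (le_trans B1)//.
  have -> : Num.sqrt (v ^+ 8 * c / 2) = v ^+ 4 * q.
    by rewrite -mulrA (exprM v 4 2) sqrtrM ?sqr_ge0// sqrtr_sqr gtr0_norm.
  apply: (@le_trans _ _ (m * (K1 * v^-1))); last by rewrite !ler_wpM2l.
  have -> : m * (K1 * v^-1) = 4 * m / (v ^+ 4 * q) * (v ^+ 3 * (1 + 2 * hkC / d)).
    by rewrite /K1; field; rewrite !gt_eqF.
  apply: ler_wpM2l; first by apply: divr_ge0; apply: mulr_ge0 => //; exact: ltW.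
  rewrite mulrDr mulr1 (_ : v ^+ 3 * (2 * hkC / d) = 2 * hkC * v ^+ 3 / d); last by ring.
  by rewrite lerD2r exprn_ege1.
have C2 : `|Q - S| <= m * (K2 * X).
  rewrite (le_trans B2)//.
  apply: (@le_trans _ _ (m * (K2 * v^-1))); last by rewrite !ler_wpM2l.
  have -> : n%:R * (m * (4 * hkC * J3 * h / (v ^+ 3) ^+ 3
      + 2 * hkC * (A * h) ^+ 2 / (v ^+ 3) ^+ 4)) =
      m * (4 * hkC * J3 / v + 2 * hkC * A ^+ 2 * (v ^+ 4 / n%:R)).
    by rewrite /h; field; rewrite !gt_eqF.
  apply: ler_wpM2l => //; rewrite /K2 [leRHS]mulrDl lerD2l.
  apply: ler_wpM2l; first by apply: mulr_ge0 => //; exact: sqr_ge0.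
  rewrite ler_pdivrMr// -ler_pdivrMl ?invr_gt0// invrK -exprS (le_trans _ nv)//.
  by rewrite ler_weXn2l.
have C3 : `|S - T| <= m * (K3 * X).
  rewrite (le_trans B3)//.
  apply: (@le_trans _ _ (m * (K3 * v^-1))); last by rewrite !ler_wpM2l.
  have -> : m * (2 * hkC * (v ^+ 6 / (A * v ^+ 8))) = m * (K3 * (v ^+ 2)^-1).
    by rewrite /K3; field; rewrite !gt_eqF.
  by rewrite ler_wpM2l// ler_wpM2l.
have C4 : `|T - U| <= m * (K4 * X).
  rewrite (le_trans B4)//.
  have -> : m * (4 * hkC * (`|x| / (a * v ^+ 4))) = m * (K4 * (`|x| * (v ^+ 4)^-1)).
    by rewrite /K4; field; rewrite !gt_eqF.
  rewrite !ler_wpM2l// /X; apply: ler_pM => //; first by rewrite invr_ge0 ltW.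
  by rewrite lerDr.
rewrite (_ : P - U = - (Q - P) + (Q - S) + (S - T) + (T - U)); last by ring.
rewrite (le_trans (ler_normD _ _))// -/X.
rewrite [leRHS](_ : _ = m * (K1 * X) + m * (K2 * X) + m * (K3 * X) + m * (K4 * X)); last by ring.
rewrite lerD// (le_trans (ler_normD _ _))// lerD// (le_trans (ler_normD _ _))// lerD//.
by rewrite normrN.
Qed.

(** The dual form of convergence in [L^1]: [conv (hk (A * v ^+ 8)) g 0] is the integral of [g]
    against the heat kernel, and the threshold is uniform over [g] bounded by 1. *)
Lemma walk_L1 f e : integ f -> 0 < e -> exists2 V, 2 <= V & forall v n g,
  V <= v -> v ^+ 16 <= n%:R -> bm 1 g ->
  (`|\int[mu]_x (f x * iter n (walk J (v ^+ 8 / n%:R)) g x)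
    - \int[mu]_x f x * conv (hk (A * v ^+ 8)) g 0| <= e)%R.
Proof.
move=> iF e0; have [K [V1 [K0 V12 H]]] := walk_heat.
have K20 : 0 < K + 2 by rewrite ltr_wpDl.
have [V2 V20 HV2] := weight_small iF (divr_gt0 e0 K20).
exists (Num.max V1 V2) => [|v n g]; first by rewrite le_max V12.
rewrite ge_max => /andP[V1v V2v] nv mg.
have v2 : 2 <= v by exact: le_trans V1v.
have v0 : 0 < v by exact: lt_le_trans v2.
have n0' : 0 < n%:R :> R by apply: lt_le_trans nv; rewrite exprn_gt0.
set h := v ^+ 8 / n%:R.
have h01 : 0 <= h <= 1.
  rewrite divr_ge0 ?exprn_ge0 ?ler0n ?(ltW v0)//= ler_pdivrMr// mul1r.
  rewrite (le_trans _ nv)// ler_weXn2l//; lra.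
have mW := (markov_iter n (markov_walk dJ h01)).1 _ _ mg.
have s0 : 0 < A * v ^+ 8 by rewrite mulr_gt0 ?exprn_gt0.
have mpsi := (markov_conv (density_hk s0)).1 _ _ mg.
set p := conv _ g 0; set w := iter n _ g in mW *.
rewrite -IntZr// -IntB; [|exact: integ_bm mW|]; last first.
  by have := integZ p iF; congr integ; apply/funext => x; rewrite mulrC.
rewrite (@le_trans _ _ ((K + 2) * (e / (K + 2))))//; last first.
  by rewrite mulrCA divff ?mulr1// gt_eqF.
apply: (@le_trans _ _ (\int[mu]_x ((K + 2) * (`|f x| * weight v x)))%R); last first.
  by rewrite IntZ; [rewrite ler_wpM2l ?(ltW K20)// HV2|exact: integ_weight].
apply: Int_norm_dom.
- apply: integB; first exact: integ_bm mW.
  by have := integZ p iF; congr integ; apply/funext => x; rewrite mulrC.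
- exact/integZ/integ_weight.
move=> x; rewrite -mulrBr normrM mulrCA ler_wpM2l//.
have B1 : `|w x - p| <= K * ((1 + `|x|) / v).
  by have := H v n 1 g x V1v nv mg; rewrite mul1r.
have B2 : `|w x - p| <= 2.
  by rewrite (le_trans (ler_normB _ _))// (natrD _ 1 1) lerD//; [exact: mW.2|exact: mpsi.2].
rewrite /weight; have [l1|l1] := leP 1 ((1 + `|x|) / v).
  by rewrite mulr1 (le_trans B2)// lerDr.
rewrite (le_trans B1)// ler_wpM2r// ?lerDl//.
by rewrite divr_ge0 ?addr_ge0// ltW.
Qed.

(** The first [n] steps make the increment [p] of size [t^(-1/2)] in both [L^1] and sup norm;
    [walk_sup] over the other [n] gains the factor again, whence [16 = 4 * 4]. *)
Lemma walk_lip m f h n x y : integ f -> bm m f -> 0 < h <= 2^-1 -> (0 < n)%N ->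
  `|iter (n + n) (walk J h) f (x + y) - iter (n + n) (walk J h) f x| <=
  16 / (n%:R * h * c / 2) * (1 + d^-1) * (1 + `|y| / d) * (m + \int[mu]_x `|f x|)%R.
Proof.
move=> iF mf h02 n0; have h01 : 0 <= h <= 1 by lra.
have mW := markov_walk dJ h01.
have mWf := (markov_iter n mW).1 _ _ mf.
have iWf := (iter_walk_adj dJ J_even n h01 iF mf mf).1.
set W := iter n (walk J h) in mWf iWf *.
pose p := lincomb 1 (-1) (tau y (W f)) (W f).
have pE x' : p x' = W f (x' + y) - W f x' by rewrite /p /lincomb /tau; ring.
have n0' : 0 < n%:R :> R by rewrite ltr0n.
have nhc0 : 0 <= n%:R * h * c / 2.
  have /andP[c0 _] := c01; have /andP[h0 _] := h02.
  by apply: divr_ge0 => //; rewrite !mulr_ge0 ?(ltW c0) ?(ltW h0).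
set S := 4 / Num.sqrt (n%:R * h * c / 2).
have S0 : 0 <= S by rewrite divr_ge0// sqrtr_ge0.
have SE : 16 / (n%:R * h * c / 2) = S * S.
  have E : Num.sqrt (n%:R * h * c / 2) * Num.sqrt (n%:R * h * c / 2) =
      n%:R * h * c / 2 by rewrite -expr2 sqr_sqrtr.
  by rewrite /S mulrACA -invfM E; congr (_ / _); ring.
have mp : bm (S * m * (1 + `|y| / d)) p.
  split; first exact: (bm_lincomb 1 (-1) (bm_tau y mWf) mWf).1.
  move=> x'; rewrite pE (le_trans (walk_tau dJ x' y dk c01 d0 ckJ h02 mf n0))//.
  by rewrite /S le_eqVlt; apply/orP; left; apply/eqP; ring.
have ip : integ p.
  by apply: integD; apply: integZ => //; exact: integ_shift.
have L1p : (\int[mu]_x `|p x| <= S * (1 + `|y| / d) * \int[mu]_x `|f x|)%R.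
  rewrite (Int_ext (g := fun x => `|W f (x + y) - W f x|)) => [|x']; last by rewrite pE.
  exact: (walk_tau_L1 dJ J_even y dk c01 d0 ckJ h02 iF mf n0).
have -> : iter (n + n) (walk J h) f (x + y) - iter (n + n) (walk J h) f x = W p x.
  have E1 := (markov_iter n mW).2 1 (-1) _ _ _ _ (bm_tau y mWf) mWf.
  have E2 := commut_iter n mW (commut_walk_tau dJ h y) mWf.
  by rewrite iterD -/W /p [in RHS]/W E1 E2 /lincomb /tau mul1r mulN1r.
rewrite (le_trans (walk_sup dJ J_even x dk c01 d0 ckJ h02 ip mp n0))//.
rewrite -/S SE.
rewrite (_ : S * S * _ * _ * _ = S * (1 + d^-1) * (S * m * (1 + `|y| / d) +
  S * (1 + `|y| / d) * (\int[mu]_x `|f x|)%R)); last by ring.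
rewrite ler_wpM2l ?lerD2l// mulr_ge0// addr_ge0// invr_ge0 ltW//.
Qed.

End walk_limits.

(** * Properties of the kernel J *)

Section kernel_facts.
Context {R : realType}.
Local Notation mu := (@lebesgue_measure R).

Lemma integ_oneDsqrV : integ (fun x : R => (1 + x ^+ 2)^-1).
Proof.
have p0 (x : R) : 0 < 1 + x ^+ 2 by rewrite ltr_pwDl// sqr_ge0.
have cf : continuous (fun x : R => (oneDsqr x)^-1) := continuous_oneDsqrV.
apply/integrableP; split.
  by apply/measurable_EFinP; exact: continuous_measurable_fun.
have -> : (\int[mu]_x `|((1 + x ^+ 2)^-1)%:E| = \int[mu]_x ((oneDsqr x)^-1)%:E)%E.
  by apply: eq_integral => x _; rewrite /= ger0_norm// invr_ge0 ltW.
rewrite (ge0_symfun_integralT _ cf) => [|x|x]; last 2 first.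
- by rewrite invr_ge0 ltW.
- by rewrite /oneDsqr/= sqrrN.
by rewrite -set_itvcy integral0y_oneDsqr -EFinM ltry.
Qed.

Variable J : R -> R.
Hypothesis J_ge0 : forall x, 0 <= J x.
Hypothesis J_schwartz : schwartz J.
Hypothesis J_int1 : (\int[mu]_s (J s))%R = 1.

Lemma schwartz_continuous : continuous J.
Proof.
move=> x; have [/(_ 0 x) sm _] := J_schwartz.
by apply: differentiable_continuous; exact/derivable1_diffP.
Qed.

Lemma schwartz_measurable : measurable_fun [set: R] J.
Proof. exact: continuous_measurable_fun schwartz_continuous. Qed.

Lemma schwartz_decay i : exists2 C, 0 <= C & forall x, `|x| ^+ i * J x <= C.
Proof.
have [_ /(_ i 0)[C HC]] := J_schwartz.
exists `|C| => // x; rewrite (le_trans _ (ler_norm C))//.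
by have := HC x; rewrite /= (ger0_norm (J_ge0 x)).
Qed.

Lemma schwartz_density : density J.
Proof.
split => //; apply/integrableP; split.
  by apply/measurable_EFinP; exact: schwartz_measurable.
have -> : (\int[mu]_x `|(J x)%:E| = \int[mu]_x (J x)%:E)%E.
  by apply: eq_integral => x _; rewrite /= ger0_norm.
(* The real integral is 0 when the extended one is infinite, so the value 1 forces finiteness. *)
move: J_int1; rewrite /Rintegral.
case: (\int[mu]_x _)%E => [r _|/= /eqP|/= /eqP]; first exact: ltry.
  by rewrite eq_sym oner_eq0.
by rewrite eq_sym oner_eq0.
Qed.

Lemma schwartz_bm : exists C, bm C J.
Proof.
have [C _ HC] := schwartz_decay 0; exists C; split; first exact: schwartz_measurable.
by move=> x; have := HC x; rewrite expr0 mul1r ger0_norm.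
Qed.

Lemma schwartz_J3 : integ (fun z => J z * `|z| ^+ 3).
Proof.
have [C3 C30 H3] := schwartz_decay 3; have [C5 C50 H5] := schwartz_decay 5.
apply: (integ_dom _ (integZ (C3 + C5) integ_oneDsqrV)).
  apply: measurable_funM; first exact: schwartz_measurable.
  by apply: measurable_funX; exact: normr_measurable.
move=> x; have p0 : 0 < 1 + x ^+ 2 by rewrite ltr_pwDl// sqr_ge0.
rewrite ger0_norm ?mulr_ge0 ?exprn_ge0// ler_pdivlMr// mulrDr mulr1.
rewrite lerD//; first by rewrite mulrC.
by rewrite -(real_normK (num_real x)) -mulrA -exprD mulrC.
Qed.

Lemma schwartz_J2 : integ (fun z => J z * z ^+ 2).
Proof.
have [iJ _ _] := schwartz_density.
apply: (integ_dom _ (integD iJ schwartz_J3)).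
  apply: measurable_funM; first exact: schwartz_measurable.
  exact: measurable_funX.
move=> x; rewrite ger0_norm; last by apply: mulr_ge0 => //; exact: sqr_ge0.
rewrite -[X in _ <= X + _]mulr1 -mulrDr; apply: ler_wpM2l => //.
rewrite -(real_normK (num_real x)); have := normr_ge0 x.
move: `|x| => q q0; have [q1|q1] := leP q 1; nra.
Qed.

(** By continuity [J] is at least [eta] on a ball of radius [r = 4 * d] around a point [x0] where it
    is positive. The uniform density on [[x0, x0 + d[], moved by at most [d], stays in that ball;
    its height [1 / d] imposes [c <= eta * d]. *)
Lemma schwartz_minorizes : exists k c d, [/\ density k, 0 < c <= 2^-1, 0 < d &
  minorizes J k c d].
Proof.
have [x0 Jx0] : exists x0, 0 < J x0.
  apply/not_existsP => H; have J0 x : J x = 0.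
    by apply/eqP; rewrite eq_le J_ge0 andbT leNgt; apply/negP/H.
  move: J_int1; rewrite (Int_ext (g := fun=> 0))// Rintegral_cst// mul0r.
  by move/eqP; rewrite eq_sym oner_eq0.
pose eta := J x0 / 2; have eta0 : 0 < eta by rewrite divr_gt0.
have /cvgrPdist_lt /(_ eta eta0) [r /= r0 Hr] := @schwartz_continuous x0.
have Jeta z : `|z - x0| < r -> eta <= J z.
  rewrite distrC => /Hr/= /ltr_distlBl; rewrite /eta => H.
  by rewrite ltW// (le_lt_trans _ H)//; lra.
pose d := r / 4; have d0 : 0 < d by rewrite divr_gt0.
exists (fun z => box d (z - x0)), (Num.min 2^-1 (eta * d)), d; split => //.
- by apply: density_shift; exact: density_box.
- by rewrite lt_min invr_gt0 ltr0n mulr_gt0//= ge_min lexx.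
move=> y yd z.
set c := Num.min _ _.
have c0 : 0 <= c by rewrite le_min invr_ge0 ler0n/= mulr_ge0// ltW.
have cd : c <= eta * d by rewrite ge_min lexx orbT.
rewrite /box indicE; have [zI|] := boolP (z - y - x0 \in _); last first.
  by rewrite !mulr0.
move: zI; rewrite inE/= in_itv/= => /andP[z0 zd].
rewrite mulr1 (@le_trans _ _ eta)//.
  by rewrite ler_pdivrMr.
apply: Jeta; move: yd; rewrite ler_norml => /andP[y1 y2].
by rewrite ltr_norml; apply/andP; split; rewrite /d in y1 y2 zd; lra.
Qed.

(** Both [c k] and its translate by [d] lie below [J], and [z^2 + (z + d)^2 >= d^2 / 2]; so twice
    the second moment is at least [c d^2 / 2]. *)
Lemma schwartz_variance_gt0 : 0 < (\int[mu]_z (J z * z ^+ 2))%R.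
Proof.
have [k [c [d [dk /andP[c0 _] d0 ckJ]]]] := schwartz_minorizes.
have [ik k0 k1] := dk.
have iJ2 := schwartz_J2.
have mk := integ_meas ik.
have P1 z : c * k z <= J z.
  by have := ckJ 0 _ z; rewrite normr0 subr0; apply; exact: ltW.
have P2 z : c * k (z - d) <= J z by apply: ckJ; rewrite gtr0_norm.
have i1 : integ (fun z => c * k z * z ^+ 2).
  apply: (integ_dom _ iJ2) => [|z].
    apply: measurable_funM; first exact: measurable_funM.
    exact: measurable_funX.
  rewrite ger0_norm; first by rewrite ler_wpM2r ?sqr_ge0.
  by apply: mulr_ge0; [exact: mulr_ge0 (ltW c0) _|exact: sqr_ge0].
have i2 : integ (fun z => c * k (z - d) * z ^+ 2).
  apply: (integ_dom _ iJ2) => [|z].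
    apply: measurable_funM; last exact: measurable_funX.
    apply: measurable_funM => //.
    exact: (measurableT_comp mk (measurable_addr (- d))).
  rewrite ger0_norm; first by rewrite ler_wpM2r ?sqr_ge0.
  by apply: mulr_ge0; [exact: mulr_ge0 (ltW c0) _|exact: sqr_ge0].
have B1 : (\int[mu]_z (c * k z * z ^+ 2) <= \int[mu]_z (J z * z ^+ 2))%R.
  by apply: le_Int => // z; rewrite ler_wpM2r ?sqr_ge0.
have B2 : (\int[mu]_z (c * k (z - d) * z ^+ 2) <= \int[mu]_z (J z * z ^+ 2))%R.
  by apply: le_Int => // z; rewrite ler_wpM2r ?sqr_ge0.
have i3 := integ_shift d i2.
rewrite -(Int_shift d (integ_meas i2)) in B2.
have B3 : (\int[mu]_z (c * d ^+ 2 / 2 * k z) <=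
    \int[mu]_z (c * k z * z ^+ 2 + c * k (z + d - d) * (z + d) ^+ 2))%R.
  apply: le_Int; [exact: integZ|exact: integD|move=> z].
  rewrite addrK -mulrDr (_ : c * d ^+ 2 / 2 * k z = c * k z * (d ^+ 2 / 2)); last by ring.
  rewrite ler_wpM2l ?mulr_ge0 ?(ltW c0)// -subr_ge0.
  rewrite (_ : _ - _ = (2 * z + d) ^+ 2 / 2); last by field.
  by rewrite divr_ge0 ?sqr_ge0.
rewrite (IntZ _ ik) k1 mulr1 (IntD i1 i3) in B3.
have : 0 < c * d ^+ 2 / 2 by rewrite divr_gt0// mulr_gt0// exprn_gt0.
by lra.
Qed.

End kernel_facts.

(** * Almost everywhere bounds *)

Section ae_bounds.
Context {R : realType}.
Local Notation mu := (@lebesgue_measure R).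
Implicit Types (f g : R -> R).

(** The excess of [|f|] over [B] is at most [|f - g|] pointwise, so its integral is below every
    positive [e]. This carries the sup bound from the Euler iterates to [u t]. *)
Lemma ae_bound f (B : R) : integ f ->
  (forall e, 0 < e -> exists2 g, integ g /\ (forall x, `|g x| <= B) &
    (\int[mu]_x `|f x - g x| <= e)%R) ->
  {ae mu, forall x, `|f x| <= B}.
Proof.
move=> iF H; have mf := integ_meas iF.
pose P x := Num.max (`|f x| - B) 0.
have P0 x : 0 <= P x by rewrite le_max lexx orbT.
have mP : measurable_fun [set: R] P.
  apply: measurable_maxr => //; apply: measurable_funB => //.
  exact: (integ_meas (integ_norm iF)).
have Pg g x : `|g x| <= B -> P x <= `|f x - g x|.
  move=> gB; rewrite ge_max normr_ge0 andbT.
  by have := ler_normD (f x - g x) (g x); rewrite subrK; lra.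
have iP : integ P.
  have [g [ig gB] _] := H 1 ltr01.
  apply: (integ_dom mP (integ_norm (integB iF ig))) => x.
  by rewrite ger0_norm// Pg.
have IP0 : (\int[mu]_x P x)%R = 0.
  apply/eqP; rewrite eq_le Rintegral_ge0 ?andbT//.
  apply/ler_addgt0Pr => e e0; rewrite add0r.
  have [g [ig gB] ge] := H e e0.
  apply: le_trans ge; apply: le_Int => // [|x]; last exact: Pg.
  exact/integ_norm/integB.
have : (\int[mu]_x `|(P x)%:E|)%E = 0%E.
  transitivity (\int[mu]_x (P x)%:E)%E; last by rewrite (Int_EFin iP) IP0.
  by apply: eq_integral => x _; rewrite /= ger0_norm.
move/(ae_eq_integral_abs mu measurableT (measurable_int _ iP)).
apply: ae_sub => x /(_ I) [] /eqP; rewrite eq_le => /andP[+ _].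
by rewrite ge_max => /andP[]; rewrite subr_le0.
Qed.

Lemma lebesgue_measureT_gt0 : (0 < mu [set: R])%E.
Proof.
apply: (@lt_le_trans _ _ (mu `[0, 1]%classic)).
  by rewrite lebesgue_measure_itv/= lte_fin ltr01 sube0 lte_fin ltr01.
by apply: le_measure; rewrite ?inE.
Qed.

Lemma bounded_version f : f \in Lfun mu 1%E -> f \in Lfun mu +oo%E ->
  exists m g, [/\ bm m g, integ g & {ae mu, forall x, f x = g x}].
Proof.
move=> /Lfun1_integrable iF foo; have mf := integ_meas iF.
have [m0 fm0] : exists m, {ae mu, forall x, `|f x| <= m}.
  move: foo; rewrite inE => /andP[_]; rewrite inE/= /finite_norm unlock/=.
  rewrite lebesgue_measureT_gt0.
  have H := ess_sup_ge mu (abse \o (EFin \o f)).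
  case: (ess_sup _ _) H => [m H _|//|H _].
    by exists m; move: H; apply: ae_sub => x; rewrite /= lee_fin.
  by exists 0; move: H; apply: ae_sub => x; rewrite /= leeNy_eq.
(* Nonnegative, so that the value 0 given to [g] where [f] is too large respects the bound. *)
pose m := `|m0|.
have fm : {ae mu, forall x, `|f x| <= m}.
  by move: fm0; apply: ae_sub => x /le_trans; apply; exact: ler_norm.
pose g x := f x * \1_(`[- m, m]%classic) (f x) : R.
have gE x : `|f x| <= m -> f x = g x.
  move=> fxm; rewrite /g indicE mem_setE in_itv/=.
  by rewrite -ler_norml fxm mulr1.
have mg : measurable_fun [set: R] g.
  apply: measurable_funM => //; apply: (measurableT_comp _ mf).
  exact: measurable_indic.
exists m, g; split.
- split=> // x; rewrite /g indicE mem_setE in_itv/= -ler_norml.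
  by have [fx|_] := leP `|f x| m; rewrite /= ?mulr1// mulr0 normr0 /m.
- by apply: (integ_dom mg (integ_norm iF)) => x; rewrite normrM indicE
    ler_piMr// normr_nat lern1 leq_b1.
- by move: fm; apply: ae_sub => x; exact: gE.
Qed.

End ae_bounds.

(** * Asymptotics in L^1, L^oo and L^p *)

Section asymptotics.
Context {R : realType}.
Local Notation mu := (@lebesgue_measure R).
Local Notation hk := (@heat_kernel R).
Implicit Types (g : R -> R) (t e x y r : R).

Lemma hk_lip r x y : 0 < r ->
  `|hk (r ^+ 2) (x + y) - hk (r ^+ 2) x| <= hkC / r ^+ 2 * `|y|.
Proof.
move=> r0; have s0 : 0 < r ^+ 2 by rewrite exprn_gt0.
have hC0 : 0 <= @hkC R by have := @hkC_ge2 R; lra.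
apply: (mvt_le (df := hk1 (r ^+ 2))) => z _; first exact: is_derive_hkx.
have q0 : 0 < Num.sqrt (2 * r ^+ 2) by rewrite sqrtr_gt0 mulr_gt0.
have qE : Num.sqrt (2 * r ^+ 2) ^+ 2 = 2 * r ^+ 2.
  by rewrite sqr_sqrtr// mulr_ge0// ltW.
rewrite (le_trans (hk1_le r0 z))//.
rewrite (_ : hkC / r ^+ 2 = hkC / r * r^-1); last by field; rewrite gt_eqF.
apply: ler_wpM2l; first by rewrite divr_ge0// ltW.
have := hk_sup q0 z; rewrite qE => /le_trans; apply.
rewrite lef_pV2 ?posrE// -[leLHS](gtr0_norm r0) -sqrtr_sqr; apply: ler_wsqrtr.
by rewrite ler_peMl ?(ltW s0)//; lra.
Qed.

Variable J : R -> R.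
Hypothesis J_ge0 : forall x, 0 <= J x.
Hypothesis J_even : forall x, J (- x) = J x.
Hypothesis J_schwartz : schwartz J.
Hypothesis J_int1 : (\int[mu]_s (J s))%R = 1.
Variables (u du : R -> R -> R).
Hypothesis C1u : C1_L1_derivative u du.
Hypothesis u_eq : forall t : R, 0 < t -> {ae mu, forall x : R,
  du t x = (\int[mu]_y (J (x - y) * (u t y - u t x)))%R}.
Variables (m : R) (f : R -> R).
Hypothesis f_bm : bm m f.
Hypothesis f_int : integ f.
Hypothesis u_f : forall b g, bm b g -> pairing u g 0 = (\int[mu]_x (f x * g x))%R.

Let A := 2^-1 * (\int[mu]_z (J z * z ^+ 2))%R.
Let M := (\int[mu]_x f x)%R.

Let dJ : density J := schwartz_density J_ge0 J_schwartz J_int1.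

Let A0 : 0 < A.
Proof. by rewrite mulr_gt0// schwartz_variance_gt0. Qed.

Lemma solution_asymptotics e : 0 < e -> exists2 T, 0 < T & forall t, T <= t ->
  (\int[mu]_x `|u t x - M * hk (A * t) x| <= e)%R /\
  {ae mu, forall x, `|u t x - M * hk (A * t) x| <= e / Num.sqrt t}.
Proof.
move=> e0.
have [k [c [d [dk c01 d0 ckJ]]]] := schwartz_minorizes J_ge0 J_schwartz J_int1.
have [CJ J_bm] := schwartz_bm J_ge0 J_schwartz.
have iJ2 := schwartz_J2 J_ge0 J_schwartz J_int1.
have iJ3 := schwartz_J3 J_ge0 J_schwartz.
have hC0 : 0 <= @hkC R by have := @hkC_ge2 R; lra.
have m0 := bm_ge0 f_bm; have /andP[c0 _] := c01.
set N1 := (\int[mu]_x `|f x|)%R.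
have N10 : 0 <= N1 by exact: Rintegral_ge0.
have di0 : 0 < d^-1 by rewrite invr_gt0.
have d10 : 0 <= 1 + d^-1 by lra.
(* The constant of [walk_lip] for [n = N + N]: with [N h = t / 2], the quotient [16 / (N h c / 2)]
   is [64 / (c t)]. [K3] adds the Lipschitz constant of [M] times the heat kernel. *)
pose K2 := 64 / c * (1 + d^-1) ^+ 2 * (m + N1).
have K20 : 0 <= K2.
  apply: mulr_ge0; last exact: addr_ge0.
  by apply: mulr_ge0; [rewrite divr_ge0// ltW|exact: sqr_ge0].
pose K3 := K2 + `|M| * (hkC / A).
have K30 : 0 <= K3 by rewrite addr_ge0// mulr_ge0// divr_ge0// ltW.
(* Averaging length [l = b sqrt t]: the average is at most [b^2 / l = b / sqrt t], and the
   oscillation at most [(K3 / sqrt t + K3 b) / sqrt t]. Here [(K3 + 1) b = e / 2], and [T] ensures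
   [K3 / sqrt t <= e / 2]. *)
pose b := e / (2 * (K3 + 1)).
have b0 : 0 < b by rewrite divr_gt0// mulr_gt0// ltr_wpDl.
have b20 : 0 < b ^+ 2 by rewrite exprn_gt0.
pose e1 := Num.min e (b ^+ 2).
have e10 : 0 < e1 by rewrite lt_min e0.
have [V V2 HV] := walk_L1 dJ J_even iJ2 iJ3 erefl A0 dk c01 d0 ckJ f_int e10.
have V0 : 0 < V by lra.
pose T := Num.max (V ^+ 8) ((2 * K3 / e) ^+ 2).
exists T; first by rewrite lt_max exprn_gt0.
move=> t; rewrite ge_max => /andP[tV tK].
have t0 : 0 < t by apply: lt_le_trans tV; rewrite exprn_gt0.
pose q := Num.sqrt t; have q0 : 0 < q by rewrite sqrtr_gt0.
have qE : q ^+ 2 = t by rewrite sqr_sqrtr// ltW.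
pose v := Num.sqrt (Num.sqrt q); have v0 : 0 < v by rewrite !sqrtr_gt0.
have vE : v ^+ 8 = t.
  by rewrite (exprM v 2 4) (exprM _ 2 2) !sqr_sqrtr ?sqrtr_ge0// ltW.
have Vv : V <= v.
  by move: tV; rewrite -vE ler_pXn2r ?nnegrE// ltW.
have qK : 2 * K3 / e <= q.
  move: tK; rewrite -qE ler_pXn2r ?nnegrE ?(ltW q0)//.
  by rewrite divr_ge0 ?mulr_ge0// ltW.
have At0 : 0 < A * t by rewrite mulr_gt0.
have [ih h0 h1] := density_hk At0.
have [Ct Ct0 HC] := euler_error dJ J_even J_bm C1u u_eq t0.
have iu := integ_u C1u (ltW t0).
have iMh : integ (fun x => M * hk (A * t) x) by exact: integZ.
pose D x := u t x - M * hk (A * t) x.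
have iD : integ D by exact: integB.
(* At fixed [t], an iterate [w] within [eta] of [u t] in [L^1] whose two bounds do not depend on
   [eta]. *)
have key eta : 0 < eta -> exists w, [/\ integ w,
    (\int[mu]_x `|u t x - w x| <= eta)%R,
    (\int[mu]_x `|w x - M * hk (A * t) x| <= e1)%R &
    forall x, `|w x - M * hk (A * t) x| <= e / q].
  move=> eta0.
  (* The three terms serve [walk_L1], the condition [h <= 1 / 2], and an Euler error below [eta].
     The number of steps is doubled for [walk_lip]. *)
  pose N := (Num.truncn (v ^+ 16 + 2 * t + Ct / eta)).+1.
  have N0 : 0 < N%:R :> R by rewrite ltr0n.
  have NB : v ^+ 16 + 2 * t + Ct / eta <= N%:R by exact/ltW/truncnS_gt.
  have Ce0 : 0 <= Ct / eta by rewrite divr_ge0// ltW.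
  have v160 : 0 < v ^+ 16 by rewrite exprn_gt0.
  have nN : (N + N)%:R = 2 * N%:R :> R by rewrite natrD; ring.
  set n := (N + N)%N in nN.
  have n0' : 0 < n%:R :> R by rewrite nN mulr_gt0.
  have n0 : (0 < n)%N by rewrite addn_gt0.
  have nv : v ^+ 16 <= n%:R by rewrite nN; lra.
  have nC : Ct / eta <= n%:R by rewrite nN; lra.
  have h02 : 0 < t / n%:R <= 2^-1.
    by rewrite divr_gt0//= ler_pdivrMr// nN; lra.
  have h01 : 0 <= t / n%:R <= 1 by lra.
  set W := iter n (walk J (t / n%:R)).
  have mW := markov_iter n (markov_walk dJ h01).
  have mw : bm m (W f) := mW.1 _ _ f_bm.
  have adj b' g : bm b' g -> integ (W f) /\
      (\int[mu]_x (f x * W g x) = \int[mu]_x (W f x * g x))%R.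
    exact: (iter_walk_adj dJ J_even n h01 f_int f_bm).
  have iw : integ (W f) := (adj _ _ f_bm).1.
  have iDn : integ (fun x => W f x - M * hk (A * t) x) by exact: integB.
  (* [walk_L1] bounds the pairing of [f] with the iterated test function; adjunction rewrites it as
     the pairing of [W f] with [g]. *)
  have L1 : (\int[mu]_x `|W f x - M * hk (A * t) x| <= e1)%R.
    apply: L1_dual => // g mg.
    have := HV v n g Vv nv mg; rewrite vE -/W -/M.
    rewrite (adj _ _ mg).2 /conv.
    congr (`|_| <= _).
    rewrite [RHS](Int_ext (g := fun x => W f x * g x - M * hk (A * t) x * g x));
      last by move=> x; rewrite mulrBl.
    rewrite (IntB (integ_bm iw mg) (integ_bm iMh mg)); congr (_ - _).
    rewrite -(IntZ M (integ_conv 0 ih mg)).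
    by apply: Int_ext => x; rewrite add0r mulrA.
  exists (W f); split => //.
    apply: L1_dual; first exact: integB.
    move=> g mg; have := HC 1 g n mg n0; rewrite -/W mulr1 => HCn.
    have -> : (\int[mu]_x ((u t x - W f x) * g x))%R =
        pairing u g t - pairing u (W g) 0.
      rewrite (u_f (mW.1 _ _ mg)) (adj _ _ mg).2 /pairing.
      rewrite -(IntB (integ_bm iu mg) (integ_bm iw mg)).
      by apply: Int_ext => x; rewrite mulrBl.
    have h1' : t / n%:R <= 1 by lra.
    rewrite (le_trans (HCn h1'))// ler_pdivrMr// mulrC -ler_pdivrMr//.
  move=> x.
  have lip y : `|(W f (x + y) - M * hk (A * t) (x + y)) - (W f x - M * hk (A * t) x)|
      <= K3 * ((1 + `|y|) / t).
    have B1 := walk_lip dJ J_even dk c01 d0 ckJ x y f_int f_bm h02 (ltn0Sn _ : (0 < N)%N).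
    rewrite -/n -/W -/N1 in B1.
    pose r := Num.sqrt (A * t); have r0 : 0 < r by rewrite sqrtr_gt0.
    have rE : r ^+ 2 = A * t by rewrite sqr_sqrtr// ltW.
    have := hk_lip x y r0; rewrite rE => B2.
    set a1 := W f (x + y) in B1 *; set a2 := W f x in B1 *.
    set a3 := hk _ (x + y) in B2 *; set a4 := hk _ x in B2 *.
    rewrite (_ : _ - _ = (a1 - a2) - M * (a3 - a4)); last by ring.
    rewrite (le_trans (ler_normB _ _))// /K3 mulrDl lerD//.
      rewrite (le_trans B1)//.
      have -> : 16 / (N%:R * (t / n%:R) * c / 2) = 64 / c / t.
        by rewrite nN; field; rewrite !gt_eqF.
      have yd : 1 + `|y| / d <= (1 + d^-1) * (1 + `|y|).
        have := mulr_ge0 (normr_ge0 y) (ltW di0).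
        have := normr_ge0 y; lra.
      rewrite (_ : K2 * _ = 64 / c / t * (1 + d^-1) * ((1 + d^-1) * (1 + `|y|)) * (m + N1));
        last by rewrite /K2; ring.
      apply: ler_wpM2r; first exact: addr_ge0.
      by apply: ler_wpM2l => //; rewrite !mulr_ge0 ?invr_ge0 ?(ltW c0) ?(ltW t0).
    rewrite normrM -mulrA ler_wpM2l// (le_trans B2)//.
    rewrite (_ : hkC / A * _ = hkC / (A * t) * (1 + `|y|)); last first.
      by field; rewrite !gt_eqF.
    by rewrite ler_wpM2l ?lerDr// divr_ge0// ltW.
  pose l := b * q; have l0 : 0 < l by rewrite mulr_gt0.
  have [k' bD] : exists k', bm k' (fun x => W f x - M * hk (A * t) x).
    pose r := Num.sqrt (A * t); have r0 : 0 < r by rewrite sqrtr_gt0.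
    have rE : r ^+ 2 = A * t by rewrite sqr_sqrtr// ltW.
    have bh : bm r^-1 (hk (A * t)).
      split=> [|z]; first exact: integ_meas.
      by rewrite ger0_norm// -rE hk_sup.
    exists (`|1| * m + `|- M| * r^-1); have := bm_lincomb 1 (- M) mw bh.
    by congr bm; apply/funext => z; rewrite /lincomb mul1r mulNr.
  have B1 : `|conv (box l) (fun x => W f x - M * hk (A * t) x) x
      - (W f x - M * hk (A * t) x)| <= K3 * ((1 + l) / t).
    apply: (conv_box_close l0 bD) => z /andP[z0 zl].
    rewrite (le_trans (lip z))// ler_wpM2l// ler_wpM2r ?invr_ge0 ?(ltW t0)//.
    by rewrite lerD2l ger0_norm.
  have B2 := conv_box_L1 x l0 iDn bD.
  set F := conv (box l) _ x in B1 B2.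
  set G := W f x - _ in B1 *.
  have B3 : `|F| <= b / q.
    rewrite (le_trans B2)// mulrC ler_pdivrMr// (le_trans L1)//.
    rewrite (_ : b / q * l = b ^+ 2); last by rewrite /l; field; rewrite gt_eqF.
    by rewrite ge_min lexx orbT.
  have B4 : K3 * ((1 + l) / t) <= (e / 2 + K3 * b) / q.
    have -> : K3 * ((1 + l) / t) = (K3 / q + K3 * b) / q.
      by rewrite -qE /l; field; rewrite gt_eqF.
    rewrite ler_pM2r ?invr_gt0// lerD2r ler_pdivrMr// -ler_pdivrMl ?divr_gt0//.
    by rewrite (le_trans _ qK)// le_eqVlt; apply/orP; left; apply/eqP; field; rewrite gt_eqF.
  rewrite (_ : G = F - (F - G)); last by ring.
  rewrite (le_trans (ler_normB _ _))//.
  apply: (@le_trans _ _ (b / q + (e / 2 + K3 * b) / q)).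
    by rewrite lerD// (le_trans B1).
  rewrite -mulrDl ler_pM2r ?invr_gt0//.
  rewrite (_ : b + _ = e / 2 + (K3 + 1) * b); last by ring.
  rewrite (_ : (K3 + 1) * b = e / 2); first by lra.
  by rewrite /b; field; rewrite gt_eqF// ltr_wpDl.
split.
  apply/ler_addgt0Pr => eta eta0.
  have [w [iw w1 w2 _]] := key eta eta0.
  rewrite (Int_ext (g := fun x => `|(w x - M * hk (A * t) x) + (u t x - w x)|));
    last by move=> x; congr `|_|; ring.
  rewrite (le_trans (Int_norm_triangle (integB iw iMh) (integB iu iw)))// lerD//.
  by rewrite (le_trans w2)// ge_min lexx.
apply: (ae_bound iD) => eta eta0.
have [w [iw w1 w2 w3]] := key eta eta0.
exists (fun x => w x - M * hk (A * t) x); first by split => //; exact: integB.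
rewrite (Int_ext (g := fun x => `|u t x - w x|))// => x.
by rewrite /D; congr `|_|; ring.
Qed.

End asymptotics.

(** * Interpolation between L^1 and L^oo *)

Section Lp.
Context {R : realType}.
Local Notation mu := (@lebesgue_measure R).
Implicit Types (D : R -> R) (t e : R) (p : \bar R).

Lemma powR_expR_ln (a x : R) : 0 < a -> a `^ x = expR (x * ln a).
Proof. by move=> a0; rewrite /powR gt_eqF. Qed.

(** With [a = e / sqrt t], the integral of [|D|^r] is at most [a^(r - 1) e]. Its root of order [r]
    is exactly [e] divided by the time weight, so no constant is lost. *)
Lemma Lnorm_interpolation D t e p : integ D -> 0 < t -> 0 < e -> (1 <= p)%E ->
  (\int[mu]_x `|D x| <= e)%R ->
  {ae mu, forall x, `|D x| <= e / Num.sqrt t} ->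
  ((t `^ (2^-1 * (1 - fine p^-1)))%:E * 'N[mu]_p[EFin \o D] <= e%:E)%E.
Proof.
move=> iD t0 e0 p1 D1 Doo.
pose q := Num.sqrt t; have q0 : 0 < q by rewrite sqrtr_gt0.
pose a := e / q; have a0 : 0 < a by rewrite divr_gt0.
case: p p1 => [r r1|_|//]; last first.
  rewrite /= subr0 mulr1 powR12_sqrt; last exact: ltW.
  rewrite unlock lebesgue_measureT_gt0 -lee_pdivlMl//.
  apply/ess_supP; move: Doo; apply: ae_sub => x Dx.
  by rewrite /= -EFinM lee_fin mulrC.
rewrite lee_fin in r1; have r0 : 0 < r by exact: lt_le_trans r1.
have -> : fine (r%:E)^-1 = r^-1 by rewrite inver gt_eqF.
rewrite unlock.
have I : (\int[mu]_x (`|(EFin \o D) x| `^ r) <= (a `^ (r - 1) * e)%:E)%E.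
  have iDn := integ_norm iD.
  apply: (@le_trans _ _ (\int[mu]_x (a `^ (r - 1) * `|D x|)%:E)%E).
    apply: ae_ge0_le_integral => //.
    - by move=> x _; exact: poweR_ge0.
    - rewrite (_ : (fun x => _) = EFin \o (fun x => `|D x| `^ r)); last first.
        by apply/funext.
      apply/measurable_EFinP.
      exact: (measurableT_comp (measurable_powR r) (integ_meas iDn)).
    - by move=> x _; rewrite lee_fin mulr_ge0 ?powR_ge0.
    - by apply/measurable_EFinP; exact: (integ_meas (integZ _ iDn)).
    - move: Doo; apply: ae_sub => x Dx _.
      rewrite /= ?poweR_EFin lee_fin.
      (* The exponent is split as [(r - 1) + 1] through logarithms, so zeros of [D] are set
         apart. *)
      have [->|D0] := eqVneq (D x) 0.
        by rewrite normr0 mulr0 powR0// gt_eqF.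
      have Dp : 0 < `|D x| by rewrite normr_gt0.
      have -> : `|D x| `^ r = `|D x| `^ (r - 1) * `|D x|.
        rewrite !(powR_expR_ln _ Dp) -[X in _ = _ * X]lnK ?posrE// -expRD.
        by congr expR; ring.
      rewrite ler_wpM2r// ge0_ler_powR ?nnegrE ?subr_ge0//.
      exact: ltW.
  rewrite (Int_EFin (integZ _ iDn)) lee_fin IntZ//.
  by rewrite ler_wpM2l// powR_ge0.
have X0 : 0 < a `^ (r - 1) * e by rewrite mulr_gt0// powR_gt0.
have I2 : ((\int[mu]_x (`|(EFin \o D) x| `^ r)) `^ r^-1 <=
    ((a `^ (r - 1) * e) `^ r^-1)%:E)%E.
  rewrite -poweR_EFin; apply: gt0_ler_poweR => //.
  - by rewrite invr_ge0 ltW.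
  - rewrite in_itv/= leey andbT.
    by apply: integral_ge0 => x _; rewrite lee_fin powR_ge0.
  - by rewrite in_itv/= leey andbT lee_fin ltW.
apply: (le_trans (lee_wpmul2l _ I2)); first by rewrite lee_fin powR_ge0.
rewrite -EFinM lee_fin le_eqVlt; apply/orP; left; apply/eqP.
have lnt : ln t = 2 * ln q.
  by rewrite -[in LHS](sqr_sqrtr (ltW t0)) lnXn// mulr_natl.
rewrite (powR_expR_ln _ X0) (powR_expR_ln _ t0) -expRD.
rewrite lnM ?posrE ?powR_gt0// ln_powR /a lnM ?posrE ?invr_gt0// lnV ?posrE// lnt.
rewrite -[RHS](lnK (x := e)) ?posrE//; congr expR.
by field; rewrite gt_eqF.
Qed.

End Lp.

Theorem theorem1p1 (R : realType) (J : R -> R)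
  (J_ge0 : forall x : R, 0 <= J x)
  (J_even : even_fun J)
  (J_schwartz : schwartz J)
  (J_int1 : (\int[@lebesgue_measure R]_s (J s))%R = 1)
  (u0 : R -> R)
  (u0_L1 : u0 \in Lfun (@lebesgue_measure R) 1%E)
  (u0_Loo : u0 \in Lfun (@lebesgue_measure R) +oo%E)
  (u : R -> R -> R)
  (u_sol : nonlocal_diffusion_solution J u0 u)
  (p : \bar R) (p_ge1 : (1 <= p)%E) :
  let M : R := (\int[@lebesgue_measure R]_x (u0 x))%R in
  let A : R := 2^-1 * (\int[@lebesgue_measure R]_z (J z * z ^+ 2))%R in
  ((t `^ (2^-1 * (1 - fine p^-1)))%:E *
   'N[@lebesgue_measure R]_p[EFin \o
      (fun x : R => (u t x - M * heat_kernel (A * t) x)%R)])%E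
    @[t --> +oo%R] --> 0%E.
Proof.
move=> M A.
have [du C1u [u_eq u_0]] := u_sol.
have [m [f [f_bm f_int u0f]]] := bounded_version u0_L1 u0_Loo.
have iu0 : integ u0 by exact/Lfun1_integrable.
(* Passing to the bounded representative [f] of the datum does not change the mass [M]. *)
have [_ ME] := Int_ae iu0 (integ_meas f_int) u0f.
have u_f b g : bm b g ->
    pairing u g 0 = (\int[@lebesgue_measure R]_x (f x * g x))%R.
  move=> mg; have iu := integ_u C1u (lexx 0).
  have mfg := measurable_funM (integ_meas f_int) mg.1.
  apply: (Int_ae (integ_bm iu mg) mfg _).2.
  by apply: (ae_sub2 _ u_0 u0f) => x -> ->.
have Aq : 0 < A.
  by rewrite mulr_gt0// (schwartz_variance_gt0 J_ge0 J_schwartz J_int1).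
have H := solution_asymptotics J_ge0 J_even J_schwartz J_int1 C1u u_eq f_bm f_int u_f.
rewrite -ME -/M -/A in H.
have B e : 0 < e -> \forall t \near +oo%R,
  (0 <= (t `^ (2^-1 * (1 - fine p^-1)))%:E *
   'N[@lebesgue_measure R]_p[EFin \o
      (fun x : R => (u t x - M * heat_kernel (A * t) x)%R)] <= e%:E)%E.
  move=> e0; have [T T0 HT] := H e e0.
  exists T; split => // [|t /ltW tT]; first exact: num_real.
  have t0 : 0 < t by exact: lt_le_trans tT.
  have [H1 H2] := HT t tT.
  have At0 : 0 < A * t by rewrite mulr_gt0.
  have [ih _ _] := density_hk At0.
  apply/andP; split; first by rewrite mule_ge0 ?lee_fin ?powR_ge0// Lnorm_ge0.
  apply: Lnorm_interpolation => //.
  by apply: integB; [exact: (integ_u C1u (ltW t0))|exact: integZ].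
(* Convergence in the extended reals needs eventual finiteness, taken from the bound with
   [e = 1]. *)
apply/fine_cvgP; split.
  apply: filterS (B 1 ltr01) => t /andP[b0 b1].
  by rewrite fin_numElt (lt_le_trans _ b0) ?ltNyr//= (le_lt_trans b1) ?ltry.
apply/cvgrPdist_le => e e0; apply: filterS (B e e0) => t /andP[b0 b1].
rewrite sub0r normrN /= ger0_norm ?fine_ge0// -lee_fin fineK//.
by rewrite fin_numElt (lt_le_trans _ b0) ?ltNyr//= (le_lt_trans b1) ?ltry.
Qed.
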